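(* Let $g,n,r$ be integers with $0\le r<n$ and $2n\le g-1$, and put $\rho=g-(r+1)(g-2n+r)$. Let $C$ be a ribbon of genus $g$ on $\mathbb P^1$, determined by $F=\sum_{i=1}^{g-2}F_it^{-i}$, and let $$\overline W^r_{2n}(C)=\{[G_0,G_1,\dots,G_g]\in\mathbb P^g : \operatorname{rank}\overline{\mathcal A}_F(G)\le n-r\},$$ where $\overline{\mathcal A}_F(G)$ is the $(g-n)\times(n+1)$ matrix with entries $s_{ij}=G_{i+j-1}+(j-1)F_{i+j-2}G_0$ (with $F_0=F_{g-1}=0$). Then: (1) $\overline W^r_{2n}(C)$ is non-empty and has dimension equal to $2n-2r-1$ or $2n-2r$. (2) If $\rho\ge 0$, each irreducible component of $\overline W^r_{2n}(C)$ has dimension at least $\rho$. (3) If $\rho>0$, then $\overline W^r_{2n}(C)$ is connected.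
   Context: Work over an algebraically closed field $k$ of characteristic $0$. A ribbon on $\mathbb P^1$ is a scheme $C$ with an isomorphism $\mathbb P^1\to C_{red}$ such that the ideal sheaf $\mathscr L$ of $\mathbb P^1$ in $C$ satisfies $\mathscr L^2=0$ and is (as a sheaf on $\mathbb P^1$) a line bundle. Its genus is $g=1-\chi(\mathscr O_C)$; equivalently $\mathscr L\cong\mathscr O_{\mathbb P^1}(-g-1)$. Every genus $g$ ribbon is obtained by gluing $\operatorname{Spec}k[s,\epsilon]/\epsilon^2$ and $\operatorname{Spec}k[t,\eta]/\eta^2$ via $\epsilon=t^{-g-1}\eta$, $s^{-1}=t+F(t)\eta$, with $F=\sum_{i=1}^{g-2}F_it^{-i}$, $F_i\in k$; up to isomorphism over $\mathbb P^1$ it depends only on $F$ up to a nonzero scalar, and a choice of $(F_1,\dots,F_{g-2})$ is fixed. ($\overline W^r_{2n}(C)$ is a compactification of the locus $W^r_{2n}(C)$ of degree $2n$ line bundles with $h^0\ge r+1$, which is the part where $G_0\ne0$.) *)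

(* Defs.v *)
From HB Require Import structures.
From mathcomp Require Import all_boot all_order all_algebra generic_quotient.
From mathcomp.multinomials Require Import mpoly.
From mathcomp Require Import boolp classical_sets topology.

Set Implicit Arguments.
Unset Strict Implicit.
Unset Printing Implicit Defensive.

Import Order.TTheory GRing.Theory Num.Theory.
Local Open Scope ring_scope.
Local Open Scope quotient_scope.
Local Open Scope classical_set_scope.

Section TopologicalDimension.
Variable T : topologicalType.
Implicit Types (A Z : set T).

Definition irreducible_set A : Prop :=
  A !=set0 /\
  forall B C : set T, closed B -> closed C ->
    A `<=` B `|` C -> A `<=` B \/ A `<=` C.

Definition irreducible_component A Z : Prop :=
  [/\ irreducible_set Z, Z `<=` A &
      forall Y : set T, irreducible_set Y -> Y `<=` A -> Z `<=` Y -> Y = Z].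

(* Z_0 < ... < Z_m, irreducible and closed in A for the subspace topology. *)
Definition irreducible_chain A (m : nat) (Z : nat -> set T) : Prop :=
  (forall i, (i <= m)%N ->
     irreducible_set (Z i) /\ exists2 C, closed C & Z i = A `&` C) /\
  (forall i, (i < m)%N -> Z i `<` Z i.+1).

(* The Krull dimension of the subspace A is d; no d satisfies this if A is
   empty. *)
Definition has_dim A (d : nat) : Prop :=
  (exists Z : nat -> set T, irreducible_chain A d Z) /\
  (forall m, (exists Z : nat -> set T, irreducible_chain A m Z) -> (m <= d)%N).

End TopologicalDimension.

Section ProjectiveSpace.
Variables (k : fieldType) (g : nat).

Definition homog_coord := {v : 'rV[k]_g.+1 | v != 0}.

(* For nonzero rows, having the same row space is being proportional; see
   proj_pt_eqP below. *)
Definition proportional (u v : homog_coord) : bool := (val u == val v)%MS.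

Lemma proportional_equiv : equivalence_rel proportional.
Proof.
apply/equivalence_relP; split=> [u|u v /eqmxP uv w].
  by apply/eqmxP.
by rewrite /proportional !uv.
Qed.

Lemma proportional_refl : reflexive proportional.
Proof. by move=> u; have [] := proportional_equiv u u u. Qed.

Lemma proportional_sym : ssrbool.symmetric proportional.
Proof. by move=> u v; rewrite /proportional andbC. Qed.

Lemma proportional_trans : transitive proportional.
Proof.
by move=> v u w uv vw; have [_ /(_ uv) ->] := proportional_equiv u v w.
Qed.

Canonical proportional_rel :=
  EquivRel proportional proportional_refl proportional_sym proportional_trans.

(* The closed points of P^g. *)
Definition proj_space := {eq_quot proportional_rel}.

HB.instance Definition _ := Choice.on proj_space.
HB.instance Definition _ := Quotient.on proj_space.

(* [v_0, ..., v_g] *)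
Definition proj_pt (v : homog_coord) : proj_space := \pi_proj_space v.

Definition coords (x : proj_space) : 'rV[k]_g.+1 := val (repr x).

Lemma proj_pt_eqP (u v : homog_coord) :
  proj_pt u = proj_pt v <-> exists2 c : k, c != 0 & val v = c *: val u.
Proof.
split=> [/eqP|[c c0 vE]].
  rewrite /proj_pt eqmodE => /andP[_ /sub_rVP[c vE]]; exists c => //.
  by apply: contraNneq (valP v) => c0; rewrite vE c0 scale0r.
apply/eqP; rewrite /proj_pt eqmodE; apply/eqmxP; rewrite vE.
exact/eqmx_sym/eqmx_scale.
Qed.

Lemma proj_pt_coords (v : homog_coord) :
  exists2 c : k, c != 0 & coords (proj_pt v) = c *: val v.
Proof. by apply/proj_pt_eqP; rewrite /proj_pt reprK. Qed.

Definition homogeneous (p : {mpoly k[g.+1]}) : Prop :=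
  exists d, p \is d.-homog.

Definition peval (p : {mpoly k[g.+1]}) (v : 'rV[k]_g.+1) : k :=
  p.@[fun i => v 0 i].

Lemma peval_scale (p : {mpoly k[g.+1]}) (c : k) (v : 'rV[k]_g.+1) :
  homogeneous p -> c != 0 -> (peval p (c *: v) == 0) = (peval p v == 0).
Proof.
move=> [d /dhomogP hp] c0.
suff -> : peval p (c *: v) = c ^+ d * peval p v.
  by rewrite mulf_eq0 expf_eq0 (negbTE c0) andbF.
rewrite /peval !mevalE big_distrr /= big_seq [RHS]big_seq.
apply: eq_bigr => m /hp /= md; rewrite mulrCA -md mdegE -prodrXr.
rewrite -big_split /=; congr (_ * _).
by apply: eq_bigr => i _; rewrite mxE exprMn.
Qed.

(* By peval_scale the choice of coordinates does not matter. *)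
Definition zero_locus (S : set {mpoly k[g.+1]}) : set proj_space :=
  [set x | forall p, S p -> homogeneous p -> peval p (coords x) = 0].

Definition zariski_open (U : set proj_space) : Prop :=
  exists S : set {mpoly k[g.+1]}, ~` U = zero_locus S.

Lemma zariski_openT : zariski_open setT.
Proof.
exists setT; rewrite setCT; apply/seteqP; split=> // x /(_ 1 I) /=.
have h1 : homogeneous 1 by exists 0%N; exact: dhomog1.
by move=> /(_ h1); rewrite /peval meval1 => /eqP; rewrite oner_eq0.
Qed.

Lemma zariski_openI : setI_closed zariski_open.
Proof.
move=> U V [S US] [S' VS'].
exists [set p | exists q q', [/\ S q, S' q', homogeneous q, homogeneous q' &
  p = q * q']].
rewrite setCI US VS'; apply/seteqP; split=> [x xUV p|x xP].
  move=> [q [q' [Sq Sq' hq hq' ->]]] _; rewrite /peval mevalM.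
  case: xUV => xS; first by rewrite [X in X * _](xS q) ?mul0r.
  by rewrite [X in _ * X](xS q') ?mulr0.
have [xS|] := pselect (zero_locus S x); first by left.
move=> /existsNP[q /not_implyP[Sq /not_implyP[hq /eqP qx]]]; right=> q' Sq' hq'.
have hqq' : homogeneous (q * q').
  case: hq hq' => [d hd] [e he]; exists (d + e)%N; exact: dhomogM.
have := xP _ (ex_intro _ q (ex_intro _ q' (And5 Sq Sq' hq hq' erefl))) hqq'.
by rewrite /peval mevalM => /eqP; rewrite mulf_eq0 (negbTE qx) => /eqP.
Qed.

Lemma zariski_open_bigU (I : Type) (f : I -> set proj_space) :
  (forall i, zariski_open (f i)) -> zariski_open (\bigcup_i f i).
Proof.
move=> /choice[S fS]; exists (\bigcup_i S i).
rewrite setC_bigcup; apply/seteqP; split=> [x xf p [i _ Sp] hp|x xS i _].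
  by have := xf i Logic.I; rewrite fS; exact.
by rewrite fS => p Sp hp; apply: xS => //; exists i.
Qed.

HB.instance Definition _ := isOpenTopological.Build proj_space
  zariski_openT zariski_openI zariski_open_bigU.

Lemma closed_zero_locus (A : set proj_space) :
  closed A <-> exists S : set {mpoly k[g.+1]}, A = zero_locus S.
Proof.
by rewrite -openC; split=> -[S AS]; exists S; rewrite -AS setCK.
Qed.

End ProjectiveSpace.

Section Ribbon.
Variables (k : fieldType) (g : nat).

(* The coefficients (F_1, ..., F_(g-2)) of F = \sum_i F_i t^-i, that is, the
   gluing data eps = t^(-g-1) eta, s^-1 = t + F(t) eta of a genus g ribbon on
   P^1. *)
Definition ribbon_data := ((g - 2).-tuple k)%type.

(* F_m, where F_m = 0 for m = 0 and for m >= g - 1 (the default of nth). *)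
Definition ribbon_coef (F : ribbon_data) (m : nat) : k :=
  if m is m'.+1 then F`_m' else 0.

(* Rows and columns are numbered from 0 here: the entry (i, j) is
   s_(i+1)(j+1) = G_(i+j+1) + j F_(i+j) G_0. *)
Definition ribbon_matrix (n : nat) (F : ribbon_data) (G : 'rV[k]_g.+1) :
    'M[k]_(g - n, n.+1) :=
  \matrix_(i < g - n, j < n.+1)
    (G 0 (inord (i + j).+1) + j%:R * ribbon_coef F (i + j) * G 0 ord0).

Definition Wbar (r n : nat) (F : ribbon_data) : set (proj_space k g) :=
  [set x | exists2 G : homog_coord k g,
     x = proj_pt G & (\rank (ribbon_matrix n F (val G)) <= n - r)%N].

Lemma ribbon_matrixZ n F (c : k) (G : 'rV[k]_g.+1) :
  ribbon_matrix n F (c *: G) = c *: ribbon_matrix n F G.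
Proof. by apply/matrixP=> i j; rewrite !mxE mulrDr mulrCA. Qed.

Lemma Wbar_proj_pt r n F (G : homog_coord k g) :
  Wbar r n F (proj_pt G) <-> (\rank (ribbon_matrix n F (val G)) <= n - r)%N.
Proof.
split=> [[H /proj_pt_eqP[c c0 ->]]|]; last by exists G.
by rewrite ribbon_matrixZ (eqmx_scale _ c0).
Qed.

End Ribbon.

(* Main.v *)
(* Write m = n - r. Weigh the variables so that heavier indices dominate. The
   leading monomial of an (m + 1)-minor is a product of m + 1 variables whose
   indices have gaps >= 2, so modulo the minors every form is spanned by
   monomials in G_0 and m pairs of consecutive variables; the Hilbert function
   then grows with degree at most 2m, hence so does the dimension. For the lower
   bounds, a component of the zero locus of c forms has dimension at least
   g - c: cutting it by hyperplanes down to an isolated point, one counts monomials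
   modulo powers of the maximal ideal of that point. Where the rank is < m,
   adding a multiple of a point of the rational normal curve of G_0 = 0 stays in
   the locus, so the rank is m at some point of each component, where bordering
   an invertible m-minor leaves (r + 1)(g - 2n + r) local equations, which gives
   (2). The m-th secant variety of the rational normal curve in G_0 = 0 is a
   subset of dimension 2m - 1, which gives (1). When rho > 0 every component
   meets the hyperplane G_0 = 0; there the matrix is Hankel, and in
   characteristic 0 the translations t -> t + a degenerate each point to
   [0, ..., 0, 1] inside the locus, which gives (3). *)

Require Import Defs.
From mathcomp Require Import all_boot perm all_order all_algebra.
From mathcomp Require Import generic_quotient.
From mathcomp.multinomials Require Import mpoly.
From mathcomp Require Import boolp classical_sets topology.
From mathcomp Require Import zify ring.

Set Implicit Arguments.
Unset Strict Implicit.
Unset Printing Implicit Defensive.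

Import Order.TTheory GRing.Theory Num.Theory.
Local Open Scope ring_scope.
Local Open Scope classical_set_scope.

(** Dimension is the length of chains of irreducible closed sets, and bounds on it compare the
    growth rates of two counts ([leq_exponent]). A chain of length m yields 'C(d + m, m) independent
    forms in degree d D for a fixed D, so an upper bound asks only for small spanning sets. The
    lower bound depends on the number of equations, and the obstacle is that the (m + 1)-minors are
    far more numerous than the codimension; this is why the rank must first be shown to reach m on
    each component. The same obstacle shapes (1): counting equations for the (g - n) x (n + 1)
    matrix gives at best rho, so the secant variety is cut out by the (g - m) x (m + 1) Hankel
    matrix, where m is one less than the number of columns and g - 2 m equations suffice locally;
    [rank_hankel] then carries it into the locus. The condition rho > 0 enters (3) because a closed
    set that misses G_0 = 0 has a coordinate ring finite over k[G_0], hence dimension at most 0. *)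

Lemma ex_min_measure (T : Type) (Q : T -> Prop) (f : T -> nat) :
  (exists x, Q x) -> exists2 x, Q x & forall y, Q y -> (f x <= f y)%N.
Proof.
move=> [x0 Qx0].
have ex : exists n, `[< exists2 x, Q x & f x = n >].
  by exists (f x0); apply/asboolP; exists x0.
case: (ex_minnP ex) => n /asboolP[x Qx <-] min_n; exists x => // y Qy.
by apply: min_n; apply/asboolP; exists y.
Qed.

(** * Ideals and the Nullstellensatz *)

Section Ideals.
Variable R : comNzRingType.
Implicit Types (I P : set R) (a b h x y : R).

Definition ideal I : Prop :=
  [/\ I 0, forall x y, I x -> I y -> I (x + y) & forall a x, I x -> I (a * x)].

Definition prime_ideal P : Prop :=
  [/\ ideal P, ~ P 1 & forall x y, P (x * y) -> P x \/ P y].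

Definition adjoin I b : set R := [set z | exists a, I (z - a * b)].

Lemma idealN I x : ideal I -> I x -> I (- x).
Proof. by move=> [_ _ IM] Ix; rewrite -mulN1r; apply: IM. Qed.

Lemma idealB I x y : ideal I -> I x -> I y -> I (x - y).
Proof. by move=> iI Ix Iy; have [_ ID _] := iI; apply: ID => //; apply: idealN. Qed.

Lemma idealMr I x y : ideal I -> I x -> I (x * y).
Proof. by move=> [_ _ IM] Ix; rewrite mulrC; apply: IM. Qed.

Lemma ideal_sum I (T : Type) (r : seq T) (Q : pred T) (F : T -> R) :
  ideal I -> (forall i, Q i -> I (F i)) -> I (\sum_(i <- r | Q i) F i).
Proof. by move=> [I0 ID _] IF; elim/big_ind: _. Qed.

Lemma adjoin_ideal I b : ideal I -> ideal (adjoin I b).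
Proof.
move=> [I0 ID IM]; split.
- by exists 0; rewrite mul0r subr0.
- move=> x y [c Ic] [d Id]; exists (c + d).
  by rewrite mulrDl opprD addrACA; apply: ID.
- by move=> a x [c Ic]; exists (a * c); rewrite -mulrA -mulrBr; apply: IM.
Qed.

Lemma sub_adjoin I b : I `<=` adjoin I b.
Proof. by move=> x Ix; exists 0; rewrite mul0r subr0. Qed.

Lemma mem_adjoin I b : ideal I -> adjoin I b b.
Proof. by case=> I0 _ _; exists 1; rewrite mul1r subrr. Qed.

(** An ideal maximal among those that contain I and no power of h is prime: if x and y lie outside
    it, powers of h lie in its sums with (x) and with (y), and their product lies in the ideal as
    soon as x y does. *)
Lemma prime_avoiding I h : ideal I -> (forall M, ~ I (h ^+ M)) ->
  exists P, [/\ prime_ideal P, I `<=` P & ~ P h].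
Proof.
move=> iI hI.
pose good X := [/\ ideal X, I `<=` X & forall M, ~ X (h ^+ M)].
have [|P [Pgood Pmax]] := @Zorn_bigcup R [set X | X = set0 \/ good X].
  move=> F FP Ftot.
  have [[X0 FX0 X0g]|noF] := pselect (exists2 X, F X & good X); last first.
    left; apply/seteqP; split=> // x [X FX Xx]; exfalso.
    case: (FP X FX) => [X0|Xg]; first by rewrite X0 in Xx.
    by apply: noF; exists X.
  have Fg X x : F X -> X x -> good X.
    by move=> FX Xx; case: (FP X FX) => // X0'; rewrite X0' in Xx.
  have [iX0 IX0 _] := X0g.
  right; split; first split.
  - by exists X0 => //; case: iX0.
  - move=> x y [X FX Xx] [Y FY Yy].
    have [iX _ _] := Fg _ _ FX Xx; have [iY _ _] := Fg _ _ FY Yy.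
    have [XY|YX] := Ftot _ _ FX FY.
      by exists Y => //; case: iY => _ D _; apply: D => //; apply: XY.
    by exists X => //; case: iX => _ D _; apply: D => //; apply: YX.
  - move=> a x [X FX Xx]; exists X => //.
    by have [[_ _ M] _ _] := Fg _ _ FX Xx; apply: M.
  - by move=> x Ix; exists X0 => //; apply: IX0.
  - by move=> M [X FX Xx]; have [_ _ /(_ M)] := Fg _ _ FX Xx; apply.
have Ig : good I by split.
have {Pgood} [P0|[iP IP hP]] := Pgood.
  exfalso; apply: (Pmax I); last by right.
  rewrite P0; split => // /(_ 0); apply.
  by case: iI.
have adj x : ~ P x -> exists M, adjoin P x (h ^+ M).
  move=> nPx; apply: contrapT => no.
  apply: (Pmax (adjoin P x)).
    split; first exact: sub_adjoin.
    by move=> /(_ x (mem_adjoin x iP)).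
  right; split; first exact: adjoin_ideal.
    by move=> y /IP /(@sub_adjoin P x).
  by move=> M hM; apply: no; exists M.
exists P; split=> //; last by move=> Ph; apply: (hP 1%N); rewrite expr1.
split=> //.
  by move=> P1; apply: (hP 0%N); rewrite expr0.
move=> x y Pxy; apply: contrapT => /not_orP[nPx nPy].
have [M [c Pc]] := adj _ nPx; have [N [d Pd]] := adj _ nPy.
apply: (hP (M + N)%N); rewrite exprD.
have [_ PD PM] := iP.
have -> : h ^+ M * h ^+ N = (h ^+ M - c * x) * h ^+ N
   + ((c * x) * (h ^+ N - d * y) + (c * d) * (x * y)) by ring.
by apply: (PD); [apply: idealMr | apply: (PD); apply: (PM)].
Qed.

End Ideals.

Section PolyIdeal.
Variable R : idomainType.
Variables (p0 : set R) (p0_prime : prime_ideal p0).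
Implicit Types (I : set {poly R}) (f h : {poly R}).

Let coefs_in f := forall i, p0 f`_i.
Let lead_out f := ~ p0 (lead_coef f).

Lemma coefs_in_monom c i : p0 c -> coefs_in (c *: 'X^i).
Proof.
move=> pc j; rewrite coefZ coefXn; have [[p00 _ pM] _ _] := p0_prime.
by rewrite mulrC; apply: pM.
Qed.

(** Terms with coefficient in p0 belong to I, so leading ones can be stripped off. This is reduction
    to polynomials over R / p0 without forming the quotient. *)
Lemma trim_lead I f : ideal I -> (forall h, coefs_in h -> I h) -> I f ->
  coefs_in f \/ exists h, [/\ I h, lead_out h & (size h <= size f)%N].
Proof.
move=> iI pI; have [[p00 pD pM] _ _] := p0_prime.
have [s] := ubnP (size f); elim: s f => // s IHs f; rewrite ltnS => le_fs If.
have [->|f0] := eqVneq f 0; first by left=> i; rewrite coef0.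
have [plf|] := pselect (p0 (lead_coef f)); last first.
  by move=> nplf; right; exists f.
pose t := lead_coef f *: 'X^((size f).-1).
have It : I t by apply: pI; apply: coefs_in_monom.
have ltsz : (size (f - t)%R < size f)%N.
  have sf : (0 < size f)%N by rewrite size_poly_gt0.
  rewrite -[X in (_ < X)%N](prednK sf) ltnS; apply/leq_sizeP => j le_j.
  rewrite coefB coefZ coefXn; have [->|ne] := eqVneq j (size f).-1.
    by rewrite mulr1 subrr.
  rewrite mulr0 subr0 nth_default //.
  by rewrite -(prednK sf) ltn_neqAle eq_sym ne le_j.
have [||cft|[h [Ih lh le_h]]] := IHs (f - t).
- exact: leq_trans ltsz le_fs.
- exact: idealB.
- left=> i; rewrite -[f](subrK t) coefD; apply: pD => //.
  exact: coefs_in_monom.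
- by right; exists h; split=> //; apply: leq_trans (ltnW ltsz).
Qed.

(** The remainder of the pseudo-division lies in I and is shorter than h, so [trim_lead] and the
    minimality of h force its coefficients into p0. In effect h generates I over the fraction field
    of R / p0. *)
Lemma min_lead_divides I h : ideal I -> (forall f, coefs_in f -> I f) ->
  I h -> lead_out h ->
  (forall f, I f -> lead_out f -> (size h <= size f)%N) ->
  forall f, I f -> exists s q r, [/\ lead_coef h ^+ s *: f = q * h + r,
    coefs_in r & (size r < size h)%N].
Proof.
move=> iI pI Ih lh hmin f If; have [[p00 pD pM] _ _] := p0_prime.
have h0 : h != 0.
  by apply/eqP => h0; apply: lh; rewrite h0 lead_coef0.
have ltrh : (size (f %% h)%R < size h)%N by rewrite ltn_modp.
exists (scalp f h), (f %/ h)%R, (f %% h)%R; split=> //.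
  exact: (@Pdiv.Idomain.divp_eq R f h).
have Ir : I (f %% h)%R.
  have -> : (f %% h)%R = (lead_coef h ^+ scalp f h)%:P * f - (f %/ h)%R * h.
    by rewrite mul_polyC (@Pdiv.Idomain.divp_eq R f h) addrC addKr.
  by case: (iI) => _ _ IM; apply: idealB => //; apply: IM.
have [//|[u [Iu lu le_u]]] := trim_lead iI pI Ir.
have := leq_trans (hmin u Iu lu) le_u.
by rewrite leqNgt ltrh.
Qed.

End PolyIdeal.

Section Muni.
Variables (R : comNzRingType) (n : nat).

Definition mpoly_of_poly : {rmorphism {poly {mpoly R[n]}} -> {mpoly R[n.+1]}} :=
  (horner_eval 'X_ord_max \o map_poly (mwiden (n := n) (R := R)))%FUN.

Lemma muniK : cancel (muni (n := n) (R := R)) mpoly_of_poly.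
Proof.
move=> p; rewrite muniE rmorph_sum [RHS]mpolyE; apply: eq_bigr => m _ /=.
rewrite -!mul_polyC !rmorphM /= /horner_eval !map_polyC /= !hornerE.
rewrite map_polyXn hornerXn mwidenZ mwidenX -scalerAl; congr (_ *: _).
rewrite mpolyXn -mpolyXD; congr 'X_[_]; apply/mnmP => i.
rewrite mnmDE mulmnE mnm1E; case: (unliftP ord_max i) => [j ->|->].
  have -> : lift ord_max j = widen_ord (leqnSn n) j.
    by apply: val_inj; rewrite /= /bump leqNgt ltn_ord.
  rewrite mnmwiden_widen mnmE -val_eqE /= gtn_eqF ?mul0n ?addn0 //.
by rewrite mnmwiden_ordmax eqxx mul1n.
Qed.

End Muni.

Section Nullstellensatz.
Variable k : closedFieldType.

(** A Nullstellensatz that can pass from R to R[X]: some k-point of R lies on the zero set of the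
    prime P but not on that of b. *)
Definition separates (R : comNzRingType) (iota : k -> R) : Prop :=
  forall (P : set R) (b : R), prime_ideal P -> ~ P b ->
  exists phi : {rmorphism R -> k},
    [/\ cancel iota phi, forall x, P x -> phi x = 0 & phi b != 0].

(** A point of R is chosen on the zero set of p0, the contraction of P, and then extended by a value
    x of the variable. If P has all coefficients in p0, any non-root x of the image of b will do;
    otherwise x has to be a root of f, an element of P that generates it up to factors outside
    p0. *)
Lemma separates_poly (R : idomainType) (iota : k -> R) :
  separates iota -> separates (fun c => (iota c)%:P : {poly R}).
Proof.
move=> sepR P b P_prime nPb; have [iP nP1 P_mul] := P_prime.
have [P0 PD PM] := iP.
pose p0 : set R := [set c | P c%:P].
have p0_prime : prime_ideal p0.
  split; [split|exact: nP1|].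
  - by rewrite /p0 /= polyC0.
  - by move=> x y; rewrite /p0 /= polyCD; apply: PD.
  - by move=> a x; rewrite /p0 /= polyCM; apply: PM.
  - by move=> x y; rewrite /p0 /= polyCM; apply: P_mul.
have p0X (f : {poly R}) : (forall i, p0 f`_i) -> P f.
  move=> cf; rewrite -[f]coefK poly_def; apply: ideal_sum => // i _.
  by rewrite -mul_polyC mulrC; apply: PM; apply: cf.
pose psi (phi : {rmorphism R -> k}) (x : k) : {rmorphism {poly R} -> k} :=
  (horner_eval x \o map_poly phi)%FUN.
have psiE phi x f : psi phi x f = (map_poly phi f).[x] by [].
have psiC phi x (c : R) : psi phi x c%:P = phi c.
  by rewrite psiE map_polyC hornerC.
have phi_coefs (phi : {rmorphism R -> k}) (f : {poly R}) :
    (forall x, p0 x -> phi x = 0) -> (forall i, p0 f`_i) -> map_poly phi f = 0.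
  by move=> phi0 cf; apply/polyP=> i; rewrite coef_map coef0; exact: phi0.
have [Pcoef|] := pselect (forall f : {poly R}, P f -> forall i, p0 f`_i).
  have /existsNP[i nbi] : ~ forall i, p0 b`_i by move/p0X.
  have [phi [phiK phi0 phib]] := sepR _ _ p0_prime nbi.
  have /closed_nonrootP[x bx] : map_poly phi b != 0.
    by apply: contraNneq phib => /polyP/(_ i); rewrite coef_map coef0 => /eqP.
  exists (psi phi x); split=> [c|f /Pcoef cf|]; first by rewrite psiC phiK.
    by rewrite psiE phi_coefs // horner0.
  by rewrite psiE.
move=> /existsNP[f1 /not_implyP[Pf1 nf1]].
have ex_f : exists f : {poly R}, P f /\ ~ p0 (lead_coef f).
  by have [//|[h [Ph lh _]]] := trim_lead p0_prime iP p0X Pf1; exists h.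
have [f [Pf lf] fmin'] := ex_min_measure (fun f : {poly R} => size f) ex_f.
have fmin (g : {poly R}) : P g -> ~ p0 (lead_coef g) -> (size f <= size g)%N.
  by move=> Pg lg; apply: fmin'.
have f0 : f != 0.
  by apply/eqP => f0; apply: lf; rewrite f0 lead_coef0 /p0 /= polyC0.
pose I := adjoin P b.
have iI : ideal I by exact: adjoin_ideal.
have p0I (g : {poly R}) : (forall i, p0 g`_i) -> I g.
  by move=> cg; apply/sub_adjoin/p0X.
have ex_h : exists h : {poly R}, I h /\ ~ p0 (lead_coef h).
  by exists f; split=> //; apply: sub_adjoin.
have [h [Ih lh] hmin'] := ex_min_measure (fun h : {poly R} => size h) ex_h.
have hmin (g : {poly R}) : I g -> ~ p0 (lead_coef g) -> (size h <= size g)%N.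
  by move=> Ig lg; apply: hmin'.
have h0 : h != 0.
  by apply/eqP => h0; apply: lh; rewrite h0 lead_coef0 /p0 /= polyC0.
have p0_exp s c : ~ p0 c -> ~ p0 (c ^+ s).
  move=> nc; have [_ n1 pmul] := p0_prime.
  by elim: s => [|s IHs]; rewrite ?expr0 // exprS => /pmul[].
have p0_mul c d : ~ p0 c -> ~ p0 d -> ~ p0 (c * d).
  by move=> nc nd; have [_ _ pmul] := p0_prime; move=> /pmul[].
have P_scale c (g : {poly R}) : ~ p0 c -> P (c *: g) -> P g.
  by move=> nc; rewrite -mul_polyC => /P_mul[].
have div_h := min_lead_divides p0_prime iI p0I Ih lh hmin.
(* If h had positive degree, dividing f by h would put q * h into P. Either q is in P, with smaller
   degree than f, against the choice of f; or h is in P, and since h divides b up to p0 and a factor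
   outside p0, b would be in P. *)
have size_h : size h = 1%N.
  apply/eqP; rewrite eqn_leq size_poly_gt0 h0 andbT leqNgt; apply/negP => h_gt1.
  have [s [q [r [sfE cr lt_r]]]] := div_h f (sub_adjoin b Pf).
  have /P_mul[Pq|Ph] : P (q * h).
    have -> : q * h = (lead_coef h ^+ s)%:P * f - r.
      by rewrite mul_polyC sfE addrK.
    by apply: idealB; [|apply: PM|apply: p0X].
  - have lqh : lead_coef (q * h) = lead_coef h ^+ s * lead_coef f.
      rewrite -lead_coefZ sfE lead_coefDl //.
      apply: (leq_trans lt_r); rewrite leqNgt; apply/negP => lt_qh.
      have : (size (lead_coef h ^+ s *: f) < size f)%N.
        rewrite sfE; apply: (leq_ltn_trans (size_polyD _ _)).
        rewrite gtn_max (leq_trans lt_qh (hmin _ (sub_adjoin b Pf) lf)).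
        exact: leq_trans lt_r (hmin _ (sub_adjoin b Pf) lf).
      by rewrite size_scale ?ltnn // expf_neq0 // lead_coef_eq0.
    have lq : ~ p0 (lead_coef q).
      move=> plq; apply: (p0_mul _ _ (p0_exp s _ lh) lf).
      rewrite -lqh lead_coefM; have [ip _ _] := p0_prime; exact: idealMr.
    have q0 : q != 0.
      by apply/eqP => q0; apply: lq; rewrite q0 lead_coef0 /p0 /= polyC0.
    have := fmin q Pq lq; apply/negP; rewrite -ltnNge.
    have sqh : size (q * h)%R = size f.
      have sfs : size (lead_coef h ^+ s *: f) = size f.
        by rewrite size_scale // expf_neq0 // lead_coef_eq0.
      rewrite -sfs sfE size_polyDl //; apply: (leq_trans lt_r).
      by rewrite size_mul //; move: q0; rewrite -size_poly_gt0; lia.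
    by move: sqh; rewrite size_mul //; lia.
  - have [s2 [q2 [r2 [bE cr2 _]]]] := div_h b (mem_adjoin b iP).
    apply: nPb; apply: (P_scale (lead_coef h ^+ s2)); first exact: p0_exp.
    by rewrite bE; apply: PD; [apply: PM|apply: p0X].
have [c cE] : exists c, h = c%:P.
  by exists h`_0; apply: size1_polyC; rewrite size_h.
have nc : ~ p0 c by move: lh; rewrite cE lead_coefC.
have [phi [phiK phi0 phi_lfc]] := sepR _ _ p0_prime (p0_mul _ _ lf nc).
move: phi_lfc; rewrite rmorphM mulf_eq0 negb_or => /andP[phi_lf phi_c].
(* phi does not kill the leading coefficient of f, and a constant in P lies in p0, so the image of f
   is not constant and has a root. *)
have size_f : (size (map_poly phi f) != 1)%N.
  rewrite size_map_poly_id0 //; apply/eqP => /eqP/size_poly1P[d d0 fE].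
  by apply: lf; move: Pf; rewrite fE lead_coefC.
have /closed_rootP[x fx] := size_f.
have psiP (g : {poly R}) : P g -> psi phi x g = 0.
  move=> Pg.
  have [s [q [r [gE cr _]]]] := min_lead_divides p0_prime iP p0X Pf lf fmin Pg.
  have : psi phi x ((lead_coef f ^+ s)%:P * g) = 0.
    rewrite mul_polyC gE rmorphD rmorphM !psiE.
    by rewrite (phi_coefs _ r) // horner0 addr0 (rootP fx) mulr0.
  rewrite rmorphM psiC rmorphXn => /eqP; rewrite mulf_eq0 expf_eq0.
  by rewrite (negPf phi_lf) andbF => /eqP.
exists (psi phi x); split=> [d||]; [by rewrite psiC phiK|exact: psiP|].
apply: contraNneq phi_c => psib; have [e Pe] := Ih.
have := psiP _ Pe; rewrite rmorphB rmorphM psib mulr0 subr0 cE psiC.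
by move=> ->.
Qed.

Lemma separates_retract (R S : comNzRingType) (iota : k -> R) (iota' : k -> S)
  (T : {rmorphism R -> S}) (T' : {rmorphism S -> R}) :
  cancel T' T -> (forall c, T' (iota' c) = iota c) ->
  separates iota -> separates iota'.
Proof.
move=> TK T'iota sepR P b [[P0 PD PM] nP1 P_mul] nPb.
have preP : prime_ideal (T @^-1` P).
  split; [split|by rewrite /preimage /= rmorph1|].
  - by rewrite /preimage /= rmorph0.
  - by move=> x y Px Py; rewrite /preimage /= rmorphD; apply: PD.
  - by move=> a x Px; rewrite /preimage /= rmorphM; apply: PM.
  - by move=> x y; rewrite /preimage /= rmorphM => /P_mul.
have nPb' : ~ (T @^-1` P) (T' b) by rewrite /preimage /= TK.
have [phi [phiK phi0 phib]] := sepR _ _ preP nPb'.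
exists (phi \o T')%FUN; split=> [c|x Px|//].
  by rewrite /= T'iota phiK.
by apply: phi0; rewrite /preimage /= TK.
Qed.

Lemma separates_mpoly n : separates (@mpolyC n k).
Proof.
elim: n => [|n IHn].
  move=> P b [[P0 _ PM] nP1 P_mul] nPb.
  exists (mcoeff 0%MM); split=> [c|x Px|].
  - exact: mpolyCK.
  - apply/eqP/contraT => x0; exfalso; apply: nP1.
    have -> : 1 = (x@_0%MM)^-1%:MP * x.
      by rewrite [in RHS](nvar0_mpolyC x) -mpolyCM mpolyCK mulVf.
    exact: PM.
  - apply: contra_notN nPb => /eqP b0; by rewrite (nvar0_mpolyC b) b0 mpolyC0.
apply: (@separates_retract _ _ _ _ (mpoly_of_poly k n)
  (muni (n := n) (R := k)) _ _ (separates_poly IHn)) => [p|c].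
  exact: muniK.
exact: muniC.
Qed.

Theorem radical_nullstellensatz n (I : set {mpoly k[n]}) (h : {mpoly k[n]}) :
  ideal I -> (forall v, (forall p, I p -> p.@[v] = 0) -> h.@[v] = 0) ->
  exists M, I (h ^+ M).
Proof.
move=> iI hI; apply: contrapT => /forallNP noM.
have [P [Pprime IP nPh]] := prime_avoiding iI noM.
have [phi [phiK phi0 phih]] := separates_mpoly Pprime nPh.
have phiE p : phi p = p.@[fun i => phi 'X_i].
  rewrite mevalE {1}(mpolyE p) rmorph_sum; apply: eq_bigr => m _ /=.
  rewrite -mul_mpolyC rmorphM /= phiK mpolyXE_id rmorph_prod /=.
  by congr (_ * _); apply: eq_bigr => i _; rewrite rmorphXn.
move: phih; rewrite phiE hI ?eqxx // => p /IP Pp.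
by rewrite -phiE; apply: phi0.
Qed.

End Nullstellensatz.

(** * Hilbert's basis theorem *)

Section Noetherian.
Implicit Types R : comNzRingType.

Definition gen R (a : nat -> R) (m : nat) : set R :=
  [set x | exists c : nat -> R, x = \sum_(i < m) c i * a i].

(** The ascending chain condition in terms of sequences: some term depends on the earlier ones. *)
Definition noetherian R : Prop := forall a : nat -> R, exists m, gen a m (a m).

Lemma gen_ideal R (a : nat -> R) m : ideal (gen a m).
Proof.
split.
- by exists (fun=> 0); rewrite big1 // => i _; rewrite mul0r.
- move=> x y [c ->] [d ->]; exists (fun i => c i + d i).
  by rewrite -big_split; apply: eq_bigr => i _; rewrite mulrDl.
- move=> b x [c ->]; exists (fun i => b * c i).
  by rewrite mulr_sumr; apply: eq_bigr => i _; rewrite mulrA.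
Qed.

Lemma mem_gen R (a : nat -> R) m i : (i < m)%N -> gen a m (a i).
Proof.
move=> lt_im; exists (fun j => (j == i)%:R).
rewrite (bigD1 (Ordinal lt_im)) //= eqxx mul1r big1 ?addr0 // => j ne.
by rewrite -val_eqE /= in ne; rewrite (negPf ne) mul0r.
Qed.

Lemma gen_sub R (a : nat -> R) m (I : set R) :
  ideal I -> (forall i, (i < m)%N -> I (a i)) -> gen a m `<=` I.
Proof.
move=> iI Ia x [c ->]; apply: ideal_sum => // i _.
by case: (iI) => _ _ M; apply: M; apply: Ia.
Qed.

Lemma gen_le R (a : nat -> R) m n : (m <= n)%N -> gen a m `<=` gen a n.
Proof.
move=> le_mn; apply: gen_sub => [|i lt_im]; first exact: gen_ideal.
by apply: mem_gen; apply: leq_trans le_mn.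
Qed.

(** From a sequence without dependence one extracts elements [g n] of minimal degree outside the
    ideal of their predecessors. A dependence among their leading coefficients then produces an
    element of smaller degree. *)
Lemma hilbert_basis R : noetherian R -> noetherian {poly R}.
Proof.
move=> noeR f; apply: contrapT => /forallNP nf.
pose I : set {poly R} := [set x | exists m, gen f m x].
have iI : ideal I.
  split.
  - by exists 0%N; have [] := gen_ideal f 0.
  - move=> x y [m fx] [n fy]; exists (m + n)%N.
    have [_ D _] := gen_ideal f (m + n); apply: (D).
      exact: (gen_le (leq_addr n m)).
    exact: (gen_le (leq_addl m n)).
  - move=> b x [m fx]; exists m; have [_ _ M] := gen_ideal f m; exact: M.
pose next_spec (s : seq {poly R}) h :=
  (forall i, (i < size s)%N -> I s`_i) ->
  [/\ I h, ~ gen (nth 0 s) (size s) h &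
      forall h', I h' -> ~ gen (nth 0 s) (size s) h' -> (size h <= size h')%N].
have /choice[next nextP] : forall s, exists h, next_spec s h.
  move=> s; have [Is|nIs] := pselect (forall i, (i < size s)%N -> I s`_i);
    last by exists 0 => /nIs.
  have ex : exists h, I h /\ ~ gen (nth 0 s) (size s) h.
    have [N sN] : exists N, forall i, (i < size s)%N -> gen f N s`_i.
      have {Is}: forall i, exists m, (i < size s)%N -> gen f m s`_i.
        move=> i; have [lt|] := boolP (i < size s)%N; last by exists 0%N.
        by have [m fm] := Is i lt; exists m.
      move=> /choice[N fN]; exists (\max_(i < size s) N i)%N => i lt_i.
      apply: (gen_le _ (fN i lt_i)).
      by rewrite (leq_bigmax (Ordinal lt_i)).
    exists (f N); split; first by exists N.+1; apply: mem_gen.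
    by move/(gen_sub (gen_ideal f N) sN); apply: nf.
  have [h [Ih nh] hmin] := ex_min_measure (fun h : {poly R} => size h) ex.
  by exists h => _; split=> // h' Ih' nh'; apply: hmin.
(* Each choice depends on all earlier ones, so the whole list is iterated. *)
pose S n := iter n (fun s => rcons s (next s)) [::].
pose g n := next (S n).
have SE n : S n = mkseq g n.
  by elim: n => // n IHn; rewrite mkseqS -IHn.
have genE n x : gen (nth 0 (S n)) (size (S n)) x <-> gen g n x.
  rewrite SE size_mkseq; split=> -[c ->]; exists c; apply: eq_bigr => i _;
    by rewrite nth_mkseq.
have gP n : [/\ I (g n), ~ gen g n (g n) &
    forall h, I h -> ~ gen g n h -> (size (g n) <= size h)%N].
  elim/ltn_ind: n => n IHn.
  have [|I1 I2 I3] := nextP (S n).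
    rewrite SE size_mkseq => i lt_in; rewrite nth_mkseq //.
    by have [] := IHn i lt_in.
  split=> //; first by move/genE.
  by move=> h Ih nh; apply: I3 => // /genE.
have [m [c cE]] := noeR (fun n => lead_coef (g n)).
have [Igm ngm gmin] := gP m.
have le_size i : (i < m)%N -> (size (g i) <= size (g m))%N.
  move=> lt_im; have [_ _] := gP i; apply=> //.
  by move/(gen_le (ltnW lt_im)).
(* Cancels the leading term of [g m]; the exponents make sense because minimality forces the sizes
   of the [g i] to be nondecreasing. *)
pose t := \sum_(i < m) (c i *: 'X^(size (g m) - size (g i))) * g i.
have gt : gen g m t by exists (fun i => c i *: 'X^(size (g m) - size (g i))).
have gm0 : g m != 0.
  by apply/eqP => g0; apply: ngm; rewrite g0; have [] := gen_ideal g m.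
have lt_size : (size (g m - t)%R < size (g m))%N.
  have sg : (0 < size (g m))%N by rewrite size_poly_gt0.
  rewrite -[X in (_ < X)%N](prednK sg) ltnS; apply/leq_sizeP => j le_j.
  have coef_t i : (i < m)%N -> ((c i *: 'X^(size (g m) - size (g i))) * g i)`_j =
      if j == (size (g m)).-1 then c i * lead_coef (g i) else 0.
    move=> lt_im; rewrite -scalerAl coefZ coefXnM.
    have := le_size i lt_im; case: eqP => [->|] le_i.
      rewrite lead_coefE; case: ltnP => [lt|le].
        have -> : g i = 0.
          by apply/eqP; rewrite -size_poly_eq0; move: lt sg le_i; lia.
        by rewrite coef0.
      by congr (_ * _`_ _); lia.
    move=> le_i'; case: ltnP => _; rewrite ?mulr0 //.
    rewrite nth_default ?mulr0 //; move: sg le_j le_i le_i'.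
    by move: (size (g m)) (size (g i)) => x y; lia.
  rewrite coefB coef_sum (eq_bigr (fun i : 'I_m =>
     if j == (size (g m)).-1 then c i * lead_coef (g i) else 0)); last first.
    by move=> i _; apply: coef_t.
  case: eqP => [->|ne]; first by rewrite -cE lead_coefE subrr.
  rewrite big1 // subr0 nth_default //; move: sg le_j ne.
  by move: (size (g m)) => x; lia.
have It : I t.
  by apply: (gen_sub iI _ gt) => i _; have [] := gP i.
have nt : ~ gen g m (g m - t).
  move=> gmt; apply: ngm; rewrite -(subrK t (g m)).
  by have [_ D _] := gen_ideal g m; apply: D.
by have := gmin (g m - t) (idealB iI Igm It) nt; rewrite leqNgt lt_size.
Qed.

Lemma noetherian_surj (R S : comNzRingType) (T : {rmorphism R -> S}) (T' : S -> R) :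
  cancel T' T -> noetherian R -> noetherian S.
Proof.
move=> TK noeR a; have [m [c cE]] := noeR (T' \o a).
exists m, (T \o c); rewrite -[LHS]TK [T' _]cE rmorph_sum; apply: eq_bigr => i _.
by rewrite rmorphM /= TK.
Qed.

Lemma noetherian_mpoly (k : fieldType) n : noetherian {mpoly k[n]}.
Proof.
elim: n => [a|n /hilbert_basis IHn]; last first.
  exact: (noetherian_surj (@muniK k n)).
have [a0|a0] := eqVneq (a 0%N) 0.
  by exists 0%N; rewrite a0; have [] := gen_ideal a 0.
exists 1%N; exists (fun=> a 1%N * ((a 0%N)@_0%MM)^-1%:MP).
have c0 : (a 0%N)@_0%MM != 0.
  by apply: contraNneq a0 => c0; rewrite (nvar0_mpolyC (a 0%N)) c0 mpolyC0.
rewrite big_ord1 -mulrA [X in _ * X](_ : _ = 1) ?mulr1 //.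
by rewrite [X in _ * X](nvar0_mpolyC (a 0%N)) -mpolyCM mulVf.
Qed.

End Noetherian.

(** If a > b the inequality fails already at d = C, since (C + 1)^(b + 1) exceeds C (C + 1)^b. *)
Lemma leq_exponent a b C :
  (forall d, d.+1 ^ a <= C * d.+1 ^ b)%N -> (a <= b)%N.
Proof.
move=> le_ab; rewrite leqNgt; apply/negP => lt_ba.
have := le_ab C; apply/negP; rewrite -ltnNge.
apply: (@leq_trans (C.+1 ^ b.+1)); last by rewrite leq_pexp2l.
by rewrite expnS ltn_pmul2r ?expn_gt0.
Qed.

Lemma underdetermined (k : fieldType) (T1 T2 : finType) (A : T1 -> T2 -> k) :
  (#|T2| < #|T1|)%N ->
  exists2 a : T1 -> k, exists x, a x != 0 & forall s, \sum_x a x * A x s = 0.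
Proof.
move=> lt21.
pose M := \matrix_(i < #|T1|, j < #|T2|) A (enum_val i) (enum_val j).
have : kermx M != 0.
  rewrite kermx_eq0 /row_free; apply/negP => /eqP rM.
  by have := rank_leq_col M; rewrite rM leqNgt lt21.
case/rowV0Pn=> v /sub_kermxP vM /rV0Pn[i vi0].
exists (fun x => v 0 (enum_rank x)); first by exists (enum_val i); rewrite enum_valK.
move=> s; have /rowP/(_ (enum_rank s)) := vM; rewrite !mxE => vMs; rewrite -[RHS]vMs.
rewrite (reindex (fun j : 'I_#|T1| => enum_val j)) /=; last first.
  by exists enum_rank => x _; [apply: enum_valK | apply: enum_rankK].
by apply: eq_bigr => j _; rewrite mxE enum_valK enum_rankK.
Qed.

Section LinearSpan.
Variables (k : fieldType) (V : lmodType k).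
Implicit Types T : finType.

Definition lspan T (B : T -> V) : set V :=
  [set x | exists e : T -> k, x = \sum_s e s *: B s].

Lemma lspan0 T (B : T -> V) : lspan B 0.
Proof. by exists (fun=> 0); rewrite big1 // => s _; rewrite scale0r. Qed.

Lemma lspanD T (B : T -> V) x y : lspan B x -> lspan B y -> lspan B (x + y).
Proof.
move=> [e ->] [f ->]; exists (fun s => e s + f s).
by rewrite -big_split; apply: eq_bigr => s _; rewrite scalerDl.
Qed.

Lemma lspanZ T (B : T -> V) c x : lspan B x -> lspan B (c *: x).
Proof.
move=> [e ->]; exists (fun s => c * e s).
by rewrite scaler_sumr; apply: eq_bigr => s _; rewrite scalerA.
Qed.

Lemma lspan_sum T (B : T -> V) (I : Type) (r : seq I) (Q : pred I) (F : I -> V) :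
  (forall i, Q i -> lspan B (F i)) -> lspan B (\sum_(i <- r | Q i) F i).
Proof.
by move=> BF; elim/big_ind: _ => //; [apply: lspan0 | apply: lspanD].
Qed.

Lemma mem_lspan T (B : T -> V) s : lspan B (B s).
Proof.
exists (fun s' => (s' == s)%:R); rewrite (bigD1 s) //= eqxx scale1r big1 ?addr0 //.
by move=> s' /negPf->; rewrite scale0r.
Qed.

End LinearSpan.

(** * Isolated zeros *)

Section IsolatedPoint.
Variables (k : fieldType) (N : nat).
Local Notation P := {mpoly k[N]}.
Implicit Types (p q u : P) (f : nat -> P).

(** The t-th power of the maximal ideal of the origin. *)
Let vanish_order t : set P := [set p | forall m, (mdeg m < t)%N -> p@_m = 0].

Lemma vanish_orderM s t p q : vanish_order s p -> vanish_order t q ->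
  vanish_order (s + t) (p * q).
Proof.
move=> vp vq m lt_m; rewrite mcoeffM big1 // => -[m1 m2] /= /eqP mE.
have [lt1|le1] := ltnP (mdeg m1) s; first by rewrite vp ?mul0r.
rewrite [q@_m2]vq ?mulr0 //; have := congr1 mdeg mE; rewrite mdegD; lia.
Qed.

Lemma vanish_order_ideal t : ideal (vanish_order t).
Proof.
split=> [m _|p q vp vq m lt|a p vp]; first by rewrite mcoeff0.
  by rewrite mcoeffD vp ?vq ?addr0.
by rewrite -[t]add0n; apply: vanish_orderM.
Qed.

Lemma vanish_order1 p : p@_0%MM = 0 -> vanish_order 1 p.
Proof. by move=> p0 m; rewrite ltnS leqn0 mdeg_eq0 => /eqP->. Qed.

Lemma vanish_orderX t p n : vanish_order t p -> vanish_order (t * n) (p ^+ n).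
Proof.
move=> vp; elim: n => [|n IHn]; first by rewrite muln0 => m.
by rewrite mulnS exprS; apply: vanish_orderM.
Qed.

(** A truncated geometric series: u is its constant term times 1 - w, with w vanishing at the
    origin. *)
Lemma local_inverse u t : u@_0%MM != 0 -> exists u', vanish_order t (1 - u * u').
Proof.
move=> u0; pose w := 1 - (u@_0%MM)^-1 *: u.
have w0 : vanish_order 1 w.
  by apply: vanish_order1; rewrite mcoeffB mcoeffZ mulVf // mcoeff1 eqxx subrr.
exists ((u@_0%MM)^-1 *: \sum_(i < t) w ^+ i).
have -> : 1 - u * ((u@_0%MM)^-1 *: \sum_(i < t) w ^+ i) = w ^+ t.
  rewrite -scalerAr scalerAl -[_ *: u](subKr 1) -/w.
  by rewrite -opprB mulNr -subrX1 opprK addrC subrK.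
by rewrite -[t in vanish_order t]mul1n; apply: vanish_orderX.
Qed.

Section Count.
Variables (f : nat -> P) (c M : nat) (u : P).
Hypothesis f0 : forall i, (i < c)%N -> (f i)@_0%MM = 0.
Hypothesis u0 : u@_0%MM != 0.
Hypothesis ufM : forall i, gen f c ((u * 'X_i) ^+ M).

Let mono (ga : {ffun 'I_N -> 'I_M}) : P := 'X_[[multinom ga i : nat | i < N]].

(** A monomial with some exponent at least M is divisible by X_i^M, so it enters the ideal once
    multiplied by (u u')^M; and u u' is 1 up to order t. *)
Lemma reduce_mod_gen t p : exists x q : P,
  [/\ lspan mono x, gen f c q & vanish_order t (p - (x + q))].
Proof.
have [g0 gD gM] := gen_ideal f c; have [v0 vD vM] := vanish_order_ideal t.
rewrite [p]mpolyE; elim: (msupp p) => [|m r [x [q [sx gq vxq]]]].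
  exists 0, 0; rewrite big_nil !addr0 subr0; split=> //; exact: lspan0.
rewrite big_cons; set s := \sum_(j <- r) _ in vxq *.
suff [y [q' [sy gq' vyq]]] : exists y q' : P,
    [/\ lspan mono y, gen f c q' & vanish_order t ('X_[m] - (y + q'))].
  exists (p@_m *: y + x), (p@_m *: q' + q); split.
  - by apply: lspanD => //; apply: lspanZ.
  - by apply: (gD) => //; rewrite -mul_mpolyC; apply: gM.
  - rewrite addrACA -scalerDr opprD addrACA -scalerBr; apply: (vD) => //.
    by rewrite -mul_mpolyC; apply: vM.
have [/forallP lt_m|] := boolP [forall i, (m i < M)%N].
  exists 'X_[m], 0; rewrite addr0 subrr; split=> //.
  have -> : 'X_[m] = mono [ffun i => Ordinal (lt_m i)].
    by congr 'X_[_]; apply/mnmP => i; rewrite mnmE ffunE.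
  exact: mem_lspan.
rewrite negb_forall => /existsP[i]; rewrite -leqNgt => le_m.
have [u' vu'] := local_inverse t u0.
have mE : 'X_[m] = 'X_i ^+ M * 'X_[(m - U_(i) *+ M)%MM] :> P.
  rewrite mpolyXn -mpolyXD addmC submK //; apply/mnm_lepP => j.
  by rewrite mulmnE mnm1E; case: eqP => [<-|_]; rewrite ?mul1n ?mul0n.
exists 0, ((u * u') ^+ M * 'X_[m]); split; first exact: lspan0.
  rewrite mE mulrA exprMn [_ * 'X_i ^+ M]mulrAC -exprMn -mulrA mulrC.
  exact: gM.
rewrite add0r -[X in X - _]mul1r -mulrBl mulrC; apply: (vM).
by rewrite -opprB subrX1 mulrC -mulrN opprB; apply: vM.
Qed.

Let gens t (b : {ffun 'I_N -> 'I_M} * {ffun 'I_c -> 'I_t}) : P :=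
  mono b.1 * \prod_(i < c) f i ^+ b.2 i.

(** Recursion on t: each coefficient of the [f i] is expanded only to order t, and multiplication by
    [f i], which vanishes at the origin, gains the missing order while raising one exponent by 1. *)
Lemma expand_in_gens t p :
  exists2 x, lspan (@gens t) x & vanish_order t (p - x).
Proof.
elim: t p => [|t IHt] p; first by exists 0; [exact: lspan0 | move=> m].
have [x [_ [sx [a ->] vE]]] := reduce_mod_gen t.+1 p.
have /choice[y yP] : forall i : nat, exists y : P,
  lspan (@gens t) y /\ vanish_order t (a i - y).
  by move=> i; have [y] := IHt (a i); exists y.
have gensP ga (b : 'I_c -> nat) : (forall i, (b i < t.+1)%N) ->
    lspan (@gens t.+1) (mono ga * \prod_(i < c) f i ^+ b i).
  move=> lt_b; have -> : mono ga * \prod_(i < c) f i ^+ b i =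
      gens (ga, [ffun i => Ordinal (lt_b i)]).
    by congr (_ * _); apply: eq_bigr => i _; rewrite ffunE.
  exact: mem_lspan.
exists (x + \sum_(i < c) y i * f i).
  apply: lspanD.
    have [e ->] := sx; apply: lspan_sum => ga _; apply: lspanZ.
    have := gensP ga (fun=> 0%N) (fun=> isT).
    by rewrite big1 ?mulr1 // => i _; rewrite expr0.
  apply: lspan_sum => i _; have [[e ->] _] := yP i.
  rewrite mulr_suml; apply: lspan_sum => -[ga b] _.
  rewrite -scalerAl; apply: lspanZ; rewrite /gens /= -mulrA.
  have := gensP ga (fun j => (b j + (j == i))%N) _.
  rewrite (bigD1 i) //= [in X in _ -> X](bigD1 i) //= eqxx addn1 exprSr.
  rewrite (eq_bigr (fun j : 'I_c => f j ^+ b j)) => [|j /negPf->]; last first.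
    by rewrite addn0.
  rewrite [in X in _ -> X]mulrAC; apply=> j; case: (j == i).
    by rewrite addn1 ltnS.
  by rewrite addn0 ltnS ltnW.
have [v0 vD vM] := vanish_order_ideal t.+1.
rewrite opprD addrA; have -> : p - x - \sum_(i < c) y i * f i =
   (p - (x + \sum_(i < c) a i * f i)) + \sum_(i < c) (a i - y i) * f i.
  rewrite [X in _ = _ + X](eq_bigr (fun i : 'I_c => a i * f i - y i * f i)).
    by rewrite sumrB opprD !addrA subrK.
  by move=> i _; rewrite mulrBl.
apply: (vD) => //; apply: ideal_sum => [|i _]; first exact: vanish_order_ideal.
rewrite -addn1; apply: vanish_orderM; first by have [] := yP i.
by apply: vanish_order1; apply: f0.
Qed.

Lemma isolated_origin : (N <= c)%N.
Proof.
have [N0|N0] := posnP N; first by rewrite [X in (X <= _)%N]N0.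
apply: (@leq_exponent _ _ (M ^ N * N ^ c)) => d; set J := d.+1.
rewrite -mulnA -expnMn leqNgt; apply/negP => lt_card.
(* The J^N monomials with exponents below J have degree less than t, so a combination of them that
   vanishes to order t is zero. The spanning set has M^N (N J)^c elements. *)
pose t := (N * J)%N.
have /choice[x xP] : forall b : {ffun 'I_N -> 'I_J}, exists e,
    vanish_order t ('X_[[multinom b i : nat | i < N]] - \sum_s e s *: @gens t s).
  by move=> b; have [x [e ->]] := expand_in_gens t 'X_[[multinom b i : nat | i < N]];
    exists e.
have [|a [b ab0] aE] := underdetermined x.
  by rewrite card_prod !card_ffun !card_ord.
have : vanish_order t (\sum_b0 a b0 *: 'X_[[multinom b0 i : nat | i < N]]).
  have -> : \sum_b0 a b0 *: 'X_[[multinom b0 i : nat | i < N]] =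
    \sum_b0 a b0 *: ('X_[[multinom b0 i : nat | i < N]] - \sum_s x b0 s *: @gens t s).
    under [RHS]eq_bigr do rewrite scalerBr.
    rewrite big_split /= sumrN [X in _ - X](_ : _ = 0) ?subr0 //.
    under eq_bigr do rewrite scaler_sumr.
    rewrite exchange_big big1 // => s _; under eq_bigr do rewrite scalerA.
    by rewrite -scaler_suml aE scale0r.
  apply: ideal_sum => [|b0 _]; first exact: vanish_order_ideal.
  by rewrite -mul_mpolyC; have [_ _ vM] := vanish_order_ideal t; apply: vM.
move=> /(_ [multinom b i : nat | i < N]) vb; move/eqP: ab0; apply.
rewrite -vb; last first.
  rewrite mdegE /t; under eq_bigr do rewrite mnmE.
  apply: (@leq_ltn_trans (\sum_(i < N) d)%N).
    by apply: leq_sum => i _; rewrite -ltnS.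
  by rewrite sum_nat_const card_ord ltn_pmul2l.
rewrite raddf_sum (bigD1 b) //= mcoeffZ mcoeffX eqxx mulr1 big1 ?addr0 //.
move=> b' ne; rewrite mcoeffZ mcoeffX; case: eqP => [/mnmP bb|_]; last by rewrite mulr0.
case/eqP: ne; apply/ffunP => i; apply: val_inj.
by have := bb i; rewrite !mnmE.
Qed.

End Count.

Lemma meval_origin p : p.@[fun=> 0] = p@_0%MM.
Proof.
rewrite {1 2}(mpolyE p) !raddf_sum; apply: eq_bigr => m _ /=.
rewrite mcoeffZ mevalZ mcoeffX mevalX; congr (_ * _).
have [->|/eqP m0] := eqVneq m 0%MM; first by rewrite big1 // => i _; rewrite mnm0E.
have /existsP[i mi] : [exists i, m i != 0%N].
  apply: contraT => /existsPn all0; exfalso; apply: m0; apply/mnmP => i.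
  by rewrite mnm0E; apply/eqP; have := all0 i; rewrite negbK.
by apply/eqP; rewrite prodf_seq_eq0; apply/hasP; exists i;
  rewrite ?mem_index_enum //= expf_eq0 eqxx lt0n mi.
Qed.

(* Modulo the t-th power of the maximal ideal of z, the polynomials of degree
   < t are spanned by the products of a monomial with bounded exponents and a
   monomial of degree < t in the c equations: counting gives N <= c. *)
Theorem isolated_point_count f c M u (z : 'I_N -> k) :
  u.@[z] != 0 -> (forall i, (i < c)%N -> (f i).@[z] = 0) ->
  (forall i, gen f c ((u * ('X_i - (z i)%:MP)) ^+ M)) -> (N <= c)%N.
Proof.
move=> uz fz ufM; pose tau p : P := p \mPo [tuple 'X_i + (z i)%:MP | i < N].
have tau0 p : (tau p)@_0%MM = p.@[z].
  rewrite -meval_origin comp_mpoly_meval; apply: meval_eq => i.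
  by rewrite tnth_mktuple mevalD mevalXU mevalC add0r.
apply: (@isolated_origin (tau \o f) c M (tau u)) => [i lt_ic||i].
- by rewrite /= tau0 fz.
- by rewrite tau0.
have [a aE] := ufM i; exists (tau \o a).
have -> : (tau u * 'X_i) ^+ M = tau ((u * ('X_i - (z i)%:MP)) ^+ M).
  rewrite /tau rmorphXn rmorphM /= comp_mpolyB comp_mpolyC comp_mpolyXU.
  by rewrite -tnth_nth tnth_mktuple addrK.
rewrite aE /tau rmorph_sum; apply: eq_bigr => j _; exact: rmorphM.
Qed.

End IsolatedPoint.

(** * Irreducible sets and their dimension *)

Section Irreducible.
Variable T : topologicalType.
Implicit Types (A B C Y Z U : set T).

(** Zorn: a point outside B and a point outside C, both in the union of a chain, lie in a common
    member, which is irreducible. *)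
Lemma component_containing A Y : irreducible_set Y -> Y `<=` A ->
  exists2 Z, irreducible_component A Z & Y `<=` Z.
Proof.
move=> Yirr YA.
pose good X := [/\ irreducible_set X, X `<=` A & Y `<=` X].
have Ygood : good Y by split.
have [|Z [Zgood Zmax]] := @Zorn_bigcup T [set X | X = set0 \/ good X].
  move=> F FP Ftot.
  have [[X0 FX0 X0g]|noF] := pselect (exists2 X, F X & good X); last first.
    left; apply/seteqP; split=> // x [X FX Xx]; exfalso.
    case: (FP X FX) => [X0|Xg]; first by rewrite X0 in Xx.
    by apply: noF; exists X.
  have Fg X x : F X -> X x -> good X.
    by move=> FX Xx; case: (FP X FX) => // X0'; rewrite X0' in Xx.
  right; split; [split| |].
  - by have [[[x X0x] _] _ _] := X0g; exists x, X0.
  - move=> B C cB cC UBC.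
    have [|nB] := pselect (\bigcup_(X in F) X `<=` B); [by left|right].
    move: nB => /existsNP[x /not_implyP[[X FX Xx] nBx]] y [X' FX' X'y].
    apply: contrapT => nCy.
    have absurd X1 : F X1 -> X1 x -> X1 y -> False.
      move=> FX1 X1x X1y; have [[_ X1irr] _ _] := Fg _ _ FX1 X1x.
      case: (X1irr B C cB cC) => [z X1z|/(_ x X1x)//|/(_ y X1y)//].
      by apply: UBC; exists X1.
    have [XX'|X'X] := Ftot _ _ FX FX'.
      by apply: (absurd X') => //; apply: XX'.
    by apply: (absurd X) => //; apply: X'X.
  - by move=> x [X FX Xx]; have [_ XA _] := Fg _ _ FX Xx; apply: XA.
  - by move=> y Yy; exists X0 => //; have [_ _] := X0g; apply.
have {Zgood} [Z0|[Zirr ZA YZ]] := Zgood.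
  exfalso; apply: (Zmax Y); last by right.
  rewrite Z0; split=> // Y0; have [[y Yy] _] := Yirr; exact: (Y0 y Yy).
exists Z => //; split=> // X Xirr XA ZX; apply: contrapT => XZ.
apply: (Zmax X); last by right; split=> //; apply: subset_trans ZX.
by split=> // XZ'; apply: XZ; apply/seteqP.
Qed.

Lemma irreducible_set1 (x : T) : irreducible_set [set x].
Proof.
split; first by exists x.
by move=> B C _ _ /(_ x erefl)[Bx|Cx]; [left|right] => y ->.
Qed.

Lemma component_through A (x : T) : A x ->
  exists2 Z, irreducible_component A Z & Z x.
Proof.
move=> Ax; have [|Z Zc xZ] := component_containing (irreducible_set1 x) (A := A).
  by move=> y ->.
by exists Z => //; apply: xZ.
Qed.

Lemma irreducible_closure Z : irreducible_set Z -> irreducible_set (closure Z).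
Proof.
move=> [[z Zz] Zirr]; split; first by exists z; apply: subset_closure.
move=> B C cB cC ZBC; have [|ZB|ZC] := Zirr B C cB cC.
- by apply: subset_trans ZBC; apply: subset_closure.
- by left; rewrite [B](proj1 (closure_id B) cB); apply: closureS.
- by right; rewrite [C](proj1 (closure_id C) cC); apply: closureS.
Qed.

Lemma component_closed A Z : closed A -> irreducible_component A Z -> closed Z.
Proof.
move=> cA [Zirr ZA Zmax]; rewrite -(Zmax (closure Z)).
- exact: closed_closure.
- exact: irreducible_closure.
- by rewrite [A](proj1 (closure_id A) cA); apply: closureS.
- exact: subset_closure.
Qed.

Lemma irreducible_dense Z U C : irreducible_set Z -> open U -> Z `&` U !=set0 ->
  closed C -> Z `&` U `<=` C -> Z `<=` C.
Proof.
move=> [_ Zirr] oU [z [Zz Uz]] cC ZUC.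
have [||//|//] := Zirr (~` U) C _ cC.
- by rewrite closedC.
- by move=> x Zx; have [Ux|nUx] := pselect (U x); [right; apply: ZUC|left].
by move=> /(_ z Zz).
Qed.

Lemma irreducible_connected Z : irreducible_set Z -> connected Z.
Proof.
move=> [_ Zirr] B [b Bb] [C oC BC] [D cD BD].
have [||ZC|ZD] := Zirr (~` C) D _ cD.
- by rewrite closedC.
- move=> x Zx; have [Cx|] := pselect (C x); [right|by left].
  have : B x by rewrite BC.
  by rewrite BD => -[].
- by move: Bb; rewrite BC => -[/ZC].
- by rewrite BD; apply/setIidPl.
Qed.

End Irreducible.

Section ProjectiveTopology.
Variables (k : closedFieldType) (g : nat).
Local Notation proj := (proj_space k g).
Local Notation form := {mpoly k[g.+1]}.
Implicit Types (p q u : form) (x y z : proj) (Z C V : set proj) (v w : 'rV[k]_g.+1).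

Lemma pevalD p q v : peval (p + q) v = peval p v + peval q v.
Proof. exact: mevalD. Qed.

Lemma pevalM p q v : peval (p * q) v = peval p v * peval q v.
Proof. exact: mevalM. Qed.

Lemma pevalZ c p v : peval (c *: p) v = c * peval p v.
Proof. exact: mevalZ. Qed.

Lemma pevalX i v : peval 'X_i v = v 0 i.
Proof. exact: mevalXU. Qed.

Lemma homogeneousM p q : homogeneous p -> homogeneous q -> homogeneous (p * q).
Proof. by move=> [d pd] [e qe]; exists (d + e)%N; apply: dhomogM. Qed.

Lemma homogeneousX i : homogeneous ('X_i : form).
Proof. by exists 1%N; rewrite dhomogX; apply/eqP/mdeg1. Qed.

Definition hypersurface p : set proj := [set x | peval p (coords x) = 0].

Lemma hypersurfaceM p q :
  hypersurface (p * q) = hypersurface p `|` hypersurface q.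
Proof.
apply/seteqP; split=> x; rewrite /hypersurface /= pevalM.
  by move/eqP; rewrite mulf_eq0 => /orP[]/eqP; [left|right].
by case=> ->; rewrite ?mul0r ?mulr0.
Qed.

Lemma closed_hypersurface p : homogeneous p -> closed (hypersurface p).
Proof.
move=> hp; apply/closed_zero_locus; exists [set p]; apply/seteqP; split=> x.
  by move=> px q ->.
by move=> /(_ p erefl hp).
Qed.

Lemma closed_separation C x : closed C -> ~ C x ->
  exists p, [/\ homogeneous p, C `<=` hypersurface p & ~ hypersurface p x].
Proof.
move=> /closed_zero_locus[S ->] /existsNP[p /not_implyP[Sp /not_implyP[hp px]]].
by exists p; split=> // y; apply.
Qed.

Lemma irreducible_hypersurfaceM Z p q : irreducible_set Z ->
  homogeneous p -> homogeneous q -> Z `<=` hypersurface (p * q) ->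
  Z `<=` hypersurface p \/ Z `<=` hypersurface q.
Proof.
move=> [_ Zirr] hp hq; rewrite hypersurfaceM.
by apply: Zirr; apply: closed_hypersurface.
Qed.

Lemma irreducible_by_forms Z : Z !=set0 ->
  (forall p q, homogeneous p -> homogeneous q -> Z `<=` hypersurface (p * q) ->
     Z `<=` hypersurface p \/ Z `<=` hypersurface q) -> irreducible_set Z.
Proof.
move=> Z0 Zforms; split=> // B C cB cC ZBC; apply: contrapT.
move=> /not_orP[/existsNP[x /not_implyP[Zx nBx]] /existsNP[y /not_implyP[Zy nCy]]].
have [p [hp Bp px]] := closed_separation cB nBx.
have [q [hq Cq qy]] := closed_separation cC nCy.
case: (Zforms p q hp hq) => [z /ZBC|/(_ x Zx)//|/(_ y Zy)//].
by rewrite hypersurfaceM => -[/Bp|/Cq]; [left|right].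
Qed.

Lemma coords_neq0 x : coords x != 0.
Proof. exact: (valP (repr x)). Qed.

Definition point v (v0 : v != 0) : proj := proj_pt (exist _ v v0).

Lemma coords_point v (v0 : v != 0) : exists2 c : k, c != 0 & coords (point v0) = c *: v.
Proof. by have [c c0 cE] := proj_pt_coords (exist _ v v0); exists c. Qed.

Lemma point_coords x v (v0 : v != 0) c : c != 0 -> v = c *: coords x -> x = point v0.
Proof.
by move=> c0 vE; rewrite -[x]reprK; apply/proj_pt_eqP; exists c.
Qed.

Lemma hypersurface_point p v (v0 : v != 0) : homogeneous p ->
  hypersurface p (point v0) <-> peval p v = 0.
Proof.
move=> hp; have [c c0 cE] := coords_point v0.
rewrite /hypersurface /= cE.
have pE := peval_scale v hp c0.
by split=> /eqP p0; apply/eqP; [rewrite -pE|rewrite pE].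
Qed.

(** A strictly decreasing sequence of closed sets W n gives forms p n vanishing on W n.+1 but not on
    W n. No p m depends on the earlier ones: these all vanish on W m. *)
Lemma proj_noetherian_ind (G : set proj -> Prop) :
  (forall V, closed V -> (forall V', closed V' -> V' `<` V -> G V') -> G V) ->
  forall V, closed V -> G V.
Proof.
move=> IH V0 cV0; apply: contrapT => nG0.
pose bad V := closed V /\ ~ G V.
have /choice[next nextP] : forall V, exists V', bad V -> bad V' /\ V' `<` V.
  move=> V; have [[cV nG]|nb] := pselect (bad V); last by exists V => /nb.
  apply: contrapT => no; apply: nG; apply: IH => // V' cV' V'V.
  by apply: contrapT => nG'; apply: no; exists V'.
pose W n := iter n next V0.
have Wbad n : bad (W n) by elim: n => // n IHn; have [] := nextP _ IHn.
have WS n : W n.+1 `<` W n by have [] := nextP _ (Wbad n).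
have Wle m n : (m <= n)%N -> W n `<=` W m.
  move=> /subnK <-; elim: (n - m)%N => // d IHd.
  by rewrite addSn; apply: subset_trans IHd; have [] := WS (d + m)%N.
have /choice[p pP] n : exists p, [/\ homogeneous p, W n.+1 `<=` hypersurface p &
    exists2 x, W n x & ~ hypersurface p x].
  have [_ /existsNP[x /not_implyP[Wx nWx]]] := WS n.
  have [cW _] := Wbad n.+1.
  by have [p [hp Wp px]] := closed_separation cW nWx; exists p; split=> //; exists x.
have [m [c pm]] := noetherian_mpoly p.
have [_ _ [x Wx]] := pP m; apply.
rewrite /hypersurface /= pm /peval raddf_sum big1 // => i _.
have [_ Wp _] := pP i; have /Wp : W i.+1 x by apply: (Wle _ m).
by rewrite /hypersurface /peval /= mevalM => ->; rewrite mulr0.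
Qed.

(** Splitting V into finitely many closed pieces, u is a product of forms that vanish on pieces not
    containing Z, but not on Z. *)
Lemma isolate_component V Z : closed V -> irreducible_component V Z ->
  exists u, [/\ homogeneous u, ~ (Z `<=` hypersurface u) &
    forall x, V x -> ~ hypersurface u x -> Z x].
Proof.
have hyp1 x : ~ hypersurface 1 x.
  by rewrite /hypersurface /= /peval meval1 => /eqP; rewrite oner_eq0.
have hom1 : homogeneous (1 : form) by exists 0%N; apply: dhomog1.
move=> cV [Zirr ZV Zmax].
(* The maximality of Z does not fit an induction over closed subsets of V, so the claim is weakened
   to one that does not say that Z is a component. *)
suff [u [hu Zu uP]] : exists u, [/\ homogeneous u, ~ (Z `<=` hypersurface u) &
    forall x, V x -> ~ hypersurface u x ->
    exists C, [/\ irreducible_set C, Z `<=` C, C `<=` V & C x]].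
  exists u; split=> // x Vx ux; have [C [Cirr ZC CV Cx]] := uP x Vx ux.
  by rewrite -(Zmax C).
have [[z Zz] _] := Zirr.
move: {Zmax ZV} V cV; apply: proj_noetherian_ind => V cV IH.
have [Virr|] := pselect (irreducible_set V).
  have [ZV|/existsNP[x /not_implyP[Zx nVx]]] := pselect (Z `<=` V).
    by exists 1; split=> // [/(_ z Zz)/hyp1//|x Vx _]; exists V; split.
  have [u [hu Vu ux]] := closed_separation cV nVx.
  by exists u; split=> // [/(_ x Zx)//|y /Vu].
move=> /not_andP[V0|].
  exists 1; split=> // [/(_ z Zz)/hyp1//|x Vx _]; exfalso.
  by apply: V0; exists x.
move=> /existsNP[B /existsNP[C /not_implyP[cB /not_implyP[cC /not_implyP[VBC]]]]].
move=> /not_orP[nVB nVC].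
have half D : closed D -> ~ (V `<=` D) -> exists u, [/\ homogeneous u,
    ~ (Z `<=` hypersurface u) & forall x, (V `&` D) x -> ~ hypersurface u x ->
    exists C, [/\ irreducible_set C, Z `<=` C, C `<=` V & C x]].
  move=> cD nVD; have [||u [hu Zu uP]] := IH (V `&` D).
  - exact: closedI.
  - split; first exact: subIsetl.
    by move=> VVD; apply: nVD => x /VVD[].
  exists u; split=> // x VDx ux; have [E [Eirr ZE EVD Ex]] := uP x VDx ux.
  by exists E; split=> // y /EVD[].
have [u [hu Zu uP]] := half B cB nVB; have [w [hw Zw wP]] := half C cC nVC.
exists (u * w); split; first exact: homogeneousM.
  by case/(irreducible_hypersurfaceM Zirr hu hw).
move=> x Vx; rewrite hypersurfaceM => /not_orP[ux wx].
by case: (VBC x Vx) => [Bx|Cx]; [apply: uP|apply: wP].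
Qed.

End ProjectiveTopology.

Section ChainLength.
Variable T : topologicalType.
Implicit Types (A Y Z : set T).

Definition chain_bound Z (d : nat) : Prop :=
  forall m, (exists C : nat -> set T, irreducible_chain Z m C) -> (m <= d)%N.

Lemma chain_extend Y Z m (C : nat -> set T) : irreducible_set Z -> closed Y ->
  Y `<` Z -> irreducible_chain Y m C ->
  irreducible_chain Z m.+1 (fun i => if (i <= m)%N then C i else Z).
Proof.
move=> Zirr cY [YZ nZY] [Cirr Cinc]; split=> [i|i].
  rewrite leq_eqVlt ltnS => /predU1P[->|le_im].
    by rewrite ltnn; split=> //; exists setT; [exact: closedT|rewrite setIT].
  rewrite le_im; have [Ci [E cE CE]] := Cirr i le_im; split=> //.
  exists (Y `&` E); first exact: closedI.
  by rewrite setIA (setIidr YZ).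
rewrite ltnS leq_eqVlt => /predU1P[->|lt_im].
  rewrite eqxx ltnn /=; have [_ [E _ CE]] := Cirr m (leqnn m).
  rewrite CE; split; first by apply: subset_trans YZ; apply: subIsetl.
  by move=> ZYE; apply: nZY; apply: subset_trans ZYE _; apply: subIsetl.
by rewrite lt_im orbT; apply: Cinc.
Qed.

Lemma chain0 Z : irreducible_set Z -> irreducible_chain Z 0 (fun=> Z).
Proof.
move=> Zirr; split=> // i _; split=> //.
by exists setT; [exact: closedT|rewrite setIT].
Qed.

Lemma has_dim_bounded A Z d : irreducible_set Z -> closed Z -> Z `<=` A ->
  chain_bound A d -> exists2 e, has_dim A e & chain_bound A e.
Proof.
move=> Zirr cZ ZA Ad.
pose Q m := `[< exists C : nat -> set T, irreducible_chain A m C >].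
have Q0 : exists m, Q m.
  exists 0%N; apply/asboolP; exists (fun=> Z); split=> // i _; split=> //.
  by exists Z => //; rewrite setIC (setIidl ZA).
have Qd m : Q m -> (m <= d)%N by move=> /asboolP; apply: Ad.
have [e /asboolP Qe emax] := ex_maxnP Q0 Qd.
have eb : chain_bound A e by move=> m Cm; apply: emax; apply/asboolP.
by exists e.
Qed.

Lemma chain_bound_sub A Z d :
  closed Z -> Z `<=` A -> chain_bound A d -> chain_bound Z d.
Proof.
move=> cZ ZA Ad m [C [Cirr Cinc]]; apply: Ad; exists C; split=> // i /Cirr[Ci [E cE CE]].
split=> //; exists (Z `&` E); first exact: closedI.
by rewrite CE setIA (setIidr ZA).
Qed.

End ChainLength.

Section ComponentDimension.
Variables (k : closedFieldType) (g : nat).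
Local Notation proj := (proj_space k g).
Local Notation form := {mpoly k[g.+1]}.
Implicit Types (p q u : form) (x y z : proj) (Z C V : set proj) (fs : seq form).

Definition zeros fs : set proj :=
  [set x | forall p, p \in fs -> hypersurface p x].

Lemma closed_zeros fs : (forall p, p \in fs -> homogeneous p) -> closed (zeros fs).
Proof.
move=> hfs; apply/closed_zero_locus; exists [set p | p \in fs].
apply/seteqP; split=> x xfs p pfs; first by move=> _; apply: xfs.
by apply: xfs => //; apply: hfs.
Qed.

Lemma isolated_point_equations fs u z :
  (forall p, p \in fs -> homogeneous p) -> homogeneous u -> zeros fs z ->
  ~ hypersurface u z -> (forall x, zeros fs x -> ~ hypersurface u x -> x = z) ->
  (g <= size fs)%N.
Proof.
move=> hfs hu fz uz iso.
have /rV0Pn[l vl0] := coords_neq0 z; set v := coords z in vl0.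
pose w : 'rV[k]_g.+1 := (v 0 l)^-1 *: v.
have wl : w 0 l = 1 by rewrite mxE mulVf.
have w0 : w != 0 by apply/rV0Pn; exists l; rewrite wl oner_neq0.
have zw : z = point w0 by apply: (point_coords w0 (c := (v 0 l)^-1)); rewrite ?invr_eq0.
(* On the slice X_l = 1 of the cone, z becomes an isolated point of affine (g + 1)-space, at the
   price of one more equation. *)
pose F := ('X_l - 1) :: fs; pose f i := F`_i; pose c := size F.
have Fz p : p \in F -> peval p w = 0.
  rewrite inE => /predU1P[->|pfs].
    by rewrite /peval mevalB mevalXU meval1 wl subrr.
  by apply/(hypersurface_point w0 (hfs p pfs)); rewrite -zw; apply: fz.
have Fnth i : (i < c)%N -> f i \in F by move=> lt_ic; apply: mem_nth.
(* This vanishes at every zero of F, because off u = 0 the only one is w; the Nullstellensatz puts a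
   power of it into the ideal of F. *)
pose h i := u * ('X_i - (w 0 i)%:MP).
have hM i : exists M, gen f c (h i ^+ M).
  apply: radical_nullstellensatz => [|y yf]; first exact: gen_ideal.
  rewrite /h mevalM mevalB mevalXU mevalC.
  have [->|uy] := eqVneq u.@[y] 0; first by rewrite mul0r.
  pose Y : 'rV[k]_g.+1 := \row_i y i.
  have YE p : peval p Y = p.@[y] by apply: meval_eq => j; rewrite mxE.
  have Fy p : p \in F -> peval p Y = 0.
    move=> pF; rewrite YE; apply: yf; rewrite -(nth_index 0 pF).
    by apply: mem_gen; rewrite index_mem.
  have Yl : Y 0 l = 1.
    have := Fy _ (mem_head _ _); rewrite YE mevalB mevalXU meval1 => /eqP.
    by rewrite subr_eq0 mxE => /eqP.
  have Y0 : Y != 0 by apply/rV0Pn; exists l; rewrite Yl oner_neq0.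
  have zY : point Y0 = z.
    apply: iso => [p pfs|].
      by apply/(hypersurface_point Y0 (hfs p pfs)); apply: Fy; rewrite inE pfs orbT.
    by move/(hypersurface_point Y0 hu); rewrite YE; apply/eqP.
  have [e e0 vE] := coords_point Y0; rewrite zY -/v in vE.
  have Yw : Y = w.
    have vl : v 0 l = e by rewrite vE mxE Yl mulr1.
    by rewrite /w vl vE scalerA mulVf // scale1r.
  by rewrite -Yw mxE subrr mulr0.
have [M MP] := choice hM; pose M' := (\max_i M i)%N.
have := @isolated_point_count k g.+1 f c M' u (fun i => w 0 i); rewrite ltnS; apply.
- by apply/eqP => uw; apply: uz; rewrite zw; apply/(hypersurface_point w0 hu).
- by move=> i lt_ic; apply: Fz; apply: Fnth.
- move=> i; rewrite -(subnK (leq_bigmax i : (M i <= M')%N)) exprD.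
  by have [_ _ gM] := gen_ideal f c; apply: gM; apply: MP.
Qed.

Lemma separating_hyperplane x y : x <> y ->
  exists p, [/\ homogeneous p, hypersurface p x & ~ hypersurface p y].
Proof.
move=> xy; have /rV0Pn[l xl0] := coords_neq0 x.
pose p i : form := coords x 0 l *: 'X_i - coords x 0 i *: 'X_l.
have pE i v : peval (p i) v = coords x 0 l * v 0 i - coords x 0 i * v 0 l.
  by rewrite /peval mevalB !mevalZ !mevalXU.
have hp i : homogeneous (p i).
  by exists 1%N; apply: rpredB; apply: dhomogZ; rewrite dhomogX; apply/eqP/mdeg1.
have px i : hypersurface (p i) x by rewrite /hypersurface /= pE mulrC subrr.
apply: contrapT => no; apply: xy.
have py i : coords x 0 l * coords y 0 i = coords x 0 i * coords y 0 l.
  apply/eqP; rewrite -subr_eq0 -pE; apply/eqP; apply: contrapT => np.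
  by apply: no; exists (p i).
have yl0 : coords y 0 l != 0.
  have /rV0Pn[i yi0] := coords_neq0 y; apply: contraNneq yi0 => yl.
  by have /eqP := py i; rewrite yl mulr0 mulf_eq0 (negPf xl0).
rewrite -[y]reprK -[x]reprK; apply/proj_pt_eqP.
exists (coords y 0 l / coords x 0 l); first by rewrite mulf_neq0 ?invr_eq0.
apply/rowP => i; rewrite mxE -/(coords x) -/(coords y).
by apply: (mulfI xl0); rewrite py mulrA mulrCA divff // mulr1 mulrC.
Qed.

Lemma hyperplane_cut fs Z z : (forall p, p \in fs -> homogeneous p) ->
  irreducible_component (zeros fs) Z -> Z z -> Z <> [set z] ->
  exists l Y, [/\ homogeneous l, irreducible_component (zeros (l :: fs)) Y,
    Y `<` Z & closed Y].
Proof.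
move=> hfs Zcomp Zz Zpoint; have [Zirr Zfs Zmax] := Zcomp.
have cfs := closed_zeros hfs; have cZ := component_closed cfs Zcomp.
have [u [hu Zu uP]] := isolate_component cfs Zcomp.
move: Zu => /existsNP[y /not_implyP[Zy uy]].
have [y' Zy' yy'] : exists2 y', Z y' & y <> y'.
  apply: contrapT => no; have Zyy x : Z x -> y = x.
    by move=> Zx; apply: contrapT => yx; apply: no; exists x.
  apply: Zpoint; apply/seteqP; split=> [x Zx|x ->//] /=.
  by rewrite -(Zyy x Zx) -(Zyy z Zz).
have [l [hl ly ly']] := separating_hyperplane yy'.
have hlfs p : p \in l :: fs -> homogeneous p.
  by rewrite inE => /predU1P[->|/hfs].
have [|Y Ycomp Yy] := @component_through _ (zeros (l :: fs)) y.
  by move=> p; rewrite inE => /predU1P[->|pfs] //; apply: Zfs.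
have [Yirr Ylfs Ymax] := Ycomp.
have cY := component_closed (closed_zeros hlfs) Ycomp.
have Yfs x : Y x -> zeros fs x.
  by move=> /Ylfs lx p pfs; apply: lx; rewrite inE pfs orbT.
have Yl x : Y x -> hypersurface l x by move=> /Ylfs; apply; rewrite inE eqxx.
exists l, Y; split=> //; split; last by move=> /(_ y' Zy')/Yl.
(* Off u = 0 all zeros of fs lie in Z, so a dense part of Y does. *)
apply: (irreducible_dense Yirr (U := ~` hypersurface u)) => //.
- by rewrite openC; apply: closed_hypersurface.
- by exists y.
- by move=> x [/Yfs fx ux]; apply: uP.
Qed.

(* Cutting a component by a hyperplane through one of its points that lies on
   no other component adds one equation and shortens the chains; an isolated
   point remains after at most d cuts. *)
Theorem component_dimension fs Z d : (forall p, p \in fs -> homogeneous p) ->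
  irreducible_component (zeros fs) Z -> chain_bound Z d -> (g <= size fs + d)%N.
Proof.
elim: d fs Z => [|d IHd] fs Z hfs Zcomp Zd; have [Zirr Zfs _] := Zcomp;
  have [[z Zz] _] := Zirr; have [ZE|Zz'] := pselect (Z = [set z]).
1,3: rewrite ZE in Zcomp.
1,2: have [u [hu Zu uP]] := isolate_component (closed_zeros hfs) Zcomp.
1,2: apply: leq_trans (leq_addr _ _).
1,2: apply: (isolated_point_equations (u := u) (z := z)) => //; first exact: Zfs.
1,2: by move=> uz; apply: Zu => _ ->.
  have [l [Y [_ [Yirr _ _] YZ cY]]] := hyperplane_cut hfs Zcomp Zz Zz'.
  by have := Zd _ (ex_intro _ _ (chain_extend Zirr cY YZ (chain0 Yirr))).
have [l [Y [hl Ycomp YZ cY]]] := hyperplane_cut hfs Zcomp Zz Zz'.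
rewrite addnS -addSn; apply: (IHd (l :: fs) Y) => //.
  by move=> p; rewrite inE => /predU1P[->|/hfs].
by move=> m [C YC]; apply: (Zd m.+1); eexists; apply: (chain_extend Zirr cY YZ YC).
Qed.

End ComponentDimension.

(** * Hilbert functions *)

Section HilbertFunction.
Variables (k : closedFieldType) (g : nat).
Local Notation proj := (proj_space k g).
Local Notation form := {mpoly k[g.+1]}.
Implicit Types (p q f : form) (x y z : proj) (A Y Z : set proj).

Lemma sub_hypersurface_sum Z (I : Type) (r : seq I) (P : pred I) (F : I -> form) :
  (forall i, P i -> Z `<=` hypersurface (F i)) ->
  Z `<=` hypersurface (\sum_(i <- r | P i) F i).
Proof.
move=> ZF x Zx; rewrite /hypersurface /= /peval raddf_sum big1 // => i Pi.
exact: (ZF i Pi x Zx).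
Qed.

Lemma sub_hypersurfaceZ Z c p : Z `<=` hypersurface p -> Z `<=` hypersurface (c *: p).
Proof. by move=> Zp x /Zp; rewrite /hypersurface /= pevalZ => ->; rewrite mulr0. Qed.

Lemma sub_hypersurfaceMl Z p q : Z `<=` hypersurface p -> Z `<=` hypersurface (q * p).
Proof. by move=> Zp x /Zp; rewrite hypersurfaceM; right. Qed.

Lemma sub_hypersurfaceD Z p q : Z `<=` hypersurface p -> Z `<=` hypersurface q ->
  Z `<=` hypersurface (p + q).
Proof.
move=> Zp Zq x Zx; move: (Zp x Zx) (Zq x Zx).
by rewrite /hypersurface /= pevalD => -> ->; rewrite addr0.
Qed.

Lemma dhomog_varX (l : 'I_g.+1) d : ('X_l ^+ d : form) \is d.-homog.
Proof. by rewrite mpolyXn dhomogX /= mdegMn mdeg1 mul1n. Qed.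

(* The Hilbert function of Z takes a value >= n at d: there are n forms of
   degree d that are independent modulo the ideal of Z. *)
Definition hilbert_ge Z (d n : nat) : Prop :=
  exists L : 'I_n -> form, (forall i, L i \is d.-homog) /\
    forall a : 'I_n -> k, Z `<=` hypersurface (\sum_i a i *: L i) ->
    forall i, a i = 0.

Lemma hilbert_ge1 Z d : Z !=set0 -> hilbert_ge Z d 1.
Proof.
move=> [z Zz]; have /rV0Pn[l zl] := coords_neq0 z.
exists (fun=> 'X_l ^+ d); split=> [_|a aZ i].
  exact: dhomog_varX.
move: (aZ z Zz); rewrite big_ord1 /hypersurface /= pevalZ /peval rmorphXn /= mevalXU.
move=> /eqP; rewrite mulf_eq0 expf_eq0 (negPf zl) andbF orbF => /eqP a0.
by rewrite [i]ord1.
Qed.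

(** Multiplication by f is injective modulo the prime ideal of Z, and its image vanishes on Y; so
    the independent forms for Y and f times those for Z remain independent together. *)
Lemma hilbert_ge_step Y Z f d e a b : irreducible_set Z -> Y `<=` Z ->
  f \is e.-homog -> Y `<=` hypersurface f -> ~ (Z `<=` hypersurface f) ->
  hilbert_ge Y (e + d) a -> hilbert_ge Z d b -> hilbert_ge Z (e + d) (a + b).
Proof.
move=> Zirr YZ hf Yf Zf [L1 [hL1 L1ind]] [L2 [hL2 L2ind]].
pose L i := match fintype.split i with inl j => L1 j | inr j => f * L2 j end.
exists L; split=> [i|c cZ].
  by rewrite /L; case: (fintype.split i) => j //; apply: dhomogM.
pose s1 := \sum_j c (lshift b j) *: L1 j.
pose s2 := \sum_j c (rshift a j) *: L2 j.
have sE : \sum_i c i *: L i = s1 + f * s2.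
  rewrite big_split_ord /= mulr_sumr; congr (_ + _); apply: eq_bigr => j _.
    by rewrite /L (unsplitK (inl j)).
  by rewrite /L (unsplitK (inr j)) scalerAr.
have c1 : forall j, c (lshift b j) = 0.
  apply: L1ind => x Yx; have := cZ x (YZ x Yx).
  rewrite sE /hypersurface /= pevalD pevalM.
  by have := Yf x Yx; rewrite /hypersurface /= => ->; rewrite mul0r addr0.
have s10 : s1 = 0 by rewrite /s1 big1 // => j _; rewrite c1 scale0r.
have hs2 : homogeneous s2.
  by exists d; apply: rpred_sum => j _; apply: dhomogZ.
have c2 : forall j, c (rshift a j) = 0.
  apply: L2ind; have : Z `<=` hypersurface (f * s2) by rewrite -[f * s2]add0r -s10 -sE.
  by case/(irreducible_hypersurfaceM Zirr (ex_intro _ e hf) hs2).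
by move=> i; rewrite -(splitK i); case: (fintype.split i).
Qed.

(** The separating forms are brought to a common degree D by powers of a coordinate that is nonzero
    at the separated point. *)
Lemma chain_forms A m (C : nat -> set proj) : closed A -> irreducible_chain A m C ->
  exists D, forall i, (i < m)%N -> exists f,
    [/\ f \is D.-homog, C i `<=` hypersurface f & ~ (C i.+1 `<=` hypersurface f)].
Proof.
move=> cA [Cirr Cinc].
have /choice[p pP] i : exists p : nat * form, (i < m)%N ->
    [/\ p.2 \is p.1.-homog, C i `<=` hypersurface p.2 &
        ~ (C i.+1 `<=` hypersurface p.2)].
  have [lt_im|_] := boolP (i < m)%N; last by exists (0%N, 0).
  have [_ [E cE CE]] := Cirr i (ltnW lt_im).
  have [_ /existsNP[x /not_implyP[Cx nCx]]] := Cinc i lt_im.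
  have [|q [[d hq] Cq qx]] := closed_separation _ nCx.
    by rewrite CE; apply: closedI.
  by exists (d, q) => _; split=> // /(_ x Cx).
exists (\sum_(i < m) (p i).1)%N => i lt_im.
have [hp Cp nCp] := pP i lt_im; set D := (\sum_(_ < _) _)%N.
have le_D : ((p i).1 <= D)%N by rewrite /D (bigD1 (Ordinal lt_im)) //= leq_addr.
move: nCp => /existsNP[x /not_implyP[Cx px]].
have /rV0Pn[l xl] := coords_neq0 x.
exists ((p i).2 * 'X_l ^+ (D - (p i).1)); split.
- by have := dhomogM hp (dhomog_varX l (D - (p i).1)); rewrite subnKC.
- by move=> y /Cp; rewrite hypersurfaceM; left.
- move=> /(_ x Cx); rewrite hypersurfaceM => -[//|].
  rewrite /hypersurface /= /peval rmorphXn /= mevalXU => /eqP.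
  by rewrite expf_eq0 (negPf xl) andbF.
Qed.

(** Induction on i and d, where [hilbert_ge_step] becomes Pascal's rule. *)
Lemma chain_hilbert_ge A m (C : nat -> set proj) : closed A ->
  irreducible_chain A m C ->
  exists D, forall d, hilbert_ge A (d * D) 'C(d + m, m).
Proof.
move=> cA AC; have [D Dforms] := chain_forms cA AC; have [Cirr Cinc] := AC.
suff main i : (i <= m)%N -> forall d, hilbert_ge (C i) (d * D) 'C(d + i, i).
  exists D => d; have [L [hL Lind]] := main m (leqnn m) d.
  exists L; split=> // a aA; apply: Lind => x Cx; apply: aA.
  by have [_ [E _ CE]] := Cirr m (leqnn m); move: Cx; rewrite CE => -[].
elim: i => [|i IHi] lt_im d.
  by rewrite addn0 bin0; apply: hilbert_ge1; have [[]] := Cirr 0%N isT.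
have [Zirr _] := Cirr _ lt_im.
elim: d => [|d IHd]; first by rewrite add0n binn; apply: hilbert_ge1; case: Zirr.
have [f [hf Cf nCf]] := Dforms i lt_im.
rewrite mulSn addSn addnS binS [X in hilbert_ge _ _ X]addnC -addSn.
apply: (hilbert_ge_step Zirr _ hf Cf nCf); last by rewrite addSnnS.
  by have [] := Cinc i lt_im.
by rewrite -mulSn; apply: IHi; apply: ltnW.
Qed.

Definition spanning A d (T : finType) (B : T -> form) : Prop :=
  forall p, p \is d.-homog -> exists2 q, lspan B q & A `<=` hypersurface (p - q).

Lemma hilbert_ge_spanning A d n (T : finType) (B : T -> form) :
  hilbert_ge A d n -> spanning A d B -> (n <= #|T|)%N.
Proof.
move=> [L [hL Lind]] AB; rewrite leqNgt; apply/negP => lt_Tn.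
have /choice[e eP] i : exists e : T -> k,
    A `<=` hypersurface (L i - \sum_s e s *: B s).
  by have [q [e ->]] := AB _ (hL i); exists e.
have [|a [i ai] aE] := underdetermined e; first by rewrite card_ord.
move/eqP: ai; apply; apply: Lind => x Ax.
suff -> : \sum_i a i *: L i = \sum_i a i *: (L i - \sum_s e i s *: B s).
  apply: (@sub_hypersurface_sum A) => // j _; apply: sub_hypersurfaceZ.
  exact: eP.
under [RHS]eq_bigr do rewrite scalerBr.
rewrite big_split /= sumrN [X in _ - X](_ : _ = 0) ?subr0 //.
under eq_bigr do rewrite scaler_sumr.
rewrite exchange_big big1 // => s _; under eq_bigr do rewrite scalerA.
by rewrite -scaler_suml aE scale0r.
Qed.

Lemma span_by_monomials A (T : finType) (B : T -> form) p :
  (forall m, m \in msupp p ->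
     exists2 q, lspan B q & A `<=` hypersurface ('X_[m] - q)) ->
  exists2 q, lspan B q & A `<=` hypersurface (p - q).
Proof.
rewrite {2}[p]mpolyE big_seq; move: (msupp p) => r AB.
elim/big_rec: _ => [|m q' /AB[q Bq Aq] [q2 Bq2 Aq2]].
  exists 0; first exact: lspan0.
  by rewrite subr0 => x _; rewrite /hypersurface /= /peval meval0.
exists (p@_m *: q + q2); first by apply: lspanD => //; apply: lspanZ.
rewrite opprD addrACA -scalerBr; apply: sub_hypersurfaceD => //.
exact: sub_hypersurfaceZ.
Qed.

Lemma spanning_monomials A d (T : finType) (B : T -> form) :
  (forall m, mdeg m = d -> exists2 q, lspan B q & A `<=` hypersurface ('X_[m] - q)) ->
  spanning A d B.
Proof. by move=> AB p /dhomogP hp; apply: span_by_monomials => m /hp/AB. Qed.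

(** D stands for the common degree of the forms separating a chain, unknown in advance; the constant
    C may depend on it. *)
Definition growth_bound A (b : nat) : Prop :=
  forall D, exists C, forall d, exists (T : finType) (B : T -> form),
    spanning A (d * D) B /\ (#|T| <= C * d.+1 ^ b)%N.

Lemma expn_le_ffact d e : (d.+1 ^ e <= (d + e) ^_ e)%N.
Proof.
elim: e => // e IHe; rewrite addnS ffactSS expnS.
by apply: leq_mul => //; rewrite ltnS leq_addr.
Qed.

(** (d + 1)^m is at most m! 'C(d + m, m), which the spanning sets bound by a constant times (d +
    1)^b. *)
Lemma growth_chain_bound A b : closed A -> growth_bound A b -> chain_bound A b.
Proof.
move=> cA Ab m [C AC]; have [D hD] := chain_hilbert_ge cA AC.
have [c cP] := Ab D; apply: (@leq_exponent _ _ (c * m`!)) => d.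
apply: leq_trans (expn_le_ffact d m) _; rewrite -bin_ffact mulnAC leq_mul2r.
have [T [B [AB le_T]]] := cP d.
by rewrite (leq_trans _ le_T) ?orbT //; apply: hilbert_ge_spanning (hD d) AB.
Qed.

End HilbertFunction.

(** * Closed sets that miss the hyperplane G_0 = 0 *)

Section MissingHyperplane.
Variables (k : closedFieldType) (g : nat).
Local Notation proj := (proj_space k g).
Local Notation form := {mpoly k[g.+1]}.
Implicit Types (p q f : form) (x y z : proj) (A Y Z : set proj) (v : 'rV[k]_g.+1).

Lemma peval_homog p d (c : k) v : p \is d.-homog ->
  peval p (c *: v) = c ^+ d * peval p v.
Proof.
move=> /dhomogP hp; rewrite /peval !mevalE mulr_sumr big_seq [RHS]big_seq.
apply: eq_bigr => m /hp /= <-; rewrite mulrCA mdegE -prodrXr -big_split /=.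
by congr (_ * _); apply: eq_bigr => i _; rewrite mxE exprMn.
Qed.

(** The Nullstellensatz yields a cofactor q that need not be homogeneous. Along the line through v
    both sides are polynomials in t, and the coefficient of t^(e + 1) selects the part of q of
    degree e. *)
Lemma eq_peval_scale p q e v : p \is e.+1.-homog ->
  (forall t : k, t != 0 -> peval p (t *: v) = peval (q * 'X_ord0) (t *: v)) ->
  peval p v = peval (pihomog mdeg e q * 'X_ord0) v.
Proof.
move=> hp pq; pose K := maxn (msize q) e.+1.
pose P : {poly k} := peval p v *: 'X^(e.+1) -
  \sum_(d < K) (peval (pihomog mdeg d q) v * v 0 ord0) *: 'X^(d.+1).
(* The factor 'X takes care of t = 0, where the hypothesis says nothing. *)
have P0 : P * 'X = 0.
  apply/eqP/contraT => /closed_nonrootP[t].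
  rewrite /root hornerM hornerX mulf_eq0 negb_or => /andP[/eqP Pt t0].
  exfalso; apply: Pt; rewrite /P hornerD hornerN hornerZ hornerXn horner_sum.
  have := pq t t0; rewrite (peval_homog _ _ hp) pevalM pevalX mxE mulrC => ->.
  rewrite {1}(@pihomog_partitionE _ _ mdeg K q) ?leq_maxl //.
  rewrite /peval raddf_sum mulr_suml /=; apply/eqP; rewrite subr_eq0; apply/eqP.
  apply: eq_bigr => d _; rewrite hornerZ hornerXn -/(peval _ _).
  by rewrite (peval_homog _ _ (pihomogP _ _ _)) exprSr; ring.
have := coefMX P e.+2; rewrite P0 coef0 /= /P coefB coefZ coefXn eqxx mulr1.
have lt_eK : (e < K)%N by rewrite leq_max ltnSn orbT.
rewrite coef_sum (bigD1 (Ordinal lt_eK)) //= coefZ coefXn eqxx mulr1 big1.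
  by rewrite addr0 pevalM pevalX => /esym/eqP; rewrite subr_eq0 => /eqP.
move=> d ne; rewrite coefZ coefXn eqSS eq_sym.
by rewrite -val_eqE /= in ne; rewrite (negPf ne) mulr0.
Qed.

Variables (Z : set proj).
Hypotheses (cZ : closed Z) (Z0 : forall x, Z x -> coords x 0 ord0 != 0).

(** The cone over Z meets X_0 = 0 at most in the origin, so the ideal of the cone together with X_0
    contains a power of every variable. *)
Lemma integral_over_var0 : exists e, forall i, exists b : form,
  b \is e.-homog /\ Z `<=` hypersurface ('X_i ^+ e.+1 - 'X_ord0 * b).
Proof.
pose I : set form := [set p | forall v (v0 : v != 0), Z (point v0) -> peval p v = 0].
have iI : ideal I.
  split=> [v v0 _|p q Ip Iq v v0 Zv|a p Ip v v0 Zv].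
  - by rewrite /peval meval0.
  - by rewrite pevalD (Ip v v0) // (Iq v v0) // addr0.
  - by rewrite pevalM (Ip v v0) // mulr0.
have IM i : exists M, adjoin I 'X_ord0 ('X_i ^+ M).
  apply: radical_nullstellensatz => [|y yI]; first exact: adjoin_ideal.
  have y0 : y ord0 = 0.
    by have := yI _ (mem_adjoin _ iI); rewrite mevalXU.
  pose Y : 'rV[k]_g.+1 := \row_i y i.
  have YE p : peval p Y = p.@[y] by apply: meval_eq => j; rewrite mxE.
  have [Y0|Y0] := eqVneq Y 0.
    by rewrite mevalXU; have /rowP/(_ i) := Y0; rewrite !mxE.
  have ZY : ~ Z (point Y0).
    move=> /Z0; have [c _ ->] := coords_point Y0.
    by rewrite !mxE y0 mulr0 eqxx.
  have [p [hp Zp pY]] := closed_separation cZ ZY.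
  exfalso; apply: pY; apply/(hypersurface_point Y0 hp); rewrite YE.
  apply: yI; apply: sub_adjoin => v v0 /Zp.
  by move/(hypersurface_point v0 hp).
have [M MP] := choice IM; pose e := (\max_i M i)%N.
exists e => i; have le_M : (M i <= e.+1)%N by rewrite leqW // leq_bigmax.
have [a Ia] : adjoin I 'X_ord0 ('X_i ^+ e.+1).
  rewrite -(subnK le_M) exprD.
  by have [_ _ aM] := adjoin_ideal 'X_ord0 iI; apply: aM; apply: MP.
exists (pihomog mdeg e a); split=> [|x Zx]; first exact: pihomogP.
rewrite /hypersurface /= /peval mevalB; apply/eqP; rewrite subr_eq0; apply/eqP.
rewrite ['X_ord0 * _]mulrC; apply: eq_peval_scale => [|t t0]; first exact: dhomog_varX.
have tx0 : t *: coords x != 0.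
  by rewrite scaler_eq0 negb_or t0 coords_neq0.
have xt : x = point tx0 by apply: (point_coords tx0 t0).
have := Ia _ tx0; rewrite -xt => /(_ Zx)/eqP.
by rewrite /peval mevalB subr_eq0 => /eqP.
Qed.

(** Modulo the ideal of Z a power X_i^(e + 1) can be traded for X_0 times a form of degree e. Hence
    the monomials with exponents at most e span over k[X_0], and their number bounds the Hilbert
    function. *)
Lemma missing_hyperplane_growth : growth_bound Z 0.
Proof.
have [e eP] := integral_over_var0 => D; exists (e.+1 ^ g.+1)%N => d.
move: (d * D)%N => {D}n.
pose B n (ga : {ffun 'I_g.+1 -> 'I_e.+1}) : form :=
  if (\sum_i ga i <= n)%N then
    'X_ord0 ^+ (n - \sum_i ga i) * 'X_[[multinom ga i : nat | i < g.+1]] else 0.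
exists {ffun 'I_g.+1 -> 'I_e.+1}, (B n); split; last first.
  by rewrite card_ffun !card_ord expn0 muln1.
elim: n => [|n IHn]; apply: spanning_monomials => m mdeg_m.
  have -> : m = 0%MM by apply/eqP; rewrite -mdeg_eq0 mdeg_m.
  exists (B 0%N [ffun=> ord0]); first exact: mem_lspan.
  rewrite /B; under eq_bigr do rewrite ffunE.
  rewrite big1 // subn0 expr0 mul1r [X in _ - X](_ : _ = 'X_[0]).
    by rewrite subrr => x _; rewrite /hypersurface /= /peval meval0.
  by congr 'X_[_]; apply/mnmP => i; rewrite mnmE ffunE mnm0E.
have [/forallP lt_m|] := boolP [forall i, (i != ord0) ==> (m i < e.+1)%N].
  pose ga : {ffun 'I_g.+1 -> 'I_e.+1} := [ffun i => if i == ord0 then ord0 else inord (m i)].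
  have gaE i : ga i = (if i == ord0 then 0 else m i)%N :> nat.
    rewrite ffunE; case: eqP => // /eqP i0.
    by rewrite inordK //; move: (lt_m i); rewrite i0.
  have sumE : (m ord0 + \sum_i ga i)%N = n.+1.
    rewrite -mdeg_m mdegE [RHS](bigD1 ord0) //= (bigD1 ord0) //= gaE eqxx add0n.
    by congr (_ + _)%N; apply: eq_bigr => i /negPf i0; rewrite gaE i0.
  exists (B n.+1 ga); first exact: mem_lspan.
  rewrite /B ifT; last by rewrite -sumE leq_addl.
  rewrite -[in (_ - _)%N]sumE addnK [X in _ - X](_ : _ = 'X_[m]).
    by rewrite subrr => x _; rewrite /hypersurface /= /peval meval0.
  rewrite mpolyXn -mpolyXD; congr 'X_[_]; apply/mnmP => i.
  rewrite mnmDE mulmnE mnm1E mnmE gaE eq_sym.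
  by case: eqP => [->|_]; rewrite ?mul1n ?addn0 ?mul0n.
rewrite negb_forall => /existsP[i]; rewrite negb_imply -leqNgt => /andP[_ le_m].
have [b [hb Zb]] := eP i.
pose m' := (m - U_(i) *+ e.+1)%MM.
have mE : m = (U_(i) *+ e.+1 + m')%MM.
  rewrite addmC submK //; apply/mnm_lepP => j.
  by rewrite mulmnE mnm1E; case: eqP => [<-|_]; rewrite ?mul1n ?mul0n.
have mdeg_m' : (e + mdeg m')%N = n.
  by move: mdeg_m; rewrite {1}mE mdegD mdegMn mdeg1 mul1n addSn => -[].
have hbm : b * 'X_[m'] \is n.-homog.
  by rewrite -mdeg_m'; apply: dhomogM => //; rewrite dhomogX.
have [q [c ->] Zq] := IHn _ hbm.
exists ('X_ord0 * \sum_s c s *: B n s).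
  rewrite mulr_sumr; apply: lspan_sum => s _; rewrite -scalerAr; apply: lspanZ.
  rewrite [B n s]/B; case: ifP => le_s; last by rewrite mulr0; exact: lspan0.
  rewrite mulrA -exprS -subSn // -[X in lspan _ X](_ : B n.+1 s = _).
    exact: mem_lspan.
  by rewrite /B leqW.
have -> : 'X_[m] - 'X_ord0 * \sum_s c s *: B n s =
    'X_[m'] * ('X_i ^+ e.+1 - 'X_ord0 * b) +
    'X_ord0 * (b * 'X_[m'] - \sum_s c s *: B n s).
  by rewrite {1}mE mpolyXD -mpolyXn; ring.
by apply: sub_hypersurfaceD; apply: sub_hypersurfaceMl.
Qed.

End MissingHyperplane.

(** * Leading monomials of the minors *)

Section Rearrangement.
Variables (m B : nat) (a b : 'I_m.+1 -> nat).
Hypothesis lt_mB : (m.+1 < B)%N.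
Hypothesis a_inc : forall u v : 'I_m.+1, (u < v)%N -> (a u < a v)%N.
Hypothesis b_inc : forall u v : 'I_m.+1, (u < v)%N -> (b u < b v)%N.

(* At the largest index moved by s the diagonal exponent beats all the others. *)
Lemma rearrangement (s : 'S_m.+1) : s != 1%g ->
  (\sum_u B ^ (a u + b (s u)) < \sum_u B ^ (a u + b u))%N.
Proof.
move=> s1; have [i0 si0] : exists i, s i != i.
  apply/existsP; rewrite -negb_forall; apply: contra s1 => /forallP sE.
  by apply/eqP/permP => i; rewrite perm1; apply/eqP.
pose w := [arg max_(i > i0 | s i != i) (i : nat)].
have [sw wmax] : s w != w /\ forall i, s i != i -> (i <= w)%N.
  by rewrite /w; case: arg_maxnP.
have fix_gt (i : 'I_m.+1) : (w < i)%N -> s i = i.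
  by rewrite ltnNge; apply: contraNeq => /wmax.
have s_le (i : 'I_m.+1) : (i <= w)%N -> (s i <= w)%N.
  move=> le_iw; rewrite leqNgt; apply/negP => lt_ws.
  have /perm_inj si := fix_gt _ lt_ws.
  by move: lt_ws; rewrite si ltnNge le_iw.
have le_inc (f : 'I_m.+1 -> nat) :
    (forall u v : 'I_m.+1, (u < v)%N -> (f u < f v)%N) ->
    forall u v : 'I_m.+1, (u <= v)%N -> (f u <= f v)%N.
  move=> f_inc u v; rewrite leq_eqVlt => /predU1P[/val_inj->//|].
  by move/f_inc/ltnW.
rewrite (bigID (fun u : 'I_m.+1 => (w < u)%N)) [ltnRHS](bigID (fun u : 'I_m.+1 => (w < u)%N)) /=.
rewrite (eq_bigr (fun u => B ^ (a u + b u))%N) => [|u /fix_gt->//].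
rewrite ltn_add2l.
have B0 : (0 < B)%N by apply: leq_ltn_trans lt_mB.
have w0 : (0 < a w + b w)%N.
  rewrite lt0n; apply: contra sw; rewrite addn_eq0 => /andP[/eqP aw _].
  have w0 : (w : nat) = 0%N.
    apply/eqP; rewrite -leqn0 leqNgt; apply/negP => w0.
    by have := a_inc (u := ord0) w0; rewrite aw.
  by apply/eqP/val_inj; have := s_le w (leqnn w); rewrite /= w0; lia.
(* Up to w both u and s u are at most w and not both equal to w, so the exponents stay below a w + b
   w; there are at most m + 1 < B of them. *)
apply: (@leq_ltn_trans (\sum_(u < m.+1) B ^ (a w + b w).-1)%N).
  rewrite [leqRHS](bigID (fun u : 'I_m.+1 => (w < u)%N)) /=.
  apply: leq_trans (leq_addl _ _); apply: leq_sum => u; rewrite -leqNgt => le_uw.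
  rewrite leq_pexp2l // -ltnS prednK //.
  have := le_inc a a_inc u w le_uw; have := le_inc b b_inc (s u) w (s_le u le_uw).
  have [uw|uw] := eqVneq u w.
    have /b_inc : (s u < w)%N.
      by rewrite ltn_neqAle s_le // andbT uw; apply: contra sw => /eqP/val_inj->.
    lia.
  have /a_inc : (u < w)%N by rewrite ltn_neqAle le_uw andbT; apply: contra uw => /eqP/val_inj->.
  lia.
rewrite sum_nat_const card_ord.
apply: (@leq_trans (B ^ (a w + b w))%N).
  by rewrite -[in X in (_ < B ^ X)%N](prednK w0) expnS ltn_pmul2r // expn_gt0 B0.
by rewrite (bigD1 w) /= ?ltnn ?leq_addr.
Qed.

End Rearrangement.

Section Weight.
Variables (k : fieldType) (N B : nat).
Local Notation form := {mpoly k[N]}.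
Implicit Types (p q : form).

Definition weight (m : 'X_{1..N}) : nat := (\sum_i m i * B ^ i)%N.

Lemma weightD m1 m2 : weight (m1 + m2) = (weight m1 + weight m2)%N.
Proof.
by rewrite -big_split; apply: eq_bigr => i _; rewrite mnmDE mulnDl.
Qed.

Lemma weightU i : weight U_(i)%MM = (B ^ i)%N.
Proof.
rewrite /weight (bigD1 i) //= mnm1E eqxx mul1n big1 ?addn0 // => j /negPf ji.
by rewrite mnm1E eq_sym ji.
Qed.

Definition weight_lt d w p : Prop :=
  forall m, m \in msupp p -> mdeg m = d /\ (weight m < w)%N.

Lemma weight_ltW d w w' p : (w <= w')%N -> weight_lt d w p -> weight_lt d w' p.
Proof. by move=> le pw m /pw[-> lt]; split=> //; apply: leq_trans le. Qed.

Lemma weight_lt0 d w : weight_lt d w 0.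
Proof. by move=> m; rewrite msupp0. Qed.

Lemma weight_ltD d w p q :
  weight_lt d w p -> weight_lt d w q -> weight_lt d w (p + q).
Proof. by move=> pw qw m /msuppD_le; rewrite mem_cat => /orP[/pw|/qw]. Qed.

Lemma weight_ltZ d w c p : weight_lt d w p -> weight_lt d w (c *: p).
Proof. by move=> pw m /msuppZ_le/pw. Qed.

Lemma weight_ltM d w e v p q :
  weight_lt d w.+1 p -> weight_lt e v q -> weight_lt (d + e) (w + v) (p * q).
Proof.
move=> pw qv m /msuppM_le/allpairsP[[m1 m2] /= [/pw[<- lt1] /qv[<- lt2] ->]].
by rewrite mdegD weightD; split=> //; apply: leq_ltn_trans (_ : _ <= w + weight m2)%N _;
  rewrite ?leq_add2r ?ltn_add2l.
Qed.

Lemma weight_ltX m : weight_lt (mdeg m) (weight m).+1 'X_[m].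
Proof. by move=> m'; rewrite msuppX inE => /eqP->. Qed.

Lemma weight_lt_sum d w (I : Type) (r : seq I) (P : pred I) (F : I -> form) :
  (forall i, P i -> weight_lt d w (F i)) -> weight_lt d w (\sum_(i <- r | P i) F i).
Proof.
by move=> Fw; elim/big_ind: _ => //; [apply: weight_lt0|apply: weight_ltD].
Qed.

Lemma weight_lt_prod n (w : 'I_n -> nat) (F : 'I_n -> form) :
  (forall i, weight_lt 1 (w i).+1 (F i)) ->
  weight_lt n (\sum_i w i).+1 (\prod_i F i).
Proof.
move=> Fw; elim: n w F Fw => [|n IHn] w F Fw.
  by rewrite !big_ord0 -mpolyX0 => m; rewrite msuppX inE => /eqP->;
    rewrite mdeg0 /weight big1 // => i _; rewrite mnm0E.
rewrite !big_ord_recl -addnS; apply: (weight_ltM (d := 1)); first exact: Fw.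
by apply: IHn => i; apply: Fw.
Qed.

(** The correction terms of the matrix entries involve only X_0, the lightest variable, so choosing
    one of them in the product lowers the weight. *)
Lemma weight_lt_leading n (l : 'I_n -> 'I_N) (o : 'I_N) (c : 'I_n -> k) :
  (1 < B)%N -> o = 0%N :> nat -> (forall i, 0 < l i)%N ->
  weight_lt n (\sum_i B ^ l i)
    (\prod_i ('X_(l i) + c i *: 'X_o) - \prod_i 'X_(l i)).
Proof.
move=> B1 o0; elim: n l c => [|n IHn] l c l0.
  by rewrite !big_ord0 subrr; apply: weight_lt0.
have Xw i : weight_lt 1 (B ^ (l i)).+1 ('X_(l i) : form).
  by have := @weight_ltX U_(l i)%MM; rewrite mdeg1 weightU.
have ow : weight_lt 1 2 ('X_o : form).
  by have := @weight_ltX U_(o)%MM; rewrite mdeg1 weightU o0 expn0.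
have lt_o i : (1 < B ^ l i)%N by rewrite -(expn0 B) ltn_exp2l.
set p := \prod_(i < n.+1) ('X_(l i) + _); rewrite !big_ord_recl /p big_ord_recl.
set p1 := \prod_(i < n) _; set p2 := \prod_(i < n) _.
have p1w : weight_lt n (\sum_(i < n) B ^ l (lift ord0 i)).+1 p1.
  apply: weight_lt_prod => i; apply: weight_ltD; first exact: Xw.
  apply: weight_ltZ; apply: weight_ltW ow; by rewrite ltnS ltnW.
have -> : ('X_(l ord0) + c ord0 *: 'X_o) * p1 - 'X_(l ord0) * p2 =
    'X_(l ord0) * (p1 - p2) + (c ord0 *: 'X_o) * p1.
  by rewrite mulrDl mulrBr addrAC.
apply: weight_ltD.
  by apply: (weight_ltM (d := 1)); [exact: Xw | apply: IHn => i; apply: l0].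
have cow := @weight_ltZ 1 2 (c ord0) _ ow.
apply: weight_ltW (weight_ltM (d := 1) (w := 1) cow p1w).
by rewrite addnS -addSn leq_add2r.
Qed.

End Weight.

Section RibbonForms.
Variables (k : closedFieldType) (g n : nat) (F : ribbon_data k g).
Local Notation proj := (proj_space k g).
Local Notation form := {mpoly k[g.+1]}.
Implicit Types (A Z : set proj) (x : proj) (G : 'rV[k]_g.+1) (p : form).
Local Notation S := (ribbon_matrix n F).

Definition ribbon_form (i j : nat) : form :=
  'X_(inord (i + j).+1) + (j%:R * ribbon_coef F (i + j)) *: 'X_ord0.

Lemma peval_ribbon_form (i : 'I_(g - n)) (j : 'I_n.+1) G :
  peval (ribbon_form i j) G = S G i j.
Proof. by rewrite /peval mevalD mevalZ !mevalXU mxE. Qed.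

Lemma ribbon_form_homog i j : ribbon_form i j \is 1.-homog.
Proof. by apply: rpredD; [|apply: dhomogZ]; rewrite dhomogX; apply/eqP/mdeg1. Qed.

Definition ribbon_minor d (a : 'I_d -> 'I_(g - n)) (b : 'I_d -> 'I_n.+1) : form :=
  \det (\matrix_(u, v) ribbon_form (a u) (b v)).

Lemma peval_ribbon_minor d (a : 'I_d -> 'I_(g - n)) (b : 'I_d -> 'I_n.+1) G :
  peval (ribbon_minor a b) G = \det (mxsub a b (S G)).
Proof.
rewrite /ribbon_minor -[LHS]/(meval (fun i => G 0 i) _) -det_map_mx.
congr (\det _); apply/matrixP => u v.
by rewrite !mxE -[LHS]/(peval _ G) peval_ribbon_form mxE.
Qed.

Lemma dhomog_prod_ord d (f : 'I_d -> form) :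
  (forall i, f i \is 1.-homog) -> \prod_i f i \is d.-homog.
Proof.
elim: d f => [|d IHd] f hf; first by rewrite big_ord0; apply: dhomog1.
by rewrite big_ord_recl; apply: (dhomogM (d := 1)) => //; apply: IHd.
Qed.

Lemma sign_homog (b : bool) d p : p \is d.-homog -> (-1) ^+ b * p \is d.-homog.
Proof. by rewrite mulr_sign; case: b => // hp; apply: rpredNr. Qed.

Lemma det_homog d (M : 'M[form]_d) :
  (forall i j, M i j \is 1.-homog) -> \det M \is d.-homog.
Proof.
by move=> hM; apply: rpred_sum => s _; apply: sign_homog; apply: dhomog_prod_ord.
Qed.

Lemma adjugate_homog d (M : 'M[form]_d) i j :
  (forall i j, M i j \is 1.-homog) -> (\adj M) i j \is d.-1.-homog.
Proof.
move=> hM; rewrite mxE /cofactor -signr_odd; apply: sign_homog.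
by apply: det_homog => u v; rewrite !mxE.
Qed.

Lemma ribbon_minor_homog d (a : 'I_d -> 'I_(g - n)) (b : 'I_d -> 'I_n.+1) :
  ribbon_minor a b \is d.-homog.
Proof. by apply: det_homog => u v; rewrite mxE; apply: ribbon_form_homog. Qed.

Lemma rank_mxsub (m1 m2 d1 d2 : nat) (M : 'M[k]_(m1, m2)) (a : 'I_d1 -> 'I_m1)
  (b : 'I_d2 -> 'I_m2) : (\rank (mxsub a b M) <= \rank M)%N.
Proof.
have -> : mxsub a b M = (rowsub a 1%:M) *m M *m (colsub b 1%:M).
  by rewrite mul_rowsub_mx mul1mx mulmx_colsub mulmx1; apply/matrixP => i j; rewrite !mxE.
exact: leq_trans (mxrankM_maxl _ _) (mxrankM_maxr _ _).
Qed.

Lemma rank_le_minors (m1 m2 r : nat) (M : 'M[k]_(m1, m2)) :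
  (\rank M <= r)%N <-> forall (a : 'I_r.+1 -> 'I_m1) (b : 'I_r.+1 -> 'I_m2),
    \det (mxsub a b M) = 0.
Proof.
split=> [le_r a b|minors0].
  apply/eqP/contraT => det0; have : mxsub a b M \in unitmx by rewrite unitmxE unitfE.
  move/mxrank_unit => rE; have := leq_trans (rank_mxsub M a b) le_r.
  by rewrite rE ltnn.
rewrite leqNgt; apply/negP => lt_r.
pose a := maxrankfun M; have freeM := maxrowsub_free M.
pose e := widen_ord lt_r; pose M1 := rowsub (a \o e) M.
have freeM1 : row_free M1.
  have /row_freeP[X MX] := freeM; apply/row_freeP.
  exists (X *m (rowsub e 1%:M)^T).
  have -> : M1 = rowsub e 1%:M *m rowsub a M.
    by rewrite mul_rowsub_mx mul1mx; apply/matrixP => i j; rewrite !mxE.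
  rewrite -mulmxA [rowsub a M *m _]mulmxA MX mul1mx; apply/matrixP => i j.
  rewrite !mxE (bigD1 (e i)) //= !mxE eqxx mul1r big1 ?addr0.
    by rewrite eq_sym -!val_eqE.
  by move=> l /negPf li; rewrite !mxE eq_sym li mul0r.
have fullM1 : row_full M1^T by rewrite /row_full mxrank_tr -/(row_free M1).
have := mxrank_fullrowsub fullM1; set b := fullrankfun fullM1 => rb.
have /eqP := minors0 (a \o e) b; apply/negP; rewrite -unitfE -unitmxE.
rewrite -unitmx_tr -row_free_unit /row_free -[X in _ == X]rb; apply/eqP.
by congr (\rank _); apply/matrixP => i j; rewrite !mxE.
Qed.

End RibbonForms.

(** * Normal forms of monomials and the minors that reduce to them *)

Section GapMonomials.
Variables (N d : nat) (mu : 'X_{1..N.+1}).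
Hypothesis mu_le : forall i, (mu i <= d)%N.

Definition pair_mnm m (t : 'I_m -> 'I_N.+1 * 'I_d.+1 * 'I_d.+1) : 'X_{1..N.+1} :=
  (\sum_u (U_((t u).1.1) *+ (t u).1.2 + U_(inord (t u).1.1.+1) *+ (t u).2))%MM.

(** Greedy choice: take the smallest index i >= s in the support of mu and continue from i + 2.
    Either m + 1 indices are found, or at most m pairs i, i + 1 exhaust the support from s on. *)
Lemma gap_dichotomy m s :
  (exists l : 'I_m.+1 -> 'I_N.+1,
     [/\ forall u, (s <= l u)%N,
         forall u v : 'I_m.+1, (u < v)%N -> (l u + 2 * (v - u) <= l v)%N &
         forall u, mu (l u) != 0%N]) \/
  (exists t : 'I_m -> 'I_N.+1 * 'I_d.+1 * 'I_d.+1,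
     forall i, pair_mnm t i = if (s <= i)%N then mu i else 0%N).
Proof.
elim: m s => [|m IHm] s.
  have [/existsP[i /andP[le_si mui]]|/existsPn mu0] :=
      boolP [exists i : 'I_N.+1, (s <= i)%N && (mu i != 0%N)].
    left; exists (fun=> i); split=> // u v.
    by rewrite !ord1.
  right; exists (fun u => (ord0, ord0, ord0)) => i.
  rewrite /pair_mnm big_ord0 mnm0E; case: ifP => // le_si.
  by have := mu0 i; rewrite le_si negbK => /eqP.
have [ex|/existsPn mu0] :=
    boolP [exists i : 'I_N.+1, (s <= i)%N && (mu i != 0%N)]; last first.
  right; exists (fun u => (ord0, ord0, ord0)) => i.
  rewrite /pair_mnm mnm_sumE big1 => [|u _]; last by rewrite mnmDE !mulm0n mnm0E.
  case: ifP => // le_si.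
  by have := mu0 i; rewrite le_si negbK => /eqP.
have [i0 i0P] := existsP ex.
pose i := [arg min_(i < i0 | (s <= i)%N && (mu i != 0%N)) (i : nat)].
have [/andP[le_si mui] imin] : (s <= i)%N && (mu i != 0%N) /\
    forall j : 'I_N.+1, (s <= j)%N && (mu j != 0%N) -> (i <= j)%N.
  by rewrite /i; case: arg_minnP.
have mu0 (j : 'I_N.+1) : (s <= j)%N -> (j < i)%N -> mu j = 0%N.
  move=> le_sj; rewrite ltnNge; apply: contraNeq => muj.
  by apply: imin; rewrite le_sj.
have [[l [sl l_gap mul]]|[t tE]] := IHm i.+2.
  left; exists (fun u => if unlift ord0 u is Some v then l v else i).
  split=> [u|u v|u].
  - case: unliftP => [v _|_ //]; have := sl v; lia.
  - case: (unliftP ord0 u) => [u' ->|->]; case: (unliftP ord0 v) => [v' ->|->] //.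
      by rewrite !lift0 ltnS => /l_gap; rewrite subSS.
    rewrite lift0 subn0 => _; have := sl v'; have [->|v0] := posnP v'; first lia.
    by have := l_gap ord0 v' v0; have := sl ord0; rewrite subn0 /=; lia.
  - by case: unliftP.
(* For i = N there is no next variable and [inord i.+1] falls back to index 0, so the second
   exponent is set to 0. *)
right; pose e2 : 'I_d.+1 := if (i < N)%N then inord (mu (inord i.+1)) else ord0.
exists (fun u => if unlift ord0 u is Some v then t v else (i, inord (mu i), e2)) => j.
rewrite /pair_mnm big_ord_recl unlift_none /=.
under eq_bigr do rewrite liftK.
rewrite mnmDE -/(pair_mnm t) tE mnmDE !mulmnE !mnm1E inordK ?ltnS //.
have e2E : ((inord i.+1 == j) * e2 = if i.+1 == j :> nat then mu j else 0)%N.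
  rewrite /e2; case: ltnP => [lt_iN|le_Ni].
    rewrite -val_eqE /= inordK //.
    case: eqP => [ij|_]; last by rewrite mul0n.
    have -> : inord i.+1 = j by apply: val_inj; rewrite /= inordK.
    by rewrite mul1n inordK ?ltnS.
  rewrite muln0; case: eqP => // ij; have := ltn_ord j; rewrite -ij; lia.
rewrite e2E -val_eqE /=; case: (ltngtP i j) => [lt_ij|lt_ji|ij].
- rewrite mul0n add0n (leq_trans le_si (ltnW lt_ij)).
  by move: lt_ij; rewrite leq_eqVlt => /predU1P[->|lt];
    [rewrite eqxx ltnn addn0 | rewrite lt (ltn_eqF lt)].
- rewrite mul0n (_ : (i.+1 == j) = false) 1?(_ : (i.+1 < j)%N = false); try lia.
  by case: ifP => // /mu0->.
- rewrite mul1n (_ : (i.+1 == j) = false) 1?(_ : (i.+1 < j)%N = false); try lia.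
  by rewrite (val_inj ij) -ij le_si !addn0.
Qed.

End GapMonomials.

Section Staircase.
Implicit Types (P n m l u v : nat).

(* An index l, the u-th of m + 1 with gaps >= 2, is written l = i + j + 1 with a
   row i < P and a column j, both increasing in u. *)
Definition srow (P m l u : nat) : nat := minn (l.-1 - u) (P.-1 - (m - u)).

Lemma srow_lt P m l u : (m < P)%N -> (srow P m l u < P)%N.
Proof. move=> *; rewrite /srow; lia. Qed.

Lemma scol_lt P n m l u : (m < P)%N -> (m <= n)%N -> (u <= m)%N -> (l + 2 * (m - u) <= P + n)%N ->
  (l.-1 - srow P m l u < n.+1)%N.
Proof.  move=> *; rewrite /srow; lia. Qed.

Lemma srowK P m l u : (0 < l)%N -> (srow P m l u + (l.-1 - srow P m l u)).+1 = l.
Proof. move=> *; rewrite /srow; lia. Qed.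

Lemma srow_inc P m l u l' v : (m < P)%N -> (v <= m)%N -> (u < v)%N -> (2 * u < l)%N ->
  (l + 2 * (v - u) <= l')%N -> (srow P m l u < srow P m l' v)%N.
Proof. move=> *; rewrite /srow; lia. Qed.

Lemma scolE P m l u : (u < l)%N ->
  (l.-1 - srow P m l u = maxn u (l.-1 - (P.-1 - (m - u))))%N.
Proof. by move=> *; rewrite /srow; lia. Qed.

Lemma scol_inc P m l u l' v : (m < P)%N -> (v <= m)%N -> (u < v)%N -> (2 * u < l)%N ->
  (l + 2 * (v - u) <= l')%N -> (l.-1 - srow P m l u < l'.-1 - srow P m l' v)%N.
Proof.
move=> mP vm uv ul ll; rewrite !scolE; [|lia|lia].
by rewrite gtn_max !leq_max uv /=; lia.
Qed.

End Staircase.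

(** * The upper bound 2 m for the dimension of the locus *)

Section LowRank.
Variables (k : closedFieldType) (g n : nat) (F : ribbon_data k g).
Local Notation proj := (proj_space k g).
Local Notation form := {mpoly k[g.+1]}.
Implicit Types (A Z : set proj) (x : proj) (G : 'rV[k]_g.+1).
Local Notation S := (ribbon_matrix n F).

Definition low_rank (m : nat) : set proj := [set x | (\rank (S (coords x)) <= m)%N].

Lemma Wbar_low_rank r : Wbar r n F = low_rank (n - r).
Proof.
by apply/seteqP; split=> x; rewrite -[x in Wbar _ _ _ x]reprK => /Wbar_proj_pt.
Qed.

Lemma low_rank_point m G (G0 : G != 0) :
  low_rank m (point G0) <-> (\rank (S G) <= m)%N.
Proof.
rewrite /low_rank /=; have [c c0 ->] := coords_point G0.
by rewrite ribbon_matrixZ (eqmx_scale _ c0).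
Qed.

Lemma sub_low_rank_minor m (a : 'I_m.+1 -> 'I_(g - n)) (b : 'I_m.+1 -> 'I_n.+1) :
  low_rank m `<=` hypersurface (ribbon_minor F a b).
Proof.
move=> x /rank_le_minors minors0.
by rewrite /hypersurface /= peval_ribbon_minor.
Qed.

Lemma closed_low_rank m : closed (low_rank m).
Proof.
apply/closed_zero_locus.
exists [set p | exists a b, p = ribbon_minor F (d := m.+1) (n := n) a b].
apply/seteqP; split=> x.
  by move=> xm p [a [b ->]] _; exact: (@sub_low_rank_minor m a b x xm).
move=> xm; apply/rank_le_minors => a b; rewrite -peval_ribbon_minor; apply: xm.
  by exists a, b.
by exists m.+1; apply: ribbon_minor_homog.
Qed.

Section Growth.
Variable m : nat.
Hypotheses (le_mn : (m <= n)%N) (lt_mgn : (m < g - n)%N).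
(** Larger than the number m + 1 of factors in a term of a minor, as [rearrangement] demands. *)
Local Notation B := m.+2.
Local Notation A := (low_rank m).

Lemma ribbon_form_weight i j : ((i + j).+1 <= g)%N ->
  weight_lt B 1 (B ^ (i + j).+1).+1 (ribbon_form F i j).
Proof.
move=> le_g; apply: weight_ltD; [|apply: weight_ltZ].
  by have := @weight_ltX k _ B U_(inord (i + j).+1 : 'I_g.+1)%MM; rewrite mdeg1 weightU inordK //.
have := @weight_ltX k _ B U_(ord0 : 'I_g.+1)%MM; rewrite mdeg1 weightU /=.
by apply: weight_ltW; rewrite ltnS expn0 expn_gt0.
Qed.

(** The product is the leading monomial of the minor on the rows [srow] and the complementary
    columns: [rearrangement] makes the other permutations lighter, [weight_lt_leading] the rest of
    the diagonal term. *)
Lemma low_rank_straighten (l : 'I_m.+1 -> 'I_g.+1) :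
  (forall u, 0 < l u)%N ->
  (forall u v : 'I_m.+1, (u < v)%N -> (l u + 2 * (v - u) <= l v)%N) ->
  exists e : form, weight_lt B m.+1 (\sum_u B ^ l u) e /\
    A `<=` hypersurface (\prod_u 'X_(l u) - e).
Proof.
move=> l0 l_gap.
have l_lo (u : 'I_m.+1) : (2 * u < l u)%N.
  have [u0|u0] := posnP u; first by rewrite u0 muln0.
  by have := l_gap ord0 u u0; have := l0 ord0; rewrite subn0; lia.
have l_hi (u : 'I_m.+1) : (l u + 2 * (m - u) <= g)%N.
  have [um|um] := ltnP u m; last by have := ltn_ord (l u); lia.
  by have /= := l_gap u ord_max um; have := ltn_ord (l ord_max); lia.
have le_um (u : 'I_m.+1) : (u <= m)%N by rewrite -ltnS.
pose a (u : 'I_m.+1) := srow (g - n) m (l u) u.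
pose b (u : 'I_m.+1) := ((l u).-1 - a u)%N.
have gE : (g = g - n + n)%N by rewrite subnK // ltnW // -subn_gt0 (leq_ltn_trans _ lt_mgn).
have lt_a u : (a u < g - n)%N by apply: srow_lt.
have lt_b u : (b u < n.+1)%N by apply: scol_lt => //; rewrite -gE.
have abE u : (a u + b u).+1 = l u by apply: srowK.
have a_inc (u v : 'I_m.+1) : (u < v)%N -> (a u < a v)%N.
  by move=> lt_uv; apply: srow_inc => //; apply: l_gap.
have b_inc (u v : 'I_m.+1) : (u < v)%N -> (b u < b v)%N.
  by move=> lt_uv; apply: scol_inc => //; apply: l_gap.
have lt_ab (u v : 'I_m.+1) : ((a u + b v).+1 <= g)%N.
  by rewrite [X in (_ <= X)%N]gE -addSn leq_add // -ltnS.
pose p := ribbon_minor F (fun u => Ordinal (lt_a u)) (fun u => Ordinal (lt_b u)).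
exists (\prod_u 'X_(l u) - p); split; last first.
  by rewrite subKr; apply: sub_low_rank_minor.
rewrite -opprB -scaleN1r; apply: weight_ltZ.
rewrite /p /ribbon_minor /determinant (bigD1 (1%g : 'S_m.+1)) //=.
rewrite odd_perm1 expr0 mul1r addrAC.
apply: weight_ltD.
  rewrite (eq_bigr (fun u => 'X_(l u) + ((b u)%:R * ribbon_coef F (a u + b u)) *: 'X_ord0)).
    exact: weight_lt_leading.
  move=> u _; rewrite mxE perm1 /ribbon_form /=; congr ('X_ _ + _).
  by apply: val_inj; rewrite /= abE inordK.
apply: weight_lt_sum => s s1.
have sw : weight_lt B m.+1 (\sum_u B ^ (a u + b (s u)).+1).+1
    (\prod_u (\matrix_(u, v) ribbon_form F (a u) (b v)) u (s u)).
  by apply: weight_lt_prod => u; rewrite mxE; apply: ribbon_form_weight.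
rewrite mulr_sign; set q := \prod_u _ in sw *.
have {}sw : weight_lt B m.+1 (\sum_u B ^ l u) q.
  apply: weight_ltW sw; under [ltnRHS]eq_bigr do rewrite -abE -addSn.
  under eq_bigr do rewrite -addSn.
  by apply: rearrangement.
by case: ifP => _ //; rewrite -scaleN1r; apply: weight_ltZ.
Qed.

Lemma low_rank_spanning d :
  spanning A d (fun t : {ffun 'I_m -> 'I_g.+1 * 'I_d.+1 * 'I_d.+1} =>
    'X_[(U_(ord0) *+ (d - mdeg (pair_mnm t)) + pair_mnm t)%MM]).
Proof.
set Bd := (X in spanning _ _ X).
apply: spanning_monomials => mu; have [w] := ubnP (weight B mu).
elim: w mu => // w IHw mu; rewrite ltnS => le_w mu_d.
have mu_le i : (mu i <= d)%N by rewrite -mu_d mdegE (bigD1 i) //= leq_addr.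
(* Starting from index 1 leaves out G_0, whose exponent is fixed by the degree. *)
have [[l [l0 l_gap mul]]|[t tE]] := gap_dichotomy mu_le m 1; last first.
  exists (Bd [ffun u => t u]); first exact: mem_lspan.
  rewrite /Bd (_ : pair_mnm _ = pair_mnm t); last first.
    by apply: eq_bigr => u _; rewrite ffunE.
  have mdeg_mu : mdeg mu = (mu ord0 + mdeg (pair_mnm t))%N.
    rewrite !mdegE [LHS](bigD1 ord0) //= [in RHS](bigD1 ord0) //= tE add0n.
    by congr addn; apply: eq_bigr => i i0; rewrite tE lt0n i0.
  have -> : (d - mdeg (pair_mnm t) = mu ord0)%N.
    by move: mdeg_mu; rewrite mu_d => {1}->; rewrite addnK.
  rewrite (_ : (_ + _)%MM = mu).
    by rewrite subrr => x _; rewrite /hypersurface /= /peval meval0.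
  apply/mnmP => i; rewrite mnmDE mulmnE mnm1E tE lt0n -[(i : nat) == _]/(i == ord0) eq_sym.
  by case: eqP => [->|_]; rewrite ?mul1n ?addn0 ?mul0n.
have [e [ew Ae]] := low_rank_straighten l0 l_gap.
pose lm := (\sum_u U_(l u))%MM.
have l_inj : injective l.
  move=> u v luv; case: (ltngtP u v) => [lt_uv|lt_vu|/val_inj //].
    by have := l_gap u v lt_uv; rewrite luv -{2}[val (l v)]addn0 leq_add2l; lia.
  by have := l_gap v u lt_vu; rewrite luv -{2}[val (l v)]addn0 leq_add2l; lia.
have le_lm : (lm <= mu)%MM.
  apply/mnm_lepP => i; rewrite mnm_sumE.
  have [/existsP[u /eqP lu]|/existsPn nl] := boolP [exists u, l u == i].
    rewrite (bigD1 u) //= mnm1E lu eqxx big1 ?addn0 ?lt0n -?lu //.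
    by move=> v vu; rewrite mnm1E (inj_eq l_inj) (negPf vu).
  by rewrite big1 // => u _; rewrite mnm1E (negPf (nl u)).
have muE : mu = (mu - lm + lm)%MM by rewrite submK.
have lmE : 'X_[lm] = \prod_u 'X_(l u) :> form by rewrite /lm mprodXE.
(* Trading the factor lm for e keeps the degree and lowers the weight, so the induction hypothesis
   applies to every monomial. *)
have [|q Bq Aq] := @span_by_monomials _ _ A _ Bd ('X_[(mu - lm)%MM] * e).
  move=> nu /msuppM_le/allpairsP[[m1 m2] /= [+ /ew[m2d m2w] ->]].
  rewrite msuppX inE => /eqP->; apply: IHw.
    rewrite weightD; apply: leq_trans le_w; rewrite {2}muE weightD ltn_add2l.
    apply: leq_trans m2w _; rewrite /lm (big_morph (weight B) (@weightD _ _) (_ : _ = 0%N)).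
      by apply: leq_sum => u _; rewrite weightU.
    by rewrite /weight big1 // => i _; rewrite mnm0E.
  rewrite mdegD m2d -mu_d {2}muE mdegD; congr addn.
  rewrite /lm mdeg_sum; under eq_bigr do rewrite mdeg1.
  by rewrite sum1_card card_ord.
exists q => //; rewrite {1}muE mpolyXD lmE.
have -> : 'X_[(mu - lm)%MM] * \prod_u 'X_(l u) - q =
   'X_[(mu - lm)%MM] * (\prod_u 'X_(l u) - e) + ('X_[(mu - lm)%MM] * e - q).
  by rewrite mulrBr addrA subrK.
by apply: sub_hypersurfaceD => //; apply: sub_hypersurfaceMl.
Qed.

(** Each of the m pairs contributes one bounded index and two exponents of the order of the
    degree. *)
Lemma low_rank_chain_bound : chain_bound A (2 * m).
Proof.
apply: growth_chain_bound => [|D]; first exact: closed_low_rank.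
exists ((g.+1 * D.+1 ^ 2) ^ m)%N => d.
eexists; eexists; split; first exact: low_rank_spanning.
have le_exp (x y : nat) : (x <= y)%N -> (x ^ m <= y ^ m)%N.
  by have [->|m0] := posnP m; rewrite ?expn0 ?leq_exp2r.
rewrite card_ffun !card_prod !card_ord expnM -expnMn; apply: le_exp.
have le_dD : ((d * D).+1 <= D.+1 * d.+1)%N by lia.
have -> : (g.+1 * D.+1 ^ 2 * d.+1 ^ 2 = g.+1 * (D.+1 * d.+1) * (D.+1 * d.+1))%N.
  by rewrite -[LHS]mulnA -expnMn -mulnA mulnn.
by rewrite !leq_mul.
Qed.

End Growth.

End LowRank.

(** * Local equations of low-rank loci *)

Section Bordered.
Variables (R : comNzRingType) (P Q m : nat) (S : 'M[R]_(P, Q)).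
Variables (a : 'I_m -> 'I_P) (b : 'I_m -> 'I_Q).

(** The Schur complement of T = [mxsub a b S], cleared of its denominator: entry (i, j) is the minor
    of T bordered by row i and column j. *)
Definition bordered : 'M[R]_(P, Q) :=
  \det (mxsub a b S) *: S - colsub b S *m \adj (mxsub a b S) *m rowsub a S.

Lemma bordered_row u j : bordered (a u) j = 0.
Proof.
have : rowsub a bordered = 0.
  have -> : rowsub a bordered = \det (mxsub a b S) *: rowsub a S -
      rowsub a (colsub b S) *m \adj (mxsub a b S) *m rowsub a S.
    by rewrite !mul_rowsub_mx; apply/matrixP => i l; rewrite !mxE.
  have -> : rowsub a (colsub b S) = mxsub a b S by apply/matrixP => i l; rewrite !mxE.
  by rewrite mul_mx_adj mul_scalar_mx subrr.
by move/matrixP/(_ u j); rewrite !mxE.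
Qed.

Lemma bordered_col i v : bordered i (b v) = 0.
Proof.
have : colsub b bordered = 0.
  have -> : colsub b bordered = \det (mxsub a b S) *: colsub b S -
      colsub b S *m (\adj (mxsub a b S) *m colsub b (rowsub a S)).
    by rewrite mulmxA !mulmx_colsub; apply/matrixP => l j; rewrite !mxE.
  have -> : colsub b (rowsub a S) = mxsub a b S by apply/matrixP => l j; rewrite !mxE.
  by rewrite mul_adj_mx mul_mx_scalar subrr.
by move/matrixP/(_ i v); rewrite !mxE.
Qed.

End Bordered.

Lemma rank_le_bordered (k : fieldType) P Q m (S : 'M[k]_(P, Q)) (a : 'I_m -> 'I_P)
  (b : 'I_m -> 'I_Q) : \det (mxsub a b S) != 0 ->
  (\rank S <= m)%N <-> bordered S a b = 0.
Proof.
move=> detT; set T := mxsub a b S in detT.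
have Tunit : T \in unitmx by rewrite unitmxE unitfE.
split=> [le_m|/eqP]; last first.
  rewrite subr_eq0 => /eqP SE; rewrite -(eqmx_scale S detT) SE.
  by apply: leq_trans (mxrankM_maxr _ _) _; apply: rank_leq_row.
have TE : T = colsub b (rowsub a S) by apply/matrixP => i j; rewrite !mxE.
have rankR : \rank (rowsub a S) = m.
  apply/eqP; rewrite eqn_leq rank_leq_row /= -{1}(mxrank_unit Tunit).
  have -> : T = rowsub a S *m colsub b 1%:M by rewrite mulmx_colsub mulmx1.
  exact: mxrankM_maxl.
have RS : (rowsub a S <= S)%MS.
  by rewrite -[S in rowsub a S]mul1mx -mul_rowsub_mx submxMl.
have SR : (S <= rowsub a S)%MS.
  by rewrite -(geq_leqif (mxrank_leqif_sup RS)) rankR.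
have /submxP[D SE] := SR.
apply/eqP; rewrite subr_eq0; apply/eqP.
have -> : colsub b S = D *m T by rewrite {1}SE TE mulmx_colsub.
by rewrite -[D *m T *m _]mulmxA mul_mx_adj mul_mx_scalar -scalemxAl -SE.
Qed.

Section ComponentOfLowRank.
Variables (k : closedFieldType) (g n : nat) (F : ribbon_data k g).
Local Notation proj := (proj_space k g).
Local Notation form := {mpoly k[g.+1]}.
Implicit Types (A Z : set proj) (x : proj) (G H : 'rV[k]_g.+1) (p q : form).
Local Notation S := (ribbon_matrix n F).
Local Notation low_rank := (low_rank n F).

Definition ribbon_form_mx : 'M[form]_(g - n, n.+1) :=
  \matrix_(i, j) ribbon_form F i j.

Section Equations.
Variables (m : nat) (a : 'I_m -> 'I_(g - n)) (b : 'I_m -> 'I_n.+1).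

(** In the rows of a and the columns of b [bordered] is zero; leaving them out gives the right
    number of equations. *)
Definition bordered_forms : seq form :=
  [seq bordered ribbon_form_mx a b i j |
     i <- enum [predC codom a], j <- enum [predC codom b]].

Lemma peval_bordered G i j :
  peval (bordered ribbon_form_mx a b i j) G = bordered (S G) a b i j.
Proof.
pose ev : {rmorphism form -> k} := meval (fun i => G 0 i).
have SE : map_mx ev ribbon_form_mx = S G.
  by apply/matrixP => u v; rewrite !mxE -[LHS]/(peval _ _) peval_ribbon_form mxE.
have -> : bordered (S G) a b = map_mx ev (bordered ribbon_form_mx a b).
  rewrite /bordered map_mxB map_mxZ !map_mxM map_mx_adj.
  by rewrite map_mxsub map_mxsub map_mxsub SE -det_map_mx map_mxsub SE.
by rewrite [RHS]mxE.
Qed.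

Lemma bordered_forms_homog p : p \in bordered_forms -> homogeneous p.
Proof.
move=> /allpairsP[[i j] /= [_ _ ->]]; exists m.+1.
have hS u v : ribbon_form_mx u v \is 1.-homog by rewrite mxE ribbon_form_homog.
have hT u v : mxsub a b ribbon_form_mx u v \is 1.-homog by rewrite mxE.
rewrite mxE; apply: rpredD.
  rewrite mxE; have := dhomogM (det_homog hT) (hS i j); by rewrite addn1.
rewrite mxE; apply: rpredNr; rewrite mxE; apply: rpred_sum => u _.
have hadj : (colsub b ribbon_form_mx *m \adj (mxsub a b ribbon_form_mx)) i u
    \is (1 + m.-1)%N.-homog.
  rewrite mxE; apply: rpred_sum => v _; apply: dhomogM; last exact: adjugate_homog.
  by rewrite mxE; apply: hS.
have := dhomogM hadj (hS (a u) j); rewrite addn1 add1n prednK.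
  by rewrite [rowsub _ _ _ _]mxE.
by apply: leq_ltn_trans (ltn_ord u).
Qed.

Lemma zeros_bordered_forms x :
  zeros bordered_forms x <-> bordered (S (coords x)) a b = 0.
Proof.
split=> [zx|b0 p /allpairsP[[i j] /= [_ _ ->]]]; last first.
  by rewrite /hypersurface /= peval_bordered b0 mxE.
apply/matrixP => i j; rewrite [RHS]mxE.
have [/codomP[u ->]|ia] := boolP (i \in codom a); first exact: bordered_row.
have [/codomP[v ->]|jb] := boolP (j \in codom b); first exact: bordered_col.
rewrite -peval_bordered; apply: zx; apply/allpairsP; exists (i, j).
by rewrite !mem_enum.
Qed.

Lemma size_bordered_forms : injective a -> injective b ->
  size bordered_forms = ((g - n - m) * (n.+1 - m))%N.
Proof.
move=> a_inj b_inj; rewrite size_allpairs -!cardE.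
have card_compl N (c : 'I_m -> 'I_N) : injective c -> #|[predC codom c]| = (N - m)%N.
  move=> c_inj; have := cardC (mem (codom c)).
  by rewrite card_codom // !card_ord => cE; rewrite -[X in (X - _)%N]cE addKn.
by rewrite !card_compl.
Qed.

Lemma minor_injective G : \det (mxsub a b (S G)) != 0 -> injective a /\ injective b.
Proof.
move=> det0; split=> u v uv; apply: contraNeq det0 => ne; apply/eqP.
  by apply: (determinant_alternate ne) => j; rewrite !mxE uv.
rewrite -det_tr; apply: (determinant_alternate ne) => j; by rewrite !mxE uv.
Qed.

End Equations.

(** Where the minor (a, b) is invertible, the bordered forms alone express rank <= m. The extra
    equations [es] allow for cutting with G_0 = 0. *)
Lemma low_rank_component_dimension m (es : seq form) Z x
  (a : 'I_m -> 'I_(g - n)) (b : 'I_m -> 'I_n.+1) d :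
  (forall p, p \in es -> homogeneous p) ->
  irreducible_component (low_rank m `&` zeros es) Z ->
  Z x -> \det (mxsub a b (S (coords x))) != 0 -> chain_bound Z d ->
  (g <= size es + (g - n - m) * (n.+1 - m) + d)%N.
Proof.
move=> hes [Zirr ZA Zmax] Zx detx Zd.
have [a_inj b_inj] := minor_injective detx.
rewrite -(size_bordered_forms a_inj b_inj) -size_cat.
set fs := es ++ bordered_forms a b.
have hfs p : p \in fs -> homogeneous p.
  by rewrite mem_cat => /orP[/hes|/bordered_forms_homog].
have hdelta : homogeneous (ribbon_minor F a b) by exists m; apply: ribbon_minor_homog.
pose U : set proj := ~` hypersurface (ribbon_minor F a b).
have oU : open U by rewrite openC; apply: closed_hypersurface.
have UE y : U y <-> \det (mxsub a b (S (coords y))) != 0.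
  rewrite /U /hypersurface /setC /= peval_ribbon_minor.
  by split=> /eqP.
(* Z is also a component of [zeros fs]: both loci agree on U, and U meets Z. *)
apply: component_dimension hfs _ Zd; split=> //.
- move=> y Zy p; rewrite mem_cat => /orP[pes|pb]; first by have [_] := ZA y Zy; apply.
  apply: (@irreducible_dense _ Z U (hypersurface p) Zirr oU) => //.
  + by exists x; split=> //; apply/UE.
  + by apply: closed_hypersurface; apply: bordered_forms_homog pb.
  move=> z [/ZA[zm _] /UE detz]; have := (zeros_bordered_forms a b z).2; apply=> //.
  exact/rank_le_bordered.
- move=> Y Yirr Yfs ZY; apply: Zmax => //.
  apply: (irreducible_dense Yirr oU).
  + by exists x; split; [apply: ZY | apply/UE].
  + by apply: closedI; [apply: closed_low_rank | apply: closed_zeros].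
  move=> y [/Yfs yfs /UE dety]; split.
    apply/(rank_le_bordered dety)/zeros_bordered_forms => p pb.
    by apply: yfs; rewrite mem_cat pb orbT.
  by move=> p pes; apply: yfs; rewrite mem_cat pes.
Qed.

End ComponentOfLowRank.

(** * Generic rank, degeneration and secants *)

Section Shear.
Variables (k : closedFieldType) (g : nat).
Local Notation proj := (proj_space k g).
Local Notation form := {mpoly k[g.+1]}.
Implicit Types (Z : set proj) (x y z : proj) (H : 'rV[k]_g.+1) (p q : form) (t : k).

Lemma horner_mmap (h : 'I_g.+1 -> {poly k}) p t :
  (mmap polyC h p).[t] = p.@[fun i => (h i).[t]].
Proof.
rewrite /mmap horner_sum mevalE; apply: eq_bigr => m _.
rewrite hornerM hornerC horner_prod; congr (_ * _).
by apply: eq_bigr => i _; rewrite horner_exp.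
Qed.

Lemma poly_vanishing (P : {poly k}) : (forall t, P.[t] = 0) -> P = 0.
Proof.
move=> P0; apply/eqP/contraT => /closed_nonrootP[t]; by rewrite /root P0 eqxx.
Qed.

Lemma comp_mpoly_homog d p (T : g.+1.-tuple form) : p \is d.-homog ->
  (forall i, tnth T i \is 1.-homog) -> p \mPo T \is d.-homog.
Proof.
move=> /dhomogP hp hT; rewrite comp_mpolyEX big_seq; apply: rpred_sum => m /hp /= <-.
apply: dhomogZ; rewrite comp_mpolyX mdegE.
elim/big_rec2: _ => [|i e q _ hq]; first exact: dhomog1.
by apply: dhomogM => //; have := dhomogMn (m i) (hT i); rewrite mul1n.
Qed.

Variables (v : 'rV[k]_g.+1) (j l : 'I_g.+1).
Hypothesis vl : v 0 l = 1.

Let lam H : k := H 0 j - v 0 j * H 0 l.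
(** Adding t v would not be linear in H. Since [lam] kills v, this is a one-parameter group of
    invertible linear maps moving H along v. *)
Definition shear t H := H + (t * lam H) *: v.

Lemma lam_shear t H : lam (shear t H) = lam H.
Proof. by rewrite /lam /shear !mxE vl; ring. Qed.

Lemma shear_neq0 t H : H != 0 -> shear t H != 0.
Proof.
apply: contraNneq => sH0; move: (sH0).
have lH0 : lam H = 0 by rewrite -(lam_shear t) sH0 /lam !mxE mulr0 subrr.
by rewrite /shear lH0 mulr0 scale0r addr0 => ->.
Qed.

Lemma shear0 H : shear 0 H = H.
Proof. by rewrite /shear mul0r scale0r addr0. Qed.

Let sheared t p : form :=
  p \mPo [tuple 'X_i + (t * v 0 i) *: ('X_j - v 0 j *: 'X_l) | i < g.+1].

Lemma peval_sheared t p H : peval (sheared t p) H = peval p (shear t H).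
Proof.
rewrite /peval comp_mpoly_meval; apply: meval_eq => i.
rewrite tnth_mktuple mevalD mevalZ mevalB mevalZ !mevalXU !mxE /lam; ring.
Qed.

Lemma sheared_homog t p : homogeneous p -> homogeneous (sheared t p).
Proof.
move=> [d hp]; exists d; apply: comp_mpoly_homog => // i; rewrite tnth_mktuple.
have hX s : ('X_s : form) \is 1.-homog by rewrite dhomogX; apply/eqP/mdeg1.
by apply: rpredD => //; apply: dhomogZ; apply: rpredB => //; apply: dhomogZ.
Qed.

Definition shear_orbit Z : set proj :=
  [set y | exists z t c, [/\ Z z, c != 0 & coords y = c *: shear t (coords z)]].

Lemma hypersurface_scale p y c H : homogeneous p -> c != 0 -> coords y = c *: H ->
  hypersurface p y <-> peval p H = 0.
Proof.
move=> hp c0 yE; rewrite /hypersurface /= yE; have pE := peval_scale H hp c0.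
by split=> /eqP e; apply/eqP; [rewrite -pE|rewrite pE].
Qed.

Lemma sub_shear_orbit Z : Z `<=` shear_orbit Z.
Proof. by move=> z Zz; exists z, 0, 1; rewrite shear0 scale1r oner_neq0. Qed.

Lemma mem_shear_orbit Z z t (H0 : shear t (coords z) != 0) :
  Z z -> shear_orbit Z (point H0).
Proof. by move=> Zz; have [c c0 cE] := coords_point H0; exists z, t, c. Qed.

(** If p q vanishes on the orbit, then for each z one of p, q vanishes for all t, as a polynomial in
    t; the two closed conditions on z cover Z. *)
Lemma shear_orbit_irreducible Z : irreducible_set Z -> irreducible_set (shear_orbit Z).
Proof.
move=> [[z0 Zz0] Zirr]; apply: irreducible_by_forms => [|p q hp hq Opq].
  by exists z0; apply: sub_shear_orbit.
pose stays p : set proj := [set z | forall t, peval p (shear t (coords z)) = 0].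
have closed_stays r : homogeneous r -> closed (stays r).
  move=> hr; apply/closed_zero_locus; exists [set s | exists t, s = sheared t r].
  apply/seteqP; split=> z; first by move=> zr s [t ->] _; rewrite peval_sheared.
  move=> zr t; rewrite -peval_sheared; apply: zr; first by exists t.
  exact: sheared_homog.
have Z_stays : Z `<=` stays p `|` stays q.
  move=> z Zz; pose h i : {poly k} := (coords z 0 i)%:P + (lam (coords z) * v 0 i) *: 'X.
  have hE r t : (mmap polyC h r).[t] = peval r (shear t (coords z)).
    rewrite horner_mmap; apply: meval_eq => i.
    by rewrite /h hornerD hornerC hornerZ hornerX !mxE; ring.
  have /eqP : mmap polyC h p * mmap polyC h q = 0.
    apply: poly_vanishing => t; rewrite hornerM !hE -pevalM.
    have H0 := shear_neq0 t (coords_neq0 z).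
    have := Opq _ (mem_shear_orbit H0 Zz).
    by move/(hypersurface_point H0 (homogeneousM hp hq)).
  by rewrite mulf_eq0 => /orP[]/eqP r0; [left|right] => t; rewrite -hE r0 horner0.
have := Zirr _ _ (closed_stays p hp) (closed_stays q hq) Z_stays.
by case=> Zr; [left|right] => y [z [t [c [Zz c0 yE]]]];
  apply/(hypersurface_scale _ c0 yE) => //; apply: Zr.
Qed.

End Shear.

Section GenericRank.
Variables (k : closedFieldType) (g n : nat) (F : ribbon_data k g).
Local Notation proj := (proj_space k g).
Implicit Types (Z : set proj) (x : proj) (G H v : 'rV[k]_g.+1).
Local Notation S := (ribbon_matrix n F).
Local Notation low_rank := (low_rank n F).

Lemma ribbon_matrixD G H : S (G + H) = S G + S H.
Proof. by apply/matrixP => i j; rewrite !mxE mulrDr addrACA. Qed.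

Definition rational_curve (s : k) : 'rV[k]_g.+1 :=
  \row_i (if i == 0%N :> nat then 0 else s ^+ i.-1).

Lemma ribbon_matrix_curve s :
  S (rational_curve s) = (\col_i s ^+ i) *m (\row_j s ^+ j).
Proof.
apply/matrixP => i j; rewrite !mxE big_ord1 !mxE /= mulr0 addr0 -exprD.
rewrite inordK //= ltnS; have := ltn_ord i; have := ltn_ord j; lia.
Qed.

Lemma rank_add_rank1 (K : fieldType) (P Q : nat) (M : 'M[K]_(P, Q)) (y : 'cV[K]_P) (z : 'rV[K]_Q) :
  (\rank (M + y *m z)%R <= (\rank M).+1)%N.
Proof.
apply: leq_trans (mxrank_add _ _) _; rewrite -[(\rank M).+1]addn1 leq_add2l.
exact: leq_trans (mxrankM_maxr _ _) (rank_leq_row _).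
Qed.

(** The vector c shows that whatever kills M + y z on the left kills y, hence M; w kills M but not
    y, so the left kernel shrinks. *)
Lemma rank_add_rank1_gt (K : fieldType) (P Q : nat) (M : 'M[K]_(P, Q)) (y : 'cV[K]_P) (z : 'rV[K]_Q)
  (w : 'rV[K]_P) (c : 'cV[K]_Q) :
  w *m M = 0 -> M *m c = 0 -> w *m y != 0 -> z *m c != 0 ->
  (\rank M < \rank (M + y *m z)%R)%N.
Proof.
move=> wM Mc wy zc.
have scal0 P' (B : 'cV[K]_P') : B *m (z *m c) = 0 -> B = 0.
  rewrite [z *m c]mx11_scalar mul_mx_scalar => /eqP; rewrite scaler_eq0.
  case/orP => /eqP // zc0; move: zc.
  by rewrite [z *m c]mx11_scalar zc0 raddf0 eqxx.
pose N := M + y *m z.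
have NM P' (B : 'M[K]_(P', P)) : B *m N = 0 -> B *m y = 0.
  move=> BN; apply: scal0; have : B *m N *m c = 0 by rewrite BN mul0mx.
  by rewrite mulmxDr mulmxDl -!mulmxA Mc mulmx0 add0r.
have : (kermx N < kermx M)%MS.
  rewrite ltmxE; apply/andP; split.
    apply/sub_kermxP; have := mulmx_ker N; rewrite {2}/N mulmxDr mulmxA.
    by rewrite (NM _ _ (mulmx_ker N)) mul0mx addr0.
  apply: contra wy => MN; apply/eqP/NM/sub_kermxP.
  by apply: submx_trans MN; apply/sub_kermxP.
move/rank_ltmx; rewrite !mxrank_ker.
by have := rank_leq_row M; have := rank_leq_row N; rewrite -/N; lia.
Qed.

Lemma generic_rank m Z : (m < g - n)%N -> (m < n.+1)%N -> (0 < m)%N ->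
  irreducible_component (low_rank m) Z -> exists2 x, Z x & \rank (S (coords x)) = m.
Proof.
move=> lt_mP lt_mQ m0 [Zirr Zm Zmax]; apply: contrapT => no.
have Zlt x : Z x -> (\rank (S (coords x)) < m)%N.
  move=> Zx; rewrite ltn_neqAle; apply/andP; split; last exact: Zm.
  by apply/eqP => rx; apply: no; exists x.
have [[x0 Zx0] _] := Zirr.
have [x Zx xmax'] := ex_min_measure (fun x => (m - \rank (S (coords x)))%N)
  (ex_intro _ x0 Zx0).
have xmax y : Z y -> (\rank (S (coords y)) <= \rank (S (coords x)))%N.
  by move=> Zy; have := xmax' y Zy; have := Zlt x Zx; have := Zlt y Zy; lia.
set G := coords x in xmax; have lt_Gm : (\rank (S G) < m)%N := Zlt x Zx.
have [w wS w0] : exists2 w : 'rV[k]_(g - n), w *m S G = 0 & w != 0.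
  have : kermx (S G) != 0.
    by rewrite kermx_eq0 -row_leq_rank -ltnNge (ltn_trans lt_Gm).
  by case/rowV0Pn=> w /sub_kermxP wS w0; exists w.
have [c Sc c0] : exists2 c : 'rV[k]_n.+1, S G *m c^T = 0 & c != 0.
  have : kermx (S G)^T != 0.
    by rewrite kermx_eq0 -row_leq_rank mxrank_tr -ltnNge (ltn_trans lt_Gm).
  case/rowV0Pn=> c /sub_kermxP cS c0; exists c => //.
  by apply: trmx_inj; rewrite trmx_mul trmxK cS trmx0.
have rV_neq0 N (u : 'rV[k]_N) : u != 0 -> rVpoly u != 0.
  by apply: contraNneq => u0; rewrite -(rVpolyK u) u0 raddf0.
have hornerV N (u : 'rV[k]_N) s : (rVpoly u).[s] = \sum_i u 0 i * s ^+ i.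
  rewrite (horner_coef_wide _ (size_poly _ _)).
  by apply: eq_bigr => i _; rewrite coef_rVpoly_ord.
(* Pairing w or c with the vector of powers of s evaluates the associated polynomial at s. *)
have /closed_nonrootP[s] : rVpoly w * rVpoly c != 0 by rewrite mulf_neq0 ?rV_neq0.
rewrite /root hornerM mulf_eq0 negb_or => /andP[ws cs].
pose v := rational_curve s.
have rank_v : (\rank (S G) < \rank (S (G + v)%R))%N.
  rewrite ribbon_matrixD ribbon_matrix_curve.
  apply: (rank_add_rank1_gt wS Sc).
    apply: contraNneq ws => /matrixP/(_ 0 0); rewrite !mxE => e.
    rewrite hornerV -[X in _ == X]e; apply/eqP; apply: eq_bigr => i _.
    by rewrite !mxE.
  apply: contraNneq cs => /matrixP/(_ 0 0); rewrite !mxE => e.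
  rewrite hornerV -[X in _ == X]e; apply/eqP; apply: eq_bigr => i _.
  by rewrite !mxE mulrC.
have g0 : (1 < g.+1)%N by lia.
pose l : 'I_g.+1 := Ordinal g0.
have vl : v 0 l = 1 by rewrite mxE /= expr0.
(* Otherwise G would be a multiple of v, and adding v could not raise the rank. *)
have [j lam0] : exists j, G 0 j - v 0 j * G 0 l != 0.
  apply/existsP; apply: contraT; rewrite negb_exists => /forallP no_j.
  have Gv : G = G 0 l *: v.
    by apply/rowP => j; rewrite mxE mulrC; have := no_j j; rewrite negbK subr_eq0 => /eqP.
  have Gl0 : G 0 l != 0.
    by apply: contraNneq (coords_neq0 x) => Gl; rewrite -/G Gv Gl scale0r.
  have GvE : S (G + v)%R = (G 0 l + 1) *: S v.
    by rewrite -ribbon_matrixZ scalerDl scale1r -Gv.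
  have GE : S G = G 0 l *: S v by rewrite -ribbon_matrixZ -Gv.
  move: rank_v; rewrite GvE GE (eqmx_scale _ Gl0) ltnNge => /negP[].
  by rewrite -mul_scalar_mx mxrankM_maxr.
pose O := shear_orbit v j l Z.
have Om : O `<=` low_rank m.
  move=> y [z [t [e [Zz e0 yE]]]]; rewrite /low_rank /= yE ribbon_matrixZ (eqmx_scale _ e0).
  rewrite /shear ribbon_matrixD ribbon_matrixZ ribbon_matrix_curve scalemxAl.
  by apply: leq_trans (rank_add_rank1 _ _ _) _; apply: Zlt.
have OZ : O = Z.
  by apply: Zmax => //; [apply: shear_orbit_irreducible | apply: sub_shear_orbit].
(* For this t the shear sends G to G + v, whose rank exceeds the maximum on Z. *)
pose t := (G 0 j - v 0 j * G 0 l)^-1.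
have vE : shear v j l t G = G + v by rewrite /shear /t mulVf // scale1r.
have H0 : shear v j l t G != 0 by apply: shear_neq0 => //; apply: coords_neq0.
have : Z (point H0) by rewrite -OZ; apply: mem_shear_orbit.
move/xmax; have [e e0 ->] := coords_point H0.
by rewrite ribbon_matrixZ (eqmx_scale _ e0) vE leqNgt rank_v.
Qed.

End GenericRank.

(** * Degeneration to the last coordinate point *)

Section Degeneration.
Variables (k : closedFieldType) (g n : nat) (F : ribbon_data k g).
Hypothesis char0 : [pchar k] =i pred0.
Local Notation proj := (proj_space k g).
Local Notation form := {mpoly k[g.+1]}.
Implicit Types (Z : set proj) (x : proj) (G H v : 'rV[k]_g.+1).
Local Notation S := (ribbon_matrix n F).
Local Notation low_rank := (low_rank n F).

Lemma parametrized_irreducible (h : 'I_g.+1 -> {poly k}) :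
  (forall t, \row_i (h i).[t] != 0) ->
  irreducible_set [set y : proj | exists t c, c != 0 /\
     coords y = c *: \row_i (h i).[t]].
Proof.
move=> h0; apply: irreducible_by_forms => [|p q hp hq Opq].
  by have [c c0 cE] := coords_point (h0 0); exists (point (h0 0)), 0, c.
have hE r t : (mmap polyC h r).[t] = peval r (\row_i (h i).[t]).
  by rewrite horner_mmap; apply: meval_eq => i; rewrite mxE.
have /eqP : mmap polyC h p * mmap polyC h q = 0.
  apply: poly_vanishing => t; rewrite hornerM !hE -pevalM.
  apply/(hypersurface_point (h0 t) (homogeneousM hp hq)); apply: Opq.
  by have [c c0 cE] := coords_point (h0 t); exists t, c.
rewrite mulf_eq0 => /orP[]/eqP r0; [left|right] => y [t [c [c0 yE]]];
  by apply/(hypersurface_scale _ c0 yE); rewrite -?hE ?r0 ?horner0.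
Qed.

Lemma coef_XDn (a : k) N j : (('X + a%:P) ^+ N)`_j = a ^+ (N - j) *+ 'C(N, j).
Proof.
rewrite addrC exprDn coef_sum.
have [le_jN|lt_Nj] := leqP j N.
  rewrite (bigD1 (Ordinal (le_jN : (j < N.+1)%N))) //= coefMn -polyC_exp coefCM coefXn.
  rewrite eqxx mulr1 big1 ?addr0 // => i ij.
  rewrite coefMn -polyC_exp coefCM coefXn eq_sym.
  rewrite -[_ == _ :> nat]/(_ == Ordinal (le_jN : (j < N.+1)%N)).
  by rewrite (negPf ij) mulr0 mul0rn.
rewrite bin_small // mulr0n big1 // => i _.
rewrite coefMn -polyC_exp coefCM coefXn gtn_eqF ?mulr0 ?mul0rn //.
by apply: leq_trans lt_Nj; apply: ltn_ord.
Qed.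

(* A point of the hyperplane G_0 = 0 is seen as a linear functional on polynomials. *)
Definition moment G (p : {poly k}) : k := \sum_(i < g) p`_i * G 0 (inord i.+1).

Lemma moment_sum G (I : Type) (r : seq I) (P : pred I) (f : I -> {poly k}) :
  moment G (\sum_(i <- r | P i) f i) = \sum_(i <- r | P i) moment G (f i).
Proof.
rewrite exchange_big; apply: eq_bigr => i _.
by rewrite coef_sum mulr_suml.
Qed.

Lemma momentZ G c p : moment G (c *: p) = c * moment G p.
Proof. by rewrite mulr_sumr; apply: eq_bigr => i _; rewrite coefZ mulrA. Qed.

Lemma momentXn G i : (i < g)%N -> moment G 'X^i = G 0 (inord i.+1).
Proof.
move=> lt_ig; rewrite /moment (bigD1 (Ordinal lt_ig)) //= coefXn eqxx mul1r.
rewrite big1 ?addr0 // => j ji; rewrite coefXn.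
by rewrite -val_eqE /= in ji; rewrite (negPf ji) mul0r.
Qed.

Lemma poly_wide (p : {poly k}) N : (size p <= N)%N -> p = \sum_(i < N) p`_i *: 'X^i.
Proof.
move=> le_pN; rewrite -poly_def; apply/polyP => i; rewrite coef_poly.
by case: ltnP => // le_Ni; rewrite nth_default // (leq_trans le_pN).
Qed.

Definition translate a G : 'rV[k]_g.+1 :=
  \row_l (if l == 0%N :> nat then 0 else moment G (('X + a%:P) ^+ l.-1)).

Hypothesis lt_ng : (n < g)%N.

(** For G_0 = 0 the matrix is that of the bilinear form (p, q) -> moment G (p q) on powers of X; the
    translation is a change of basis on both sides. *)
Lemma ribbon_matrix_translate a G : G 0 ord0 = 0 ->
  S (translate a G) = (\matrix_(i, i') (('X + a%:P) ^+ i)`_i') *m S G *m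
                      (\matrix_(j', j) (('X + a%:P) ^+ j)`_j').
Proof.
move=> G0; apply/matrixP => i j; rewrite !mxE /= mulr0 addr0.
have lt_ij : (i + j < g)%N by have := ltn_ord i; have := ltn_ord j; lia.
rewrite inordK //= exprD.
have size_XDn l N : (l < N)%N -> (size (('X + a%:P) ^+ l) <= N)%N.
  by rewrite -[a]opprK polyCN size_exp_XsubC.
rewrite [X in moment _ (X * _)](poly_wide (size_XDn i _ (ltn_ord i))).
rewrite [X in moment _ (_ * X)](poly_wide (size_XDn j _ (ltn_ord j))).
rewrite mulr_sumr moment_sum; apply: eq_bigr => j' _; rewrite mxE.
rewrite -scalerAr momentZ mulrC [in RHS]mxE; congr (_ * _).
rewrite mulr_suml moment_sum; apply: eq_bigr => i' _.
rewrite -scalerAl momentZ -exprD !mxE momentXn; last first.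
  by have := ltn_ord i'; have := ltn_ord j'; lia.
by rewrite G0 mulr0 addr0.
Qed.

Lemma rank_translate a G : G 0 ord0 = 0 -> (\rank (S (translate a G)) <= \rank (S G))%N.
Proof.
move=> G0; rewrite ribbon_matrix_translate //.
exact: leq_trans (mxrankM_maxl _ _) (mxrankM_maxr _ _).
Qed.

Definition last_point : 'rV[k]_g.+1 := delta_mx 0 ord_max.

Lemma rank_last_point : (\rank (S last_point) <= 1)%N.
Proof.
have -> : S last_point = (\col_i (i == (g - n).-1 :> nat)%:R) *m (\row_j (j == n :> nat)%:R).
  apply/matrixP => i j; rewrite !mxE big_ord1 !mxE /=.
  have lt_ij : ((i + j).+1 < g.+1)%N by have := ltn_ord i; have := ltn_ord j; lia.
  have -> : (ord0 == ord_max :> 'I_g.+1) = false.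
    by rewrite -val_eqE /=; apply/eqP; lia.
  rewrite [false%:R]mulr0n mulr0 addr0 -natrM mulnb -val_eqE /= inordK //; congr (nat_of_bool _)%:R.
  apply/eqP/andP => [|[/eqP-> /eqP->]]; have := ltn_ord i; have := ltn_ord j; last lia.
  by move=> lt1 lt2 e; split; apply/eqP; lia.
exact: leq_trans (mxrankM_maxr _ _) (rank_leq_row _).
Qed.

Lemma last_point_neq0 : last_point != 0.
Proof. by apply/rV0Pn; exists ord_max; rewrite mxE !eqxx oner_neq0. Qed.

(** Let l0 be the first index with G_(l0) nonzero. In [translate a G] the highest power of a is a^(g
    - l0), in the last coordinate only, with coefficient 'C(g - 1, l0 - 1) G_(l0), nonzero in
    characteristic 0. Putting a = (1 - b) / b and multiplying by b^K makes this a polynomial curve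
    in b through G at b = 1 and through the last point at b = 0. *)
Lemma degenerate_to_last m x : (0 < m)%N -> low_rank m x -> coords x 0 ord0 = 0 ->
  exists O, [/\ irreducible_set O, O `<=` low_rank m, O x & O (point last_point_neq0)].
Proof.
move=> m0 xm x0; set G := coords x in x0.
have [i0 Gi0] : exists i, G 0 i != 0 by apply/rV0Pn; apply: coords_neq0.
pose l0 := [arg min_(i < i0 | G 0 i != 0) (i : nat)].
have [Gl0 l0min] : G 0 l0 != 0 /\ forall i, G 0 i != 0 -> (l0 <= i)%N.
  by rewrite /l0; case: arg_minnP.
have l0_gt0 : (0 < l0)%N.
  rewrite lt0n; apply: contra Gl0 => /eqP l00; apply/eqP; rewrite -x0.
  by congr (G 0 _); apply: val_inj.
have Gsmall i : (i < l0)%N -> (i < g.+1)%N -> G 0 (inord i) = 0.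
  move=> lt_i lt_ig; apply/eqP; apply: contraLR lt_i => /l0min.
  by rewrite inordK // -leqNgt.
pose K := (g - l0)%N.
(* The subtraction K - (l - j) is truncated only where the coefficient of G or the binomial is
   zero. *)
pose term l j : {poly k} := ((1 - 'X) ^+ (l - j) * 'X ^+ (K - (l - j))) *+ 'C(l, j).
pose h (l : 'I_g.+1) : {poly k} := if l == 0%N :> nat then 0 else
  \sum_(j < g) G 0 (inord j.+1) *: term l.-1 j.
have termE l j b : (term l j).[b] =
    ((1 - b) ^+ (l - j) * b ^+ (K - (l - j))) *+ 'C(l, j).
  by rewrite hornerMn hornerM !horner_exp hornerD hornerN hornerC hornerX.
have hE (l : 'I_g.+1) b : (h l).[b] = if l == 0%N :> nat then 0 else
    \sum_(j < g) G 0 (inord j.+1) * (term l.-1 j).[b].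
  rewrite /h; case: ifP => _; first by rewrite horner0.
  by rewrite horner_sum; apply: eq_bigr => j _; rewrite hornerZ.
have h_unit b : b != 0 -> \row_l (h l).[b] = b ^+ K *: translate ((1 - b) / b) G.
  move=> b0; apply/rowP => l; rewrite !mxE hE; case: ifP => l_0; first by rewrite mulr0.
  rewrite mulr_sumr; apply: eq_bigr => j _; rewrite termE coef_XDn.
  have [lt_j|le_j] := ltnP j.+1 l0.
    by rewrite Gsmall ?mul0r ?mulr0 // ltnS.
  have le_K : (l.-1 - j <= K)%N by rewrite /K; have := ltn_ord l; lia.
  rewrite [RHS]mulrA [b ^+ K * _]mulrnAr mulrC; congr (_ *+ _ * _).
  rewrite expr_div_n mulrCA; congr (_ * _).
  by rewrite -[in RHS](subnK le_K) exprD mulfK // expf_neq0.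
have h_zero : \row_l (h l).[0] = ('C(g.-1, l0.-1)%:R * G 0 l0) *: last_point.
  apply/rowP => l; rewrite !mxE hE eqxx /=; have lt_lg := ltn_ord l.
  have lt_l0 : (l0.-1 < g)%N by have := ltn_ord l0; lia.
  have zero (j : 'I_g) : (j.+1 != l0) || (l < g)%N -> (0 < l)%N ->
      G 0 (inord j.+1) * (term l.-1 j).[0] = 0.
    move=> jl l_0; have [lt_j|le_j] := ltnP j.+1 l0; first by rewrite Gsmall ?mul0r ?ltnS.
    rewrite termE; have [lt_lj|le_jl] := ltnP l.-1 j.
      by rewrite bin_small // mulr0n mulr0.
    have -> : (K - (l.-1 - j) = (K - (l.-1 - j)).-1.+1)%N.
      by rewrite prednK // /K; lia.
    by rewrite exprSr mulr0 mulr0 mul0rn mulr0.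
  case: eqP => [l_0|/eqP l_0].
    by rewrite -val_eqE /= l_0 eq_sym gtn_eqF ?mulr0 //; lia.
  have [lg|lt_g] := eqVneq l ord_max; last first.
    rewrite mulr0 big1 // => j _; apply: zero; last by rewrite lt0n.
    by move: lt_g; rewrite -val_eqE /=; lia.
  rewrite mulr1 (bigD1 (Ordinal lt_l0)) //= big1 ?addr0 => [|j jl]; last first.
    by apply: zero; [rewrite -val_eqE /= in jl; lia|rewrite lt0n].
  rewrite prednK // termE lg /= (_ : (K - (g.-1 - l0.-1) = 0)%N); last by rewrite /K; lia.
  rewrite subr0 expr0 expr1n mulr1 mulrC; congr (_ * G 0 _).
  by apply: val_inj; rewrite /= inordK.
have bin_neq0 : 'C(g.-1, l0.-1)%:R != 0 :> k.
  rewrite (pcharf0P k).1 // -lt0n bin_gt0; have := ltn_ord l0; lia.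
(* For b nonzero, translation leaves the first nonzero coordinate unchanged. *)
have K_neq0 b : \row_l (h l).[b] != 0.
  have [->|b0] := eqVneq b 0.
    by rewrite h_zero scaler_eq0 mulf_eq0 !negb_or bin_neq0 Gl0 last_point_neq0.
  rewrite h_unit // scaler_eq0 expf_eq0 (negPf b0) andbF /=.
  apply/rV0Pn; exists l0; rewrite mxE gtn_eqF // /moment.
  have lt_l0 : (l0.-1 < g)%N by have := ltn_ord l0; lia.
  rewrite (bigD1 (Ordinal lt_l0)) //= coef_XDn subnn expr0 binn mul1r.
  have -> : inord l0.-1.+1 = l0 by apply: val_inj; rewrite /= prednK // inordK.
  rewrite big1 ?addr0 // => j jl; rewrite -val_eqE /= in jl.
  have [lt_j|le_j] := ltnP j.+1 l0; first by rewrite Gsmall ?mulr0 // ltnS.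
  by rewrite coef_XDn bin_small ?mulr0n ?mul0r //; lia.
exists [set y | exists t c, c != 0 /\ coords y = c *: \row_i (h i).[t]]; split.
- exact: parametrized_irreducible.
- move=> y [b [c [c0 yE]]]; rewrite /low_rank /= yE ribbon_matrixZ (eqmx_scale _ c0).
  have [->|b0] := eqVneq b 0.
    rewrite h_zero ribbon_matrixZ eqmx_scale ?mulf_neq0 //.
    exact: leq_trans rank_last_point m0.
  rewrite h_unit // ribbon_matrixZ eqmx_scale ?expf_neq0 //.
  exact: leq_trans (rank_translate _ x0) xm.
- exists 1, 1; split; rewrite ?oner_neq0 // scale1r h_unit ?oner_neq0 //.
  rewrite expr1n scale1r subrr mul0r; apply/rowP => l; rewrite mxE.
  case: eqP => [l_0|/eqP l_0].
    by rewrite -/G -x0; congr (G 0 _); apply: val_inj.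
  rewrite polyC0 addr0 momentXn; last by have := ltn_ord l; lia.
  by congr (G 0 _); apply: val_inj; rewrite /= inordK ?prednK ?lt0n.
- have [c c0 cE] := coords_point last_point_neq0.
  exists 0, (c / ('C(g.-1, l0.-1)%:R * G 0 l0)).
  have B0 : 'C(g.-1, l0.-1)%:R * G 0 l0 != 0 by rewrite mulf_neq0.
  split; first by rewrite mulf_neq0 ?invr_eq0.
  by rewrite h_zero scalerA divfK.
Qed.

End Degeneration.

(** * Hankel matrices and the secant variety *)

Section HankelCone.
Variables (k : closedFieldType) (g n : nat) (F : ribbon_data k g).
Local Notation proj := (proj_space k g).
Local Notation form := {mpoly k[g.+1]}.
Implicit Types (Z : set proj) (x : proj) (G : 'rV[k]_g.+1).

(* A vector c in the kernel of the (g - m) x (m + 1) Hankel matrix gives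
   n - m + 1 independent ones, its shifts, in that of the (g - n) x (n + 1) one. *)
Lemma rank_hankel m G : (m <= n)%N -> (n < g)%N -> G 0 ord0 = 0 ->
  (\rank (ribbon_matrix m F G) <= m)%N -> (\rank (ribbon_matrix n F G) <= m)%N.
Proof.
move=> le_mn lt_ng G0 rk_m.
have SE N i j : (ribbon_matrix N F G) i j = G 0 (inord (i + j).+1).
  by rewrite mxE G0 mulr0 addr0.
have hankel_mul N (p : {poly k}) (i : 'I_(g - N)) : (N < g)%N -> (size p <= N.+1)%N ->
    \sum_(j < N.+1) p`_j * ribbon_matrix N F G i j = moment G ('X^i * p).
  move=> lt_Ng le_p; rewrite {2}(poly_wide le_p) mulr_sumr moment_sum.
  apply: eq_bigr => j _; rewrite -scalerAr momentZ -exprD momentXn ?SE //.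
  by have := ltn_ord i; have := ltn_ord j; lia.
have : kermx (ribbon_matrix m F G)^T != 0.
  by rewrite kermx_eq0 -row_leq_rank mxrank_tr -ltnNge ltnS.
case/rowV0Pn=> c /sub_kermxP cS c0.
have size_c : (size (rVpoly c) <= m.+1)%N by apply: size_poly.
have poly_c0 : rVpoly c != 0.
  by apply: contraNneq c0 => pc; rewrite -(rVpolyK c) pc raddf0.
pose q (u : 'I_(n - m).+1) : {poly k} := 'X^u * rVpoly c.
have size_q u : (size (q u) <= n.+1)%N.
  rewrite /q mulrC size_mulXn //; apply: (leq_trans (leq_add (leqnn u) size_c)).
  by have := ltn_ord u; lia.
pose K : 'M[k]_((n - m).+1, n.+1) := \matrix_u poly_rV (q u).
have KS : K *m (ribbon_matrix n F G)^T = 0.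
  apply/row_matrixP => u; rewrite row_mul rowK row0; apply/rowP => i; rewrite !mxE.
  rewrite (eq_bigr (fun j : 'I_n.+1 => (q u)`_j * ribbon_matrix n F G i j)); last first.
    by move=> j _; rewrite !mxE.
  rewrite hankel_mul // /q mulrA -exprD.
  have lt_iu : (i + u < g - m)%N by have := ltn_ord i; have := ltn_ord u; lia.
  rewrite -(hankel_mul m _ (Ordinal lt_iu)) //; last by apply: leq_ltn_trans lt_ng.
  have /rowP/(_ (Ordinal lt_iu)) := cS; rewrite !mxE => cSi; rewrite -[RHS]cSi.
  by apply: eq_bigr => j _; rewrite coef_rVpoly_ord !mxE.
(* A relation among the shifts is a polynomial multiple of c that vanishes. *)
have K_free : row_free K.
  rewrite -kermx_eq0; apply: contraT => /rowV0Pn[w /sub_kermxP wK w0].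
  have poly_w0 : rVpoly w != 0.
    by apply: contraNneq w0 => pw; rewrite -(rVpolyK w) pw raddf0.
  have : rVpoly w * rVpoly c = 0.
    rewrite (poly_wide (size_poly _ _ : size (rVpoly w) <= (n - m).+1)%N) mulr_suml.
    rewrite (eq_bigr (fun u : 'I_(n - m).+1 => w 0 u *: q u)); last first.
      by move=> u _; rewrite coef_rVpoly_ord -scalerAl.
    apply/polyP => j; rewrite coef0 coef_sum.
    have [lt_j|le_j] := ltnP j n.+1; last first.
      rewrite big1 // => u _; rewrite coefZ nth_default ?mulr0 //.
      exact: leq_trans (size_q u) le_j.
    have /rowP/(_ (Ordinal lt_j)) := wK; rewrite !mxE => wKj; rewrite -[RHS]wKj.
    by apply: eq_bigr => u _; rewrite coefZ !mxE.
  by move/eqP; rewrite mulf_eq0 (negPf poly_w0) (negPf poly_c0).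
have : (K <= kermx (ribbon_matrix n F G)^T)%MS by apply/sub_kermxP.
move/mxrankS; rewrite mxrank_ker mxrank_tr (eqP (_ : row_free K)) //.
by have := rank_leq_col (ribbon_matrix n F G); lia.
Qed.

End HankelCone.

Section Secants.
Variables (k : closedFieldType) (g : nat) (F : ribbon_data k g).
Local Notation proj := (proj_space k g).
Implicit Types (Z : set proj) (x : proj) (G : 'rV[k]_g.+1).

Lemma det_antidiagonal (m : nat) :
  \det (\matrix_(u < m, v < m) ((u + v).+1 == m)%:R) != 0 :> k.
Proof.
set T := \matrix_(_, _) _.
have TT : T *m T = 1%:M.
  apply/matrixP => u w; rewrite !mxE (bigD1 (rev_ord u)) //= !mxE /=.
  have -> : ((u + (m - u.+1)).+1 == m) = true by have := ltn_ord u; lia.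
  rewrite mul1r big1 ?addr0 => [|v vu].
    by congr (nat_of_bool _)%:R; rewrite -val_eqE /=; have := ltn_ord u; have := ltn_ord w; lia.
  rewrite !mxE [_ == m](_ : _ = false) ?mul0r //.
  apply: contraNF vu => /eqP uv; apply/eqP/val_inj; rewrite /=; lia.
have : \det (T *m T) != 0 by rewrite TT det1 oner_neq0.
by rewrite det_mulmx; apply: contraNneq => ->; rewrite mulr0.
Qed.

(* Z is the m-th secant variety of the rational normal curve in G_0 = 0. *)
Lemma secant_chain n m : (0 < m)%N -> (m <= n)%N -> (n < g)%N -> (2 * m < g)%N ->
  exists Z, [/\ irreducible_set Z, closed Z, Z `<=` low_rank n F m,
    Z `<=` hypersurface 'X_ord0 &
    forall d, chain_bound Z d -> (2 * m - 1 <= d)%N].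
Proof.
move=> m0 le_mn lt_ng lt_mg.
pose es : seq {mpoly k[g.+1]} := [:: 'X_ord0].
have hes p : p \in es -> homogeneous p.
  by rewrite inE => /eqP->; apply: homogeneousX.
(* The point whose only nonzero coordinate is G_m: its matrix has ones on the antidiagonal of the
   upper left m x m block and zeros elsewhere, so rank m is attained. *)
pose v : 'rV[k]_g.+1 := delta_mx 0 (inord m).
have lt_m : (m < g.+1)%N by lia.
have v0 : v != 0 by apply/rV0Pn; exists (inord m); rewrite mxE !eqxx oner_neq0.
have vord0 : v 0 ord0 = 0.
  rewrite mxE eqxx /= -val_eqE /= inordK // [_ == _](_ : _ = false) //; lia.
have SE i j : ribbon_matrix m F v i j = ((i + j).+1 == m)%:R.
  rewrite mxE vord0 mulr0 addr0 mxE eqxx /= -val_eqE /= !inordK //.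
  have := ltn_ord i; have := ltn_ord j; lia.
have lt_a (u : 'I_m) : (u < g - m)%N by have := ltn_ord u; lia.
pose a (u : 'I_m) := Ordinal (lt_a u); pose b (u : 'I_m) := widen_ord (leqnSn m) u.
have rk_v : (\rank (ribbon_matrix m F v) <= m)%N.
  have -> : ribbon_matrix m F v =
      (\matrix_(i < g - m, u < m) (i == u :> nat)%:R) *m rowsub a (ribbon_matrix m F v).
    apply/matrixP => i j; rewrite [RHS]mxE SE.
    have [lt_im|le_mi] := ltnP i m.
      rewrite (bigD1 (Ordinal lt_im)) //= [X in X * _]mxE eqxx mulr1n mul1r.
      rewrite big1 ?addr0; first by rewrite mxE SE.
      move=> u ui; rewrite [X in X * _]mxE [_ == _ :> nat](_ : _ = false) ?mul0r //.
      by apply: contraNF ui => /eqP iu; apply/eqP/val_inj.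
    rewrite big1 => [|u _]; last first.
      by rewrite [X in X * _]mxE gtn_eqF ?mul0r // (leq_trans (ltn_ord u)).
    by rewrite gtn_eqF // ltnS (leq_trans le_mi) ?leq_addr.
  exact: leq_trans (mxrankM_maxr _ _) (rank_leq_row _).
pose A := low_rank m F m `&` zeros es.
pose x := point v0; have [c c0 xE] := coords_point v0.
have Ax : A x.
  split; first exact/low_rank_point.
  by move=> p; rewrite inE => /eqP->; rewrite /hypersurface /= pevalX xE mxE vord0 mulr0.
have cA : closed A.
  by apply: closedI; [apply: closed_low_rank | apply: closed_zeros].
have [Z Zcomp Zx] := component_through Ax; have [Zirr ZA _] := Zcomp.
have ZX : Z `<=` hypersurface 'X_ord0.
  by move=> y /ZA[_]; apply; rewrite inE eqxx.
exists Z; split=> //.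
- exact: component_closed cA Zcomp.
- move=> y Zy; apply: (rank_hankel le_mn) => //; last by have [] := ZA y Zy.
  by have := ZX y Zy; rewrite /hypersurface /= pevalX.
move=> d Zd; have det_x : \det (mxsub a b (ribbon_matrix m F (coords x))) != 0.
  have -> : mxsub a b (ribbon_matrix m F (coords x)) =
      c *: \matrix_(u < m, w < m) ((u + w).+1 == m)%:R.
    by apply/matrixP => u w; rewrite xE ribbon_matrixZ [LHS]mxE [LHS]mxE SE !mxE.
  by rewrite detZ mulf_neq0 ?expf_neq0 ?det_antidiagonal.
(* One equation for G_0 = 0 and (g - 2 m) * 1 bordered forms leave dimension at least 2 m - 1. *)
have := low_rank_component_dimension hes Zcomp Zx det_x Zd.
by rewrite /= subSnn muln1; lia.
Qed.

End Secants.

Theorem theorem2p7 (k : closedFieldType) (char0 : [pchar k] =i pred0)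
    (g n r : nat) (lt_rn : (r < n)%N) (le_2n_g : (2 * n <= g - 1)%N)
    (F : ribbon_data k g) :
  let rho : int := g%:Z - (r%:Z + 1) * (g%:Z - 2 * n%:Z + r%:Z) in
  let W := Wbar r n F in
  [/\ W !=set0 /\
        (has_dim W (2 * n - 2 * r - 1) \/ has_dim W (2 * n - 2 * r)),
      0 <= rho -> forall Z, irreducible_component W Z ->
        exists2 d : nat, has_dim Z d & rho <= d%:Z
    & 0 < rho -> connected W].
Proof.
move=> rho W; pose m := (n - r)%N.
have WE : W = low_rank n F m by apply: Wbar_low_rank.
have m0 : (0 < m)%N by rewrite subn_gt0.
have le_mn : (m <= n)%N by apply: leq_subr.
have lt_ng : (n < g)%N by lia.
have lt_mgn : (m < g - n)%N by lia.
have cW : closed W by rewrite WE; apply: closed_low_rank.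
have W_bound : chain_bound W (2 * m) by rewrite WE; apply: low_rank_chain_bound.
have comp_dim Z : irreducible_component W Z ->
    exists2 d, has_dim Z d & rho <= d%:Z.
  move=> Zcomp; have [Zirr ZW _] := Zcomp.
  have cZ := component_closed cW Zcomp.
  have [d Zd Z_bound] := has_dim_bounded Zirr cZ (fun _ => id)
    (chain_bound_sub cZ ZW W_bound).
  exists d => //; rewrite WE in Zcomp.
  have [x Zx rk_x] := generic_rank lt_mgn (leq_ltn_trans le_mn (ltnSn n)) m0 Zcomp.
  (* The rank at x is m, so some m-minor is nonzero there. *)
  have [a [b det_x]] : exists a b,
      \det (mxsub (m' := m) (n' := m) a b (ribbon_matrix n F (coords x))) != 0.
    apply: contrapT => no.
    suff : (\rank (ribbon_matrix n F (coords x)) <= m.-1)%N by rewrite rk_x; lia.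
    apply/rank_le_minors; rewrite prednK // => a b.
    by apply/eqP/contraT => det_x; exfalso; apply: no; exists a, b.
  have hnil p : p \in ([::] : seq {mpoly k[g.+1]}) -> homogeneous p by rewrite in_nil.
  have Zcomp0 : irreducible_component (low_rank n F m `&` zeros [::]) Z.
    by rewrite (_ : _ `&` _ = low_rank n F m) //; apply/setIidPl => y _ p; rewrite in_nil.
  have := low_rank_component_dimension hnil Zcomp0 Zx det_x Z_bound.
  have -> : (n.+1 - m = r.+1)%N by rewrite /m; lia.
  have : (g - n - m)%N%:Z = g%:Z - 2 * n%:Z + r%:Z by rewrite /m; lia.
  rewrite /rho add0n => <-; move: (g - n - m)%N => A; nia.
have [|Y [Yirr cY YW YX Y_bound]] := secant_chain F m0 le_mn lt_ng; first by lia.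
rewrite -WE in YW.
split.
- split; first by have [[y Yy] _] := Yirr; exists y; apply: YW.
  have [e We We_bound] := has_dim_bounded Yirr cY YW W_bound.
  have le_e : (e <= 2 * m)%N by apply: W_bound; case: We.
  have ge_e := Y_bound e (chain_bound_sub cY YW We_bound).
  have [<-|e_ne] := eqVneq e (2 * n - 2 * r)%N; [by right|left].
  by rewrite (_ : (2 * n - 2 * r - 1)%N = e) //; rewrite /m in le_e ge_e; lia.
- by move=> _; apply: comp_dim.
move=> rho0; pose last := point (@last_point_neq0 k g).
have W_link x : W x -> exists C, [/\ connected C, C `<=` W, C x & C last].
  move=> Wx; have [Z Zcomp Zx] := component_through Wx; have [Zirr ZW _] := Zcomp.
  (* A component off the hyperplane would have dimension 0, below rho. *)
  have [y [Zy y0]] : exists y, Z y /\ coords y 0 ord0 = 0.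
    apply: contrapT => no; have [d Zd rho_d] := comp_dim Z Zcomp.
    have cZ := component_closed cW Zcomp.
    have Z0 z : Z z -> coords z 0 ord0 != 0.
      by move=> Zz; apply: contra_notN no => /eqP z0; exists z.
    have Zb := growth_chain_bound cZ (missing_hyperplane_growth cZ Z0).
    have := Zb d Zd.1; lia.
  have ym : low_rank n F m y by rewrite -WE; apply: ZW.
  have [O [Oirr OW Oy Olast]] := degenerate_to_last char0 lt_ng m0 ym y0.
  (* Every point is joined to the same last point, through its component and a degeneration that
     meet at y. *)
  exists (Z `|` O); split.
  - by apply: connectedU; [exists y | apply: irreducible_connected..].
  - by move=> z [/ZW//|/OW]; rewrite WE.
  - by left.
  - by right.
have -> : W = \bigcup_(C in [set C | [/\ connected C, C `<=` W & C last]]) C.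
  apply/seteqP; split=> [x /W_link[C [C1 C2 C3 C4]]|x [C [_ CW _]]]; last exact: CW.
  by exists C.
by apply: bigcup_connected => [|C []]; first by exists last => C [].
Qed.
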